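(* Let $\mathcal{A}$ be a van Hove sequence on $G$ and let $\mu$ be a translation bounded measure on $G$. Then $\mu$ is Besicovitch $2$-almost periodic with respect to $\mathcal{A}$ if and only if the following three conditions hold: (a) The autocorrelation $\gamma$ of $\mu$ exists with respect to $\mathcal{A}$, and $\widehat{\gamma}$ is a pure point measure. (b) The Fourier--Bohr coefficients $a_\chi^{\mathcal{A}}(\mu)$ exist for all $\chi\in\widehat{G}$. (c) For all $\chi\in\widehat{G}$, the consistent phase property $\widehat{\gamma}(\{\chi\})=|a_\chi^{\mathcal{A}}(\mu)|^2$ holds.
   Context: $G$ is a locally compact (Hausdorff), $\sigma$-compact abelian group with Haar measure $\theta_G$; $|A|=\theta_G(A)$, and $\mathrm{d}t$ denotes integration against $\theta_G$. $\widehat{G}$ is the dual group. $\widetilde g(s)=\overline{g(-s)}$. A measure on $G$ is a (complex) Radon measure; $|\mu|$ is its total variation; $\widetilde\mu(g)=\overline{\mu(\widetilde g)}$. $\mu$ is translation bounded if $\sup_{t\in G}|\mu|(t+V)<\infty$ for one (equivalently every) nonempty open relatively compact $V$. $(\mu*\varphi)(t)=\int_G\varphi(t-s)\,\mathrm{d}\mu(s)$ for $\varphi\in C_c(G)$. A van Hove sequence $\mathcal{A}=(A_n)$ is a sequence of relatively compact open sets (of positive measure) with $|\partial^K A_n|/|A_n|\to 0$ for every compact $K\subseteq G$, where $\partial^K A=\big(\overline{A+K}\cap\overline{A^c}\big)\cup\big(\overline{A^c-K}\cap\overline{A}\big)$. The autocorrelation $\gamma$ of $\mu$ with respect to $\mathcal{A}$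 is the vague limit of $\frac{1}{|A_n|}\,\mu|_{A_n}*\widetilde{\mu}|_{-A_n}$, if it exists. It is positive definite, and $\widehat\gamma$ is the unique positive measure on $\widehat G$ with $\int_{\widehat G}|\check\varphi|^2\,\mathrm{d}\widehat\gamma=\int_G(\varphi*\widetilde\varphi)\,\mathrm{d}\gamma$ for all $\varphi\in C_c(G)$, where $\check\varphi(\chi)=\int_G\chi(t)\varphi(t)\,\mathrm{d}t$. The Fourier--Bohr coefficient is $a_\chi^{\mathcal{A}}(\mu)=\lim_{n\to\infty}\frac{1}{|A_n|}\int_{A_n}\overline{\chi(t)}\,\mathrm{d}\mu(t)$, if the limit exists. A trigonometric polynomial is a finite linear combination of characters $\chi\in\widehat G$. For $f\in\mathcal{L}^2_{loc}(G)$ put $\|f\|_{\mathsf{B},2,\mathcal{A}}=\limsup_n\big(\frac{1}{|A_n|}\int_{A_n}|f(t)|^2\,\mathrm{d}t\big)^{1/2}$. A function $f\in\mathcal{L}^2_{loc}(G)$ is Besicovitch $2$-almost periodic with respect to $\mathcal{A}$ if for each $\varepsilon>0$ there is a trigonometric polynomial $P$ with $\|f-P\|_{\mathsf{B},2,\mathcal{A}}<\varepsilon$. A measure $\mu$ is Besicovitch $2$-almost periodic with respect to $\mathcal{A}$ if $\mu*\varphi$ is a Besicovitch $2$-almost periodic function for all $\varphi\in C_c(G)$. *)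

(* Defs.v *)
From HB Require Import structures.
From mathcomp Require Import all_boot all_order all_algebra.
From mathcomp Require Import complex.
From mathcomp Require Import all_classical all_reals all_analysis.

Set Implicit Arguments.
Unset Strict Implicit.
Unset Printing Implicit Defensive.

Import Order.TTheory GRing.Theory Num.Theory.
Import numFieldNormedType.Exports.

Local Open Scope classical_set_scope.
Local Open Scope complex_scope.
Local Open Scope ring_scope.

(* Modulus as an element of R (the norm `|z| of R[i] takes values in R[i]). *)
Definition cabs (R : realType) (z : R[i]) : R := ComplexField.Normc.normc z.

(* Measurable types are pointed in the library: the Borel sigma-algebra of G is
   put on the alias [pointed G] of G, pointed by 0. *)
Definition pointed (G : topologicalZmodType) : Type := G.

HB.instance Definition _ (G : topologicalZmodType) :=
  Topological.copy (pointed G) G.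
HB.instance Definition _ (G : topologicalZmodType) :=
  isPointed.Build (pointed G) (0 : G).

Notation borel X := (g_sigma_algebraType (@open X)).

Definition sigma_compact (X : topologicalType) :=
  exists K : nat -> set X, (forall n, compact (K n)) /\ \bigcup_n K n = setT.

Definition relatively_compact (X : topologicalType) (A : set X) :=
  compact (closure A).

(* Positive Radon measures as Borel measures which are finite on compact sets
   and inner regular on all Borel sets.  On a locally compact Hausdorff space
   these correspond bijectively to the positive functionals on C_c(X), also
   when X is not sigma-compact (as may happen for the dual of G). *)
Definition radon_measure (R : realType) (X : ptopologicalType)
    (nu : set (borel X) -> \bar R) :=
  (forall K : set X, compact K -> (nu K < +oo)%E) /\
  (forall B : set (borel X), measurable B ->
     nu B = ereal_sup [set nu K | K in [set K : set X | compact K /\ K `<=` B]]).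

Definition pure_point (R : realType) (X : ptopologicalType)
    (nu : set (borel X) -> \bar R) :=
  forall B : set (borel X), measurable B ->
    nu B = \esum_(x in B) nu [set x].

Definition haar_measure (R : realType) (G : topologicalZmodType)
    (theta : set (borel (pointed G)) -> \bar R) :=
  [/\ radon_measure theta,
      forall (t : G) (B : set (borel (pointed G))), measurable B ->
        theta [set t + (x : G) | x in B] = theta B
    & theta setT != 0%E].

Section complex_radon.
Context {R : realType} {G : topologicalZmodType}.
Implicit Types (f g phi : G -> R[i]) (mu nu : (G -> R[i]) -> R[i]).

Definition Cc f :=
  continuous (f : G -> R[i]^o) /\ relatively_compact [set x | f x != 0].

(* A complex Radon measure is a linear functional on C_c(G) which is continuous
   for the inductive limit topology; its values outside C_c(G) are irrelevant
   (and never used below). *)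
Definition cradon mu :=
  [/\ forall (a : R[i]) f g, Cc f -> Cc g ->
        mu (fun x => a * f x + g x) = a * mu f + mu g
    & forall K : set G, compact K -> exists c : R, forall f (m : R),
        Cc f -> (forall x, ~ K x -> f x = 0) -> (forall x, cabs (f x) <= m) ->
        cabs (mu f) <= c * m].

(* Integration theory of mu in the sense of Bourbaki: |mu|^*(h) is, for h lower
   semicontinuous, the supremum of |mu(g)| over the g in C_c(G) with |g| <= h;
   for arbitrary f >= 0 it is the infimum of |mu|^*(h) over lower semicontinuous
   h >= f.  A function is mu-integrable when it is a limit of functions in
   C_c(G) for the seminorm |mu|^*(|.|), and its integral is the corresponding
   limit of the values of mu. *)
Definition radon_lsc_integral mu (h : G -> \bar R) : \bar R :=
  ereal_sup [set (cabs (mu g))%:E |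
    g in [set g | Cc g /\ forall x, ((cabs (g x))%:E <= h x)%E]].

Definition radon_upper_integral mu (f : G -> \bar R) : \bar R :=
  ereal_inf [set radon_lsc_integral mu h |
    h in [set h | lower_semicontinuous h /\ forall x, (f x <= h x)%E]].

Definition radon_variation mu (E : set G) : \bar R :=
  radon_upper_integral mu (fun x => (\1_E x)%:E).

Definition has_radon_integral mu f (z : R[i]) :=
  forall e : R, 0 < e -> exists g,
    [/\ Cc g, (radon_upper_integral mu (fun x => (cabs (f x - g x))%:E) < e%:E)%E
      & cabs (z - mu g) < e].

(* Only used for functions \1_A * f with A open and relatively compact and f
   continuous; these are mu-integrable, so the default value 0 is irrelevant. *)
Definition radon_integral mu f : R[i] := xget 0 [set z | has_radon_integral mu f z].

Definition radon_restrict mu (A : set G) : (G -> R[i]) -> R[i] :=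
  fun f => radon_integral mu (fun x => \1_A x * f x).

Definition fun_tilde g : G -> R[i] := fun s => (g (- s))^*.

Definition radon_tilde mu : (G -> R[i]) -> R[i] := fun g => (mu (fun_tilde g))^*.

Definition radon_conv mu nu : (G -> R[i]) -> R[i] :=
  fun f => mu (fun s => nu (fun t => f (s + t))).

Definition radon_fun_conv mu phi : G -> R[i] := fun t => mu (fun s => phi (t - s)).

Definition translation_bounded mu :=
  exists V : set G, [/\ open V, V !=set0, relatively_compact V
    & (ereal_sup [set radon_variation mu [set (t + x)%R | x in V]
                  | t in [set: G]] < +oo)%E].

End complex_radon.

Record dual (R : realType) (G : topologicalZmodType) := Dual {
  dual_fun :> G -> R[i]^o ;
  dual_continuous : continuous dual_fun ;
  dual_add : forall s t, dual_fun (s + t) = dual_fun s * dual_fun t ;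
  dual_abs : forall t, cabs (dual_fun t) = 1 }.

Section dual_instances.
Context (R : realType) (G : topologicalZmodType).

Definition trivial_character : dual R G.
Proof.
exists (fun=> 1).
- exact: cst_continuous.
- by move=> s t; rewrite mulr1.
- by move=> t; exact: ComplexField.Normc.normc1.
Defined.

HB.instance Definition _ := gen_eqMixin (dual R G).
HB.instance Definition _ := gen_choiceMixin (dual R G).
HB.instance Definition _ := isPointed.Build (dual R G) trivial_character.
HB.instance Definition _ := Topological.copy (dual R G)
  (initial_topology
     (@dual_fun R G : dual R G -> {compact-open, G -> R[i]^o})).

End dual_instances.

Section averages.
Context {R : realType} {G : topologicalZmodType}.
Variables (theta : set (borel (pointed G)) -> \bar R) (A : nat -> set G).
Implicit Types (f g phi : G -> R[i]) (mu gamma : (G -> R[i]) -> R[i]).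

Definition vh_boundary (K B : set G) : set G :=
  (closure [set b + k | b in B & k in K] `&` closure (~` B)) `|`
  (closure [set b - k | b in ~` B & k in K] `&` closure B).

Definition vol (n : nat) : R := fine (theta (A n)).

Definition van_hove :=
  [/\ forall n, open (A n), forall n, relatively_compact (A n),
      forall n, (0 < theta (A n))%E
    & forall K : set G, compact K ->
        (fun n => (theta (vh_boundary K (A n)) * ((vol n)^-1)%:E)%E) @ \oo
          --> 0%E].

Definition autocorrelation_approx mu (n : nat) : (G -> R[i]) -> R[i] :=
  fun phi => ((vol n)^-1)%:C *
    radon_conv (radon_restrict mu (A n))
      (radon_restrict (radon_tilde mu) [set - x | x in A n]) phi.

Definition is_autocorrelation mu gamma :=
  cradon gamma /\ forall phi, Cc phi ->
    (fun n => autocorrelation_approx mu n phi : R[i]^o) @ \oo --> (gamma phi : R[i]^o).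

Definition fourier_bohr_mean mu (chi : dual R G) (n : nat) : R[i]^o :=
  ((vol n)^-1)%:C * radon_restrict mu (A n) (fun t => (chi t)^*).

Definition fourier_bohr_exists mu (chi : dual R G) : Prop :=
  cvg (fourier_bohr_mean mu chi @ \oo).

Definition fourier_bohr mu (chi : dual R G) : R[i] :=
  lim (fourier_bohr_mean mu chi @ \oo).

End averages.

Section haar_integrals.
Context {R : realType} {G : topologicalZmodType}.
Variables (theta : {measure set (borel (pointed G)) -> \bar R}).
Implicit Types (f g phi : G -> R[i]) (mu gamma : (G -> R[i]) -> R[i]).

Definition haar_integral f : R[i] :=
  (\int[theta]_t complex.Re (f t))%R +i* (\int[theta]_t complex.Im (f t))%R.

Definition fun_conv f g : G -> R[i] :=
  fun t => haar_integral (fun s => f (t - s) * g s).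

Definition fcheck phi (chi : dual R G) : R[i] :=
  haar_integral (fun t => chi t * phi t).

Definition is_fourier_transform gamma
    (gammahat : {measure set (borel (dual R G)) -> \bar R}) :=
  radon_measure gammahat /\ forall phi, Cc phi ->
    exists2 r : R, gamma (fun_conv phi (fun_tilde phi)) = r%:C
      & (\int[gammahat]_chi ((cabs (fcheck phi chi)) ^+ 2)%:E)%E = r%:E.

Definition L2loc f :=
  [/\ measurable_fun setT ((fun t => complex.Re (f t)) : borel (pointed G) -> R),
      measurable_fun setT ((fun t => complex.Im (f t)) : borel (pointed G) -> R)
    & forall K : set G, compact K ->
        (\int[theta]_(t in K) ((cabs (f t)) ^+ 2)%:E < +oo)%E].

Definition trig_poly (P : G -> R[i]) :=
  exists (n : nat) (c : 'I_n -> R[i]) (chi : 'I_n -> dual R G),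
    forall t, P t = \sum_(i < n) c i * chi i t.

Variable A : nat -> set G.

Definition besicovitch_norm f : \bar R :=
  limn_esup (fun n => (((vol theta A n)^-1)%:E *
    \int[theta]_(t in A n) ((cabs (f t)) ^+ 2)%:E) `^ 2^-1)%E.

Definition besicovitch_ap f :=
  L2loc f /\ forall e : R, 0 < e ->
    exists2 P, trig_poly P & (besicovitch_norm (fun t => (f t - P t)%R) < e%:E)%E.

Definition besicovitch_ap_measure mu :=
  forall phi, Cc phi -> besicovitch_ap (radon_fun_conv mu phi).

End haar_integrals.

(* Main.v *)
(* For [f] in C_c(G) write [F = mu * f].  Up to van Hove boundary terms,
   [gamma_n (f * f~)] is the mean of [|F|^2] over [A n], and the mean of
   [F chi^*] is the n-th Fourier-Bohr mean of [mu] at [chi] times [fcheck f chi].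
   Characters are asymptotically orthonormal for the means, so [F] is Besicovitch
   almost periodic iff these limits exist and satisfy Parseval's identity
     [lim mean |F|^2 = sum_chi |a_chi|^2 |fcheck f chi|^2].
   The left-hand side is [gamma (f * f~)], and the right-hand side is the integral
   of [|fcheck f|^2] against the pure point measure with masses [|a_chi|^2].
   Hence Parseval for all [f] says exactly that this measure is the Fourier
   transform of [gamma].  No Bochner theorem is needed: in the direct implication
   the limits exist for all [f * f~], hence by polarisation and an approximate
   identity [gamma] exists, and its Fourier transform is given explicitly. *)
From HB Require Import structures.
Require Import Defs.
From mathcomp Require Import all_boot all_order all_algebra.
From mathcomp Require Import finmap complex.
From mathcomp Require Import all_classical all_reals all_analysis.
From mathcomp Require Import measurable_realfun.
From mathcomp Require Import ring lra.
Set Implicit Arguments.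
Unset Strict Implicit.
Unset Printing Implicit Defensive.
Import Order.TTheory GRing.Theory Num.Theory.
Import numFieldNormedType.Exports.
Local Open Scope classical_set_scope.
Local Open Scope complex_scope.
Local Open Scope ring_scope.

(** * Complex numbers *)

Section complex_modulus.
Context {R : realType}.
Implicit Types (z w : R[i]) (r e : R) (u v : nat -> R[i]).

(** The obstacle is the sharp restriction of [mu] to [A n]: it is defined by upper integrals and a
    choice, so neither linearity nor Fubini is immediate for it. It is replaced by [h mu], where [h]
    in C_c(G) fills [A n] up to a [|mu|]-error [eps] (see [fills]). For [h mu] the convolution
    identities are exact, without boundary terms. The true approximants differ from these by at most
    a constant times [eps], where the constant may depend on [n]: the limit [eps -> 0] is taken at
    fixed [n], and only then [n -> oo], which removes the van Hove boundary. Translation boundedness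
    enters twice. It makes [mu * f] bounded and continuous, and it bounds the approximants of the
    autocorrelation uniformly in [n]; the uniform bound carries the approximate identity argument
    and gives the limit the continuity of a Radon measure. For each [n] the means define a genuine
    semi-inner product [ip n], and only the orthogonality of distinct characters is asymptotic; so
    the Hilbert space algebra is done at fixed [n], before any limit. *)

Lemma cabs_ge0 z : 0 <= cabs z.
Proof. by case: z => a b; exact: sqrtr_ge0. Qed.

Lemma cabs0 : cabs (0 : R[i]) = 0.
Proof. exact: ComplexField.Normc.normc0. Qed.

Lemma cabs1 : cabs (1 : R[i]) = 1.
Proof. exact: ComplexField.Normc.normc1. Qed.

Lemma cabsM z w : cabs (z * w) = cabs z * cabs w.
Proof. exact: ComplexField.Normc.normcM. Qed.

Lemma cabsN z : cabs (- z) = cabs z.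
Proof. exact: normcN. Qed.

Lemma cabs_distC z w : cabs (z - w) = cabs (w - z).
Proof. by rewrite -cabsN opprB. Qed.

Lemma cabsD z w : cabs (z + w) <= cabs z + cabs w.
Proof. exact: le_normcD. Qed.

Lemma cabsB z w : cabs (z - w) <= cabs z + cabs w.
Proof. by rewrite (le_trans (cabsD _ _))// cabsN. Qed.

Lemma cabs_sub_le z w t : cabs (z - w) <= cabs (z - t) + cabs (t - w).
Proof. by rewrite (le_trans _ (cabsD _ _))// addrA subrK. Qed.

Lemma cabs_eq0 z : cabs z = 0 -> z = 0.
Proof. exact: ComplexField.Normc.eq0_normc. Qed.

Lemma cabs_conj z : cabs z^* = cabs z.
Proof. by case: z => a b; rewrite /cabs/= sqrrN. Qed.

Lemma cabs_real r : cabs r%:C = `|r|.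
Proof. by rewrite /cabs/= expr0n addr0 sqrtr_sqr. Qed.

Lemma sqr_cabs z : cabs z ^+ 2 = complex.Re z ^+ 2 + complex.Im z ^+ 2.
Proof. by case: z => a b; rewrite /cabs/= sqr_sqrtr// addr_ge0 ?sqr_ge0. Qed.

Lemma Re_le_cabs z : `|complex.Re z| <= cabs z.
Proof.
rewrite -(@ler_pXn2r _ 2)// ?nnegrE ?cabs_ge0//.
by rewrite real_normK ?num_real// sqr_cabs lerDl sqr_ge0.
Qed.

Lemma Im_le_cabs z : `|complex.Im z| <= cabs z.
Proof.
rewrite -(@ler_pXn2r _ 2)// ?nnegrE ?cabs_ge0//.
by rewrite real_normK ?num_real// sqr_cabs lerDr sqr_ge0.
Qed.

Lemma cabs_le_ReIm z : cabs z <= `|complex.Re z| + `|complex.Im z|.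
Proof.
rewrite -(@ler_pXn2r _ 2)// ?nnegrE ?cabs_ge0// ?addr_ge0//.
rewrite sqr_cabs sqrrD !real_normK ?num_real//.
have := mulr_ge0 (normr_ge0 (complex.Re z)) (normr_ge0 (complex.Im z)).
nra.
Qed.

Lemma mulcJ z : z * z^* = (cabs z ^+ 2)%:C.
Proof.
case: z => a b; rewrite sqr_cabs; apply/eqP; rewrite eq_complex/=.
by apply/andP; split; apply/eqP; ring.
Qed.

Lemma normc_cabs z : `|z| = (cabs z)%:C.
Proof. by []. Qed.

Lemma cReD z w : complex.Re (z + w) = complex.Re z + complex.Re w.
Proof. by case: z; case: w. Qed.

Lemma cImD z w : complex.Im (z + w) = complex.Im z + complex.Im w.
Proof. by case: z; case: w. Qed.

Lemma cReN z : complex.Re (- z) = - complex.Re z.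
Proof. by case: z. Qed.

Lemma cImN z : complex.Im (- z) = - complex.Im z.
Proof. by case: z. Qed.

Lemma cReM z w : complex.Re (z * w) =
  complex.Re z * complex.Re w - complex.Im z * complex.Im w.
Proof. by case: z; case: w. Qed.

Lemma cImM z w : complex.Im (z * w) =
  complex.Re z * complex.Im w + complex.Im z * complex.Re w.
Proof. by case: z => a b; case: w => c d /=; ring. Qed.

Lemma cRe_conj z : complex.Re z^* = complex.Re z.
Proof. by case: z. Qed.

Lemma cIm_conj z : complex.Im z^* = - complex.Im z.
Proof. by case: z. Qed.

Lemma conjcM z w : (z * w)^* = z^* * w^*.
Proof. exact: rmorphM. Qed.

Lemma conjcD z w : (z + w)^* = z^* + w^*.
Proof. exact: rmorphD. Qed.

Lemma conjcN z : (- z)^* = - z^*.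
Proof. exact: rmorphN. Qed.

Lemma conjc_0 : (0 : R[i])^* = 0.
Proof. exact: rmorph0. Qed.

Lemma conjc_1 : (1 : R[i])^* = 1.
Proof. exact: rmorph1. Qed.

Lemma conjc_K z : z^*^* = z.
Proof. exact: conjcK. Qed.

Lemma conjc_R r : r%:C^* = r%:C.
Proof. exact: conjc_real. Qed.

Lemma realcM r e : (r * e)%:C = r%:C * e%:C.
Proof. exact: rmorphM. Qed.

Lemma realcD r e : (r + e)%:C = r%:C + e%:C.
Proof. exact: rmorphD. Qed.

Lemma realcB r e : (r - e)%:C = r%:C - e%:C.
Proof. exact: rmorphB. Qed.

(** Convergence with a real radius. The norm of [R[i]] takes values in [R[i]], so the radii of the
    library are positive elements of [R[i]]; [climP] translates between the two. *)
Definition clim u z := forall e, 0 < e -> \forall n \near \oo, cabs (u n - z) < e.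

Lemma climP (u : nat -> R[i]^o) (z : R[i]^o) : clim u z <-> u @ \oo --> z.
Proof.
split=> [ulim|/cvgrPdist_lt ulim e e0].
  apply/cvgrPdist_lt => e; case: e => a b; rewrite ltcE/= => /andP[/eqP -> a0].
  near=> n; rewrite distrC normc_cabs ltcR; near: n; exact: ulim.
have /ulim : 0 < e%:C :> R[i] by rewrite ltcR.
apply: filterS => n; rewrite distrC normc_cabs ltcR.
exact.
Unshelve. all: by end_near. Qed.

Lemma clim_unique u z w : clim u z -> clim u w -> z = w.
Proof.
move=> uz uw; apply/eqP; rewrite -subr_eq0; apply/eqP/cabs_eq0/eqP.
rewrite eq_le cabs_ge0 andbT; apply/ler_addgt0Pr => e e0; rewrite add0r.
have e20 : 0 < e / 2 by rewrite divr_gt0.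
near \oo => n.
rewrite (le_trans (cabs_sub_le _ _ (u n)))// [e]splitr lerD// ltW//.
  by rewrite cabs_distC; near: n; exact: uz.
by near: n; exact: uw.
Unshelve. all: by end_near. Qed.

Lemma clim_cst z : clim (fun=> z) z.
Proof. by move=> e e0; apply: nearW => n; rewrite subrr cabs0. Qed.

Lemma clim0_squeeze u (v : nat -> R) :
  (\forall n \near \oo, cabs (u n) <= v n) -> v @ \oo --> (0 : R) -> clim u 0.
Proof.
move=> uv /cvgrPdist_lt v0 e e0; near=> n; rewrite subr0.
have /le_lt_trans : cabs (u n) <= v n by near: n.
apply; apply: le_lt_trans (ler_norm _) _.
by rewrite -normrN -sub0r; near: n; exact: v0.
Unshelve. all: by end_near. Qed.

Lemma climD u v z w : clim u z -> clim v w -> clim (fun n => u n + v n) (z + w).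
Proof.
move=> uz vw e e0; have e20 : 0 < e / 2 by rewrite divr_gt0.
near=> n; rewrite [e]splitr opprD addrACA (le_lt_trans (cabsD _ _))// ltrD//.
  by near: n; exact: uz.
by near: n; exact: vw.
Unshelve. all: by end_near. Qed.

Lemma climZ (a : R[i]) u z : clim u z -> clim (fun n => a * u n) (a * z).
Proof.
move=> uz e e0; have ea : 0 < e / (cabs a + 1).
  by rewrite divr_gt0// ltr_wpDl// cabs_ge0.
near=> n; rewrite -mulrBr cabsM.
have : cabs (u n - z) < e / (cabs a + 1) by near: n; exact: uz.
rewrite ltr_pdivlMr ?ltr_wpDl ?cabs_ge0//; apply: le_lt_trans.
by rewrite mulrDr mulr1 mulrC lerDl cabs_ge0.
Unshelve. all: by end_near. Qed.

Lemma climN u z : clim u z -> clim (fun n => - u n) (- z).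
Proof.
move=> uz; have := climZ (-1) uz; rewrite mulN1r; congr clim.
by apply/funext => n; rewrite mulN1r.
Qed.

Lemma climB u v z w : clim u z -> clim v w -> clim (fun n => u n - v n) (z - w).
Proof. by move=> uz vw; apply: climD => //; exact: climN. Qed.

Lemma climJ u z : clim u z -> clim (fun n => (u n)^*) z^*.
Proof.
move=> uz e /uz; apply: filterS => n.
by rewrite -cabs_conj conjcD conjcN.
Qed.

Lemma clim_dist0 u v z : clim (fun n => u n - v n) 0 -> clim v z -> clim u z.
Proof.
move=> uv vz; have := climD uv vz; rewrite add0r; congr clim.
by apply/funext => n; rewrite subrK.
Qed.

Lemma clim_Re u z : clim u z -> (fun n => complex.Re (u n)) @ \oo --> complex.Re z.
Proof.
move=> uz; apply/cvgrPdist_lt => e /uz; apply: filterS => n; apply: le_lt_trans.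
by rewrite distrC -cReN -cReD Re_le_cabs.
Qed.

Lemma clim_ReIm u a b : (fun n => complex.Re (u n)) @ \oo --> a ->
  (fun n => complex.Im (u n)) @ \oo --> b -> clim u (a +i* b).
Proof.
move=> /cvgrPdist_lt ua /cvgrPdist_lt ub e e0.
have e20 : 0 < e / 2 by rewrite divr_gt0.
near=> n; rewrite (le_lt_trans (cabs_le_ReIm _))// [e]splitr ltrD//.
  by rewrite cReD cReN distrC/=; near: n; exact: ua.
by rewrite cImD cImN distrC/=; near: n; exact: ub.
Unshelve. all: by end_near. Qed.

Lemma clim_real (v : nat -> R) r : v @ \oo --> r -> clim (fun n => (v n)%:C) r%:C.
Proof. by move=> vr; apply: clim_ReIm => //=; exact: cvg_cst. Qed.

Lemma clim_cabs_le u z r : clim u z -> (\forall n \near \oo, cabs (u n) <= r) ->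
  cabs z <= r.
Proof.
move=> uz ur; apply/ler_addgt0Pr => e e0; near \oo => n.
rewrite -[z](subrK (u n)) addrC (le_trans (cabsD _ _))// lerD//.
  by near: n.
by rewrite cabs_distC ltW//; near: n; exact: uz.
Unshelve. all: by end_near. Qed.

(** A Cauchy criterion in the form in which limits arise below: for each [e] the sequence is
    eventually [e]-close to a number that is already known. Real and imaginary parts are 1-Lipschitz
    images, so completeness of [R] suffices. *)
Lemma clim_ex u :
  (forall e, 0 < e -> exists z, \forall n \near \oo, cabs (u n - z) < e) ->
  exists z, clim u z.
Proof.
move=> uC.
have aux (p : R[i] -> R) : (forall z w, `|p z - p w| <= cabs (z - w)) ->
    cvgn (fun n => p (u n)).
  move=> pC; apply/cauchy_cvgP/cauchy_exP => e e0.
  have [z uz] := uC _ e0; exists (p z).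
  change (\forall n \near \oo, ball (p z) e (p (u n))).
  apply: filterS uz => n uz; rewrite -ball_normE/=.
  by apply: le_lt_trans (pC _ _) _; rewrite cabs_distC.
have /cvg_ex[a ua] : cvgn (fun n => complex.Re (u n)).
  by apply: aux => z w; rewrite -cReN -cReD Re_le_cabs.
have /cvg_ex[b ub] : cvgn (fun n => complex.Im (u n)).
  by apply: aux => z w; rewrite -cImN -cImD Im_le_cabs.
by exists (a +i* b); exact: clim_ReIm.
Qed.

End complex_modulus.

(** * Compactly supported functions *)

Section topological_group.
Context {G : topologicalZmodType}.
Implicit Types (x y t : G) (K L U : set G).

Lemma addl_continuous t : continuous (fun x => t + x).
Proof.
move=> x; apply: (@continuous_comp _ _ _ (fun x => (t, x)) (fun p : G * G => p.1 + p.2)).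
  by apply: cvg_pair => /=; [exact: cvg_cst|exact: cvg_id].
exact: add_continuous.
Qed.

Lemma subl_continuous t : continuous (fun x => t - x).
Proof.
move=> x; apply: (@continuous_comp _ _ _ (fun x => - x) (fun x => t + x)).
  exact: opp_continuous.
exact: addl_continuous.
Qed.

Lemma subr_continuous t : continuous (fun x => x - t).
Proof.
move=> x; rewrite (_ : (fun x => x - t) = (fun x => - t + x)).
  exact: addl_continuous.
by apply/funext => y; rewrite addrC.
Qed.

Lemma compact_image (T U : topologicalType) (f : T -> U) (A : set T) :
  continuous f -> compact A -> compact (f @` A).
Proof. by move=> cf; apply: continuous_compact; exact: continuous_subspaceT. Qed.

Lemma compact_sum K L : compact K -> compact L ->
  compact [set x + y | x in K & y in L].
Proof.
move=> cK cL; rewrite image2E; apply: compact_image; last exact: compact_setX.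
rewrite (_ : uncurry _ = (fun p => p.1 + p.2)); first exact: add_continuous.
by apply/funext => -[].
Qed.

Lemma compact_opp K : compact K -> compact [set - x | x in K].
Proof. by move=> cK; apply: compact_image => //; exact: opp_continuous. Qed.

Lemma compact_dif K L : compact K -> compact L ->
  compact [set x - y | x in K & y in L].
Proof.
move=> cK cL; rewrite image2E; apply: compact_image; last exact: compact_setX.
rewrite (_ : uncurry _ = (fun p => p.1 - p.2)); first exact: sub_continuous.
by apply/funext => -[].
Qed.

Lemma open_translate U t : open U -> open [set t + x | x in U].
Proof.
move=> oU; rewrite (_ : [set _ | _ in _] = (fun x => - t + x) @^-1` U).
  by apply: open_comp => // x _; exact: addl_continuous.
apply/seteqP; split=> [_ [x Ux <-]|x /= Ux]; first by rewrite /= addKr.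
by exists (- t + x) => //; rewrite addNKr.
Qed.

Lemma open_opp U : open U -> open [set - x | x in U].
Proof.
move=> oU; rewrite (_ : [set _ | _ in _] = (fun x => - x) @^-1` U).
  by apply: open_comp => // x _; exact: opp_continuous.
apply/seteqP; split=> [_ [x Ux <-]|x /= Ux]; first by rewrite /= opprK.
by exists (- x) => //; rewrite opprK.
Qed.

End topological_group.

(** * Urysohn functions on locally compact Hausdorff spaces *)

Section urysohn.
Context {R : realType} {X : topologicalType}.
Hypothesis hausX : hausdorff_space X.
Hypothesis lcX : locally_compact [set: X].

Lemma locally_compact_nbhs (x : X) : exists2 C : set X, nbhs x C & compact C.
Proof.
have [C] := lcX (I : [set: X] x).
by rewrite withinET => Cx [cC _]; exists C.
Qed.

(** The one-point compactification is compact Hausdorff, hence normal. There the image of [K] is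
    compact and so closed, and the complement of the image of [U] is closed because [U] stays open;
    the separating function is pulled back. *)
Lemma compact_urysohn (K U : set X) : compact K -> open U -> K `<=` U ->
  exists h : X -> R, [/\ continuous h, forall x, 0 <= h x <= 1,
    forall x, K x -> h x = 1 & forall x, ~ U x -> h x = 0].
Proof.
move=> cK oU KU.
pose Y := one_point_compactification X.
have hausY : hausdorff_space Y by exact: one_point_compactification_hausdorff.
have nY : normal_space Y.
  exact/compact_normal/one_point_compactification_compact.
have sc : continuous (Some : X -> Y).
  exact: one_point_compactification_some_continuous.
have clK : @closed Y (Some @` K).
  by apply: compact_closed => //; exact: compact_image.
have clU : @closed Y (~` (Some @` U)).
  by apply: open_closedC; exact: one_point_compactification_open_some.
have UK0 : ~` (Some @` U) `&` (Some @` K : set Y) = set0.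
  rewrite -subset0 => y [nU [x Kx xy]]; apply: nU.
  by exists x => //; exact: KU.
have /(@normal_separatorP R) := nY.
move=> /(_ _ _ clU clK UK0) /(@uniform_separatorP _ R)[f [cf f01 f0 f1]].
exists (f \o Some); split.
- by move=> x; apply: continuous_comp; [exact: sc|exact: cf].
- by move=> x; have /= := f01 (f (Some x)); rewrite in_itv/=; apply; exists (Some x).
- by move=> x Kx /=; apply: (f1 (f (Some x))); exists (Some x) => //; exists x.
- move=> x nUx /=; apply: (f0 (f (Some x))); exists (Some x) => //.
  by move=> [x' Ux' [xx']]; apply: nUx; rewrite -xx'.
Qed.

End urysohn.

Section complex_continuous.
Context {R : realType} {X : topologicalType}.
Implicit Types (f g : X -> R[i]).

Definition ccont f := continuous (f : X -> R[i]^o).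

Lemma ccontP f : ccont f <->
  forall x e, 0 < e -> \forall y \near x, cabs (f y - f x) < e.
Proof.
split=> [cf x e e0|H x].
  have /cvgrPdist_lt := cf x.
  move=> /(_ e%:C); rewrite ltcR => /(_ e0); apply: filterS => y.
  by rewrite normc_cabs ltcR cabs_distC.
apply/cvgrPdist_lt => -[a b]; rewrite ltcE/= => /andP[/eqP -> a0].
have := H x a a0; apply: filterS => y.
by rewrite cabs_distC -[a +i* 0]/(a%:C) normc_cabs ltcR.
Qed.

Lemma ccont_cst z : ccont (fun=> z).
Proof. by move=> x; exact: cvg_cst. Qed.

Lemma ccontD f g : ccont f -> ccont g -> ccont (fun x => f x + g x).
Proof. by move=> cf cg x; apply: cvgD; [exact: cf|exact: cg]. Qed.

Lemma ccontM f g : ccont f -> ccont g -> ccont (fun x => f x * g x).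
Proof. by move=> cf cg x; apply: cvgM; [exact: cf|exact: cg]. Qed.

Lemma ccontN f : ccont f -> ccont (fun x => - f x).
Proof. by move=> cf x; apply: cvgN; exact: cf. Qed.

Lemma ccontB f g : ccont f -> ccont g -> ccont (fun x => f x - g x).
Proof. by move=> cf cg; exact: (ccontD cf (ccontN cg)). Qed.

Lemma ccontJ f : ccont f -> ccont (fun x => (f x)^*).
Proof.
move=> /ccontP cf; apply/ccontP => x e /(cf x); apply: filterS => y.
by rewrite -conjcN -conjcD cabs_conj.
Qed.

Lemma ccont_real (h : X -> R) : continuous h -> ccont (fun x => (h x)%:C).
Proof.
move=> ch; apply/ccontP => x e e0; have /cvgrPdist_lt := ch x.
move=> /(_ e e0); apply: filterS => y.
by rewrite -realcB cabs_real distrC.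
Qed.

Lemma continuous_cabs f : ccont f -> continuous (fun x => cabs (f x)).
Proof.
move=> /ccontP cf x; apply/cvgrPdist_lt => e /(cf x); apply: filterS => y.
apply: le_lt_trans; rewrite ler_norml.
have := cabsD (f y - f x) (f x); have := cabsD (f x - f y) (f y).
rewrite !subrK (cabs_distC (f x)) => fxy fyx.
by apply/andP; split; lra.
Qed.

Lemma continuous_Re f : ccont f -> continuous (fun x => complex.Re (f x)).
Proof.
move=> /ccontP cf x; apply/cvgrPdist_lt => e /(cf x); apply: filterS => y.
by apply: le_lt_trans; rewrite distrC -cReN -cReD Re_le_cabs.
Qed.

Lemma continuous_Im f : ccont f -> continuous (fun x => complex.Im (f x)).
Proof.
move=> /ccontP cf x; apply/cvgrPdist_lt => e /(cf x); apply: filterS => y.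
by apply: le_lt_trans; rewrite distrC -cImN -cImD Im_le_cabs.
Qed.

End complex_continuous.

Lemma ccont_comp {R : realType} {X Y : topologicalType} (f : Y -> R[i]) (p : X -> Y) :
  continuous p -> ccont f -> ccont (fun x => f (p x)).
Proof.
move=> cp /ccontP cf; apply/ccontP => x e e0.
have := cf (p x) e e0; exact: cp.
Qed.

Section compactly_supported.
Context {R : realType} {G : topologicalZmodType}.
Hypothesis hausG : hausdorff_space G.
Implicit Types (f g : G -> R[i]).

Lemma Cc_ccont f : Cc f -> ccont f.
Proof. by case. Qed.

Lemma CcP f : Cc f <-> ccont f /\
  exists2 K : set G, compact K & forall x, ~ K x -> f x = 0.
Proof.
split=> -[cf].
  move=> cK; split => //; exists (closure [set x | f x != 0]) => // x nKx.
  apply/eqP; apply: contra_notT nKx => fx; exact: subset_closure.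
move=> [K cK f0]; split => //.
apply: (subclosed_compact _ cK); first exact: closed_closure.
rewrite (closure_id K).1; last exact: compact_closed.
apply: closure_subset => x /= fx; apply: contrapT => /f0 f0x.
by rewrite f0x eqxx in fx.
Qed.

Lemma Cc_supp f : Cc f -> exists2 K : set G, compact K & forall x, ~ K x -> f x = 0.
Proof. by move=> /CcP[]. Qed.

Lemma Cc0 : Cc (fun _ : G => 0 : R[i]).
Proof.
by apply/CcP; split; [exact: ccont_cst|exists set0 => //; exact: compact0].
Qed.

Lemma CcD f g : Cc f -> Cc g -> Cc (fun x => f x + g x).
Proof.
move=> /CcP[cf [K cK f0]] /CcP[cg [L cL g0]]; apply/CcP; split.
  exact: ccontD.
exists (K `|` L); first exact: compactU.
by move=> x /not_orP[nK nL]; rewrite f0// g0// addr0.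
Qed.

Lemma CcM f g : Cc f -> ccont g -> Cc (fun x => f x * g x).
Proof.
move=> /CcP[cf [K cK f0]] cg; apply/CcP; split; first exact: ccontM.
by exists K => // x /f0 ->; rewrite mul0r.
Qed.

Lemma CcMl f g : ccont f -> Cc g -> Cc (fun x => f x * g x).
Proof.
move=> cf cg; rewrite (_ : (fun _ => _) = (fun x => g x * f x)).
  exact: CcM.
by apply/funext => x; rewrite mulrC.
Qed.

Lemma CcZ a f : Cc f -> Cc (fun x => a * f x).
Proof. by move=> cf; apply: CcMl => //; exact: ccont_cst. Qed.

Lemma CcN f : Cc f -> Cc (fun x => - f x).
Proof.
move=> cf; rewrite (_ : (fun _ => _) = (fun x => -1 * f x)); first exact: CcZ.
by apply/funext => x; rewrite mulN1r.
Qed.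

Lemma CcB f g : Cc f -> Cc g -> Cc (fun x => f x - g x).
Proof. by move=> cf cg; exact: (CcD cf (CcN cg)). Qed.

Lemma CcJ f : Cc f -> Cc (fun x => (f x)^*).
Proof.
move=> /CcP[cf [K cK f0]]; apply/CcP; split; first exact: ccontJ.
by exists K => // x /f0 ->; rewrite conjc_0.
Qed.

Lemma Cc_dominated f g : Cc f -> ccont g -> (forall x, f x = 0 -> g x = 0) -> Cc g.
Proof.
move=> /CcP[cf [K cK f0]] cg fg; apply/CcP; split => //.
by exists K => // x /f0 /fg.
Qed.

Lemma Cc_cabs f : Cc f -> Cc (fun x => (cabs (f x))%:C).
Proof.
move=> cf; apply: (Cc_dominated cf).
  by apply: ccont_real; exact/continuous_cabs/Cc_ccont.
by move=> x ->; rewrite cabs0.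
Qed.

Lemma Cc_subl f t : Cc f -> Cc (fun x => f (t - x)).
Proof.
move=> /CcP[cf [K cK f0]]; apply/CcP; split.
  by apply: (ccont_comp (p := fun x => t - x)) => //; exact: subl_continuous.
exists [set t - x | x in K].
  by apply: compact_image => //; exact: subl_continuous.
move=> x nx; apply: f0 => Kx; apply: nx; exists (t - x) => //.
by rewrite subKr.
Qed.

Lemma Cc_subr f t : Cc f -> Cc (fun x => f (x - t)).
Proof.
move=> cf; have := Cc_subl 0 (Cc_subl (- t) cf); congr Cc.
by apply/funext => x; rewrite sub0r opprK addrC.
Qed.

Lemma Cc_addr f t : Cc f -> Cc (fun x => f (x + t)).
Proof. by move=> /(Cc_subr (- t)); rewrite opprK. Qed.

Lemma Cc_addl f t : Cc f -> Cc (fun x => f (t + x)).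
Proof.
by move=> /(Cc_addr t); congr Cc; apply/funext => x; rewrite addrC.
Qed.

Lemma Cc_opp f : Cc f -> Cc (fun x => f (- x)).
Proof.
by move=> /(Cc_subl 0); congr Cc; apply/funext => x; rewrite sub0r.
Qed.

Lemma Cc_tilde f : Cc f -> Cc (fun_tilde f).
Proof. by move=> cf; exact/CcJ/Cc_opp. Qed.

Lemma Cc_bounded f : Cc f -> exists2 m : R, 0 < m & forall x, cabs (f x) <= m.
Proof.
move=> /CcP[/ccontP cf [K cK f0]].
have /compact_near_coveringP/(_ R +oo (fun m x => cabs (f x) <= m)) := cK.
case=> [x Kx|M [_ KM]].
- near=> y m.
  have : cabs (f y - f x) < 1 by near: y; exact: cf.
  have : cabs (f x) + 1 <= m by near: m; apply: nbhs_pinfty_ge; exact: num_real.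
  have := cabsD (f y - f x) (f x); rewrite subrK => h1 h2 h3.
  by apply: (le_trans h1); apply: le_trans h2; rewrite addrC lerD2l ltW.
- exists (`|M| + 1) => [|x]; first by rewrite ltr_wpDl.
  have [Kx|/f0 ->] := pselect (K x); last by rewrite cabs0 addr_ge0.
  apply: KM => //; rewrite (le_lt_trans (ler_norm _))// ltrDl//.
Unshelve. all: by end_near. Qed.

(** Compactness of the support [K] gives uniformity only for base points in [K], so both [x + u] and
    [x - u] are treated. If [x] is not in [K] but [x + u] is, the estimate is read backwards from
    [x + u]; if neither is, both values vanish. *)
Lemma Cc_uniform_continuous f e : Cc f -> 0 < e ->
  \forall u \near (0 : G), forall x, cabs (f (x + u) - f x) < e.
Proof.
move=> cf0 e0; have /CcP[cf [K cK f0]] := cf0.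
have e20 : 0 < e / 2 by rewrite divr_gt0.
have near2 (q : G * G -> G) : continuous q -> (forall x, q (x, 0) = x) ->
    forall x : G, \forall x' \near x & u \near (0 : G), cabs (f (q (x', u)) - f x') < e.
  move=> cq q0 x.
  have H1 : \forall p \near (x, 0 : G), cabs (f (q p) - f x) < e / 2.
    have /ccontP/(_ (x, 0) _ e20) : ccont (fun p => f (q p)) by exact: ccont_comp.
    by rewrite q0.
  have H2 : \forall p \near (x, 0 : G), cabs (f p.1 - f x) < e / 2.
    have /ccontP/(_ (x, 0) _ e20) // : ccont (fun p : G * G => f p.1).
    by apply: ccont_comp => // p; exact: cvg_fst.
  have : \forall p \near (x, 0 : G), cabs (f (q p) - f p.1) < e.
    apply: filterS2 H1 H2 => p H1 H2.
    by rewrite (le_lt_trans (cabs_sub_le _ _ (f x)))// [e]splitr ltrD// cabs_distC.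
  by apply: filterS => -[].
have /compact_near_coveringP cov := cK.
have K1 : \forall u \near (0 : G), K `<=` (fun x => cabs (f (x + u) - f x) < e).
  apply: (cov) => x Kx.
  by apply: (near2 (fun p => p.1 + p.2)) => [|y]; [exact: add_continuous|rewrite /= addr0].
have K2 : \forall u \near (0 : G), K `<=` (fun x => cabs (f (x - u) - f x) < e).
  apply: (cov) => x Kx.
  by apply: (near2 (fun p => p.1 - p.2)) => [|y]; [exact: sub_continuous|rewrite /= subr0].
apply: filterS2 K1 K2 => u K1 K2 x.
have [/K1//|nKx] := pselect (K x).
have [/K2|nKxu] := pselect (K (x + u)); first by rewrite addrK cabs_distC.
by rewrite !f0// subrr cabs0.
Qed.

End compactly_supported.

Section bump.
Context {R : realType} {G : topologicalZmodType}.
Hypothesis hausG : hausdorff_space G.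
Hypothesis lcG : locally_compact [set: G].

Lemma compact_nbhs_ex (K : set G) : compact K ->
  exists U : set G, [/\ open U, K `<=` U & exists2 C : set G, compact C & U `<=` C].
Proof.
move=> cK; have [C C0 cC] := locally_compact_nbhs lcG 0.
exists (\bigcup_(x in K) [set x + y | y in C^°]); split.
- by apply: bigcup_open => x _; apply: open_translate; exact: open_interior.
- by move=> x Kx; exists x => //; exists 0; [exact: C0|rewrite addr0].
- exists [set x + y | x in K & y in C]; first exact: compact_sum.
  move=> _ [x Kx [y Cy <-]]; exists x => //; exists y => //.
  exact: interior_subset.
Qed.

(** Shrinking [U] to a relatively compact neighbourhood of [K] makes the Urysohn function compactly
    supported. *)
Lemma Cc_urysohn (K U : set G) : compact K -> open U -> K `<=` U ->
  exists h : G -> R, [/\ Cc (fun x => (h x)%:C), forall x, 0 <= h x <= 1,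
    forall x, K x -> h x = 1 & forall x, ~ U x -> h x = 0].
Proof.
move=> cK oU KU; have [V [oV KV [C cC VC]]] := compact_nbhs_ex cK.
have KUV : K `<=` U `&` V by move=> x Kx; split; [exact: KU|exact: KV].
have [h [ch h01 h1 h0]] := compact_urysohn (R := R) hausG lcG cK (openI oU oV) KUV.
exists h; split => // [|x nU]; last by rewrite h0// => -[].
apply/CcP => //; split; first exact: ccont_real.
by exists C => // x nC; rewrite h0// => -[_ /VC].
Qed.

End bump.

(** * Haar integration *)

Section haar.
Context {R : realType} {G : topologicalZmodType}.
Hypothesis hausG : hausdorff_space G.
Variable theta : {measure set (borel (pointed G)) -> \bar R}.
Hypothesis haar_theta : haar_measure theta.
Let T : Type := borel (pointed G).
Implicit Types (f g : G -> R[i]).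

Lemma open_measurable (U : set G) : open U -> measurable (U : set (borel (pointed G))).
Proof. by move=> oU; apply: sub_sigma_algebra. Qed.

Lemma closed_measurable (F : set G) : closed F -> measurable (F : set (borel (pointed G))).
Proof.
by move=> cF; rewrite -[F]setCK; apply: measurableC; apply: open_measurable; rewrite openC.
Qed.

Lemma compact_measurable_borel (K : set G) : compact K ->
  measurable (K : set (borel (pointed G))).
Proof. by move=> cK; exact: (closed_measurable (compact_closed hausG cK)). Qed.

Lemma compact_fin_haar (K : set G) : compact K -> (theta K < +oo)%E.
Proof. by case: haar_theta => -[+ _] _ _ => /[apply]. Qed.

Lemma continuous_borel_measurable (h : G -> R) : continuous h ->
  measurable_fun setT (h : borel (pointed G) -> R).
Proof.
move=> ch; apply: (measurability _ (measurable_realfun.RGenOInfty.measurableE R)) => //.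
move=> _ [_ [x ->] <-]; rewrite setTI; apply: open_measurable.
by apply: open_comp => [y _|]; [exact: ch|rewrite set_itvE; exact: open_gt].
Qed.

(** The working class of integrands. It contains C_c(G) and the truncations of continuous functions
    to [A n], is closed under sums and products, and consists of Haar integrable functions since
    compact sets have finite measure. *)
Definition hintegrable f :=
  [/\ measurable_fun setT ((fun t => complex.Re (f t)) : borel (pointed G) -> R),
      measurable_fun setT ((fun t => complex.Im (f t)) : borel (pointed G) -> R),
      exists m : R, forall x, cabs (f x) <= m
    & exists2 K : set G, compact K & forall x, ~ K x -> f x = 0].

Lemma hintegrable_Cc f : Cc f -> hintegrable f.
Proof.
move=> cf; split.
- exact: (continuous_borel_measurable (continuous_Re (Cc_ccont cf))).
- exact: (continuous_borel_measurable (continuous_Im (Cc_ccont cf))).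
- by have [m _ fm] := Cc_bounded hausG cf; exists m.
- exact: Cc_supp.
Qed.

Lemma hintegrableD f g : hintegrable f -> hintegrable g ->
  hintegrable (fun x => f x + g x).
Proof.
move=> [f1 f2 [m fm] [K cK fK]] [g1 g2 [m' gm] [K' cK' gK]]; split.
- rewrite [X in measurable_fun _ X](_ : _ =
    (fun t => complex.Re (f t) + complex.Re (g t))); first exact: measurable_funD.
  by apply/funext => t; rewrite cReD.
- rewrite [X in measurable_fun _ X](_ : _ =
    (fun t => complex.Im (f t) + complex.Im (g t))); first exact: measurable_funD.
  by apply/funext => t; rewrite cImD.
- exists (m + m') => x; exact: le_trans (cabsD _ _) (lerD (fm x) (gm x)).
- exists (K `|` K'); first exact: compactU.
  by move=> x /not_orP[nK nK']; rewrite fK// gK// addr0.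
Qed.

Lemma hintegrableM f g : hintegrable f -> hintegrable g ->
  hintegrable (fun x => f x * g x).
Proof.
move=> [f1 f2 [m fm] [K cK fK]] [g1 g2 [m' gm] [K' cK' gK]]; split.
- rewrite [X in measurable_fun _ X](_ : _ = (fun t =>
    complex.Re (f t) * complex.Re (g t) - complex.Im (f t) * complex.Im (g t))).
    by apply: measurable_funB; exact: measurable_funM.
  by apply/funext => t; rewrite cReM.
- rewrite [X in measurable_fun _ X](_ : _ = (fun t =>
    complex.Re (f t) * complex.Im (g t) + complex.Im (f t) * complex.Re (g t))).
    by apply: measurable_funD; exact: measurable_funM.
  by apply/funext => t; rewrite cImM.
- exists (m * m') => x; rewrite cabsM ler_pM ?cabs_ge0//.
- by exists K => // x /fK ->; rewrite mul0r.
Qed.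

Lemma hintegrable_indic (B : set G) (K : set G) f :
  measurable (B : set (borel (pointed G))) -> compact K -> B `<=` K -> ccont f ->
  hintegrable (fun x => \1_B x * f x).
Proof.
move=> mB cK BK cf.
have aux (p : R[i] -> R) : p 0 = 0 ->
    measurable_fun setT ((fun t => p (f t)) : borel (pointed G) -> R) ->
    measurable_fun setT ((fun t => p (\1_B t * f t)) : borel (pointed G) -> R).
  move=> p0 mp; rewrite [X in measurable_fun _ X](_ : _ = (fun t => \1_B t * p (f t))).
    by apply: measurable_funM => //; exact: measurable_indic.
  by apply/funext => t; rewrite !indicE; case: (t \in B); rewrite ?mul1r ?mul0r.
split.
- by apply: (aux (@complex.Re R)) => //; exact: (continuous_borel_measurable (continuous_Re cf)).
- by apply: (aux (@complex.Im R)) => //; exact: (continuous_borel_measurable (continuous_Im cf)).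
- have /compact_near_coveringP/(_ R +oo (fun m x => cabs (f x) <= m)) := cK.
  case=> [x Kx|M [_ KM]].
    near=> y m.
    have h2 : cabs (f y - f x) < 1 by near: y; exact: (ccontP f).1.
    have h1 : cabs (f x) + 1 <= m.
      by near: m; apply: nbhs_pinfty_ge; exact: num_real.
    rewrite (le_trans _ h1)// -[f y](subrK (f x)) addrC (le_trans (cabsD _ _))//.
    by rewrite lerD2l ltW.
  exists (`|M| + 1) => x; rewrite indicE; have [xB|xB] := boolP (x \in B); last first.
    by rewrite mul0r cabs0 addr_ge0.
  rewrite mul1r; apply: KM; last by apply: BK; rewrite inE in xB.
  by rewrite (le_lt_trans (ler_norm _))// ltrDl.
- exists K => // x nK; rewrite indicE memNset ?mul0r// => /BK//.
Unshelve. all: by end_near. Qed.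

Lemma hintegrable_cst (B K : set G) (z : R[i]) :
  measurable (B : set (borel (pointed G))) -> compact K -> B `<=` K ->
  hintegrable (fun x => \1_B x * z).
Proof. by move=> mB cK BK; apply: (hintegrable_indic mB cK BK); exact: ccont_cst. Qed.

Lemma hintegrableZ a f : hintegrable f -> hintegrable (fun x => a * f x).
Proof.
move=> hf; have [_ _ _ [K cK fK]] := hf.
(* A nonzero constant need not have compact support, so [a] is cut off by a compact set outside
   which [f] vanishes. *)
rewrite (_ : (fun x => _) = (fun x => (\1_K x * a) * f x)).
  apply: hintegrableM => //; apply: (hintegrable_cst _ _ cK) => //.
  exact: compact_measurable_borel.
apply/funext => x; rewrite indicE; have [|nK] := boolP (x \in K).
  by rewrite mul1r.
by rewrite mul0r mul0r fK ?mulr0//; rewrite -notin_setE.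
Qed.

Lemma hintegrableB f g : hintegrable f -> hintegrable g ->
  hintegrable (fun x => f x - g x).
Proof.
move=> hf hg; have := hintegrableD hf (hintegrableZ (-1) hg); congr hintegrable.
by apply/funext => x; rewrite mulN1r.
Qed.

Lemma hintegrable_integrable (h : G -> R) (m : R) (K : set G) :
  measurable_fun setT (h : borel (pointed G) -> R) -> (forall x, `|h x| <= m) ->
  compact K -> (forall x, ~ K x -> h x = 0) ->
  theta.-integrable setT (EFin \o h).
Proof.
move=> mh hm cK h0; have mK := compact_measurable_borel cK.
have -> : EFin \o h = (EFin \o h) \_ K.
  apply/funext => x; rewrite patchE; case: ifPn => //= nK.
  by rewrite h0//; rewrite -notin_setE.
apply/(integrable_mkcond _ _).1 => //.
apply: measurable_bounded_integrable => //; first exact: compact_fin_haar.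
  exact: measurable_funTS.
exists m; split; first exact: num_real.
by move=> m' mm' x _ /=; rewrite (le_trans (hm x))// ltW.
Qed.

Lemma Re_integrable f : hintegrable f ->
  theta.-integrable setT (EFin \o (fun x => complex.Re (f x))).
Proof.
move=> [f1 f2 [m fm] [K cK fK]]; apply: (hintegrable_integrable (m := m) (K := K)) => //.
  by move=> x; exact: le_trans (Re_le_cabs _) (fm x).
by move=> x /fK ->.
Qed.

Lemma Im_integrable f : hintegrable f ->
  theta.-integrable setT (EFin \o (fun x => complex.Im (f x))).
Proof.
move=> [f1 f2 [m fm] [K cK fK]]; apply: (hintegrable_integrable (m := m) (K := K)) => //.
  by move=> x; exact: le_trans (Im_le_cabs _) (fm x).
by move=> x /fK ->.
Qed.

Local Notation I := (haar_integral theta).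

Lemma haar_integralD f g : hintegrable f -> hintegrable g ->
  I (fun x => f x + g x) = I f + I g.
Proof.
move=> hf hg; rewrite /haar_integral; apply/eqP; rewrite eq_complex/=.
under eq_Rintegral do rewrite cReD.
under [X in _ && (X == _)]eq_Rintegral do rewrite cImD.
rewrite !RintegralD ?eqxx//; try exact: Re_integrable; exact: Im_integrable.
Qed.

Lemma haar_integralZ a f : hintegrable f -> I (fun x => a * f x) = a * I f.
Proof.
move=> hf; rewrite /haar_integral; apply/eqP; rewrite eq_complex/= cReM cImM/=.
have hR := Re_integrable hf; have hI := Im_integrable hf.
have hRZ r := integrableZl measurableT r hR.
have hIZ r := integrableZl measurableT r hI.
under eq_Rintegral do rewrite cReM.
under [X in _ && (X == _)]eq_Rintegral do rewrite cImM.
rewrite RintegralB//; [|exact: hRZ|exact: hIZ].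
rewrite RintegralD//; [|exact: hIZ|exact: hRZ].
by rewrite !RintegralZl// !eqxx.
Qed.

Lemma haar_integralN f : hintegrable f -> I (fun x => - f x) = - I f.
Proof.
move=> hf; have := haar_integralZ (-1) hf; rewrite mulN1r => <-.
by congr haar_integral; apply/funext => x; rewrite mulN1r.
Qed.

Lemma haar_integralB f g : hintegrable f -> hintegrable g ->
  I (fun x => f x - g x) = I f - I g.
Proof.
move=> hf hg; rewrite haar_integralD//; first by rewrite haar_integralN.
have := hintegrableZ (-1) hg; congr hintegrable.
by apply/funext => x; rewrite mulN1r.
Qed.

Lemma haar_integralJ f : hintegrable f -> I (fun x => (f x)^*) = (I f)^*.
Proof.
move=> hf; rewrite /haar_integral/=; apply/eqP; rewrite eq_complex/=.
under eq_Rintegral do rewrite cRe_conj.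
under [X in _ && (X == _)]eq_Rintegral do rewrite cIm_conj -mulN1r.
rewrite RintegralZl//; last exact: Im_integrable.
by rewrite mulN1r !eqxx.
Qed.

Lemma haar_integral0 : I (fun=> 0) = 0.
Proof. by rewrite /haar_integral /Rintegral !integral0. Qed.

Lemma haar_integral_real (h : G -> R) :
  I (fun x => (h x)%:C) = (\int[theta]_x h x)%:C.
Proof.
by rewrite /haar_integral/= /Rintegral integral0.
Qed.

Lemma haar_integral_indic (B K : set G) z :
  measurable (B : set (borel (pointed G))) -> compact K -> B `<=` K ->
  I (fun x => \1_B x * z) = (fine (theta B))%:C * z.
Proof.
move=> mB cK BK.
have -> : (fun x => \1_B x * z) = (fun x : G => z * (\1_B x : R)%:C).
  by apply/funext => x; rewrite mulrC !indicE; case: (x \in B).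
rewrite haar_integralZ; last first.
  have := hintegrable_cst 1 mB cK BK; congr hintegrable.
  by apply/funext => x; rewrite mulr1 !indicE; case: (x \in B).
by rewrite haar_integral_real /Rintegral integral_indic// setIT mulrC.
Qed.

Lemma le_Re_haar_integral f g : hintegrable f -> hintegrable g ->
  (forall x, complex.Re (f x) <= complex.Re (g x)) ->
  complex.Re (I f) <= complex.Re (I g).
Proof.
by move=> hf hg fg; apply: le_Rintegral => //; exact: Re_integrable.
Qed.

(** The factor 2 comes from bounding the real and the imaginary part separately; the value of the
    constant is immaterial in the estimates below. *)
Lemma le_cabs_haar_integral f (g : G -> R) : hintegrable f ->
  hintegrable (fun x => (g x)%:C) -> (forall x, cabs (f x) <= g x) ->
  cabs (I f) <= 2 * complex.Re (I (fun x => (g x)%:C)).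
Proof.
move=> hf hg fg; rewrite (le_trans (cabs_le_ReIm _))// mulr2n mulrDl mul1r.
have ig := Re_integrable hg.
apply: lerD; rewrite /haar_integral/=.
  rewrite (le_trans (le_normr_Rintegral _ _))//; first exact: Re_integrable.
  apply: le_Rintegral => //; last first.
    by move=> x _; exact: le_trans (Re_le_cabs _) (fg x).
  exact/integrable_norm/Re_integrable.
rewrite (le_trans (le_normr_Rintegral _ _))//; first exact: Im_integrable.
apply: le_Rintegral => //; last first.
  by move=> x _; exact: le_trans (Im_le_cabs _) (fg x).
exact/integrable_norm/Im_integrable.
Qed.

Lemma cabs_haar_integral_bound2 f (m1 m2 : R) (S1 S2 K : set G) : hintegrable f ->
  measurable (S1 : set (borel (pointed G))) ->
  measurable (S2 : set (borel (pointed G))) ->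
  compact K -> S1 `<=` K -> S2 `<=` K ->
  (forall x, cabs (f x) <= m1 * \1_S1 x + m2 * \1_S2 x) ->
  cabs (I f) <= 2 * (m1 * fine (theta S1) + m2 * fine (theta S2)).
Proof.
move=> hf mS1 mS2 cK S1K S2K fm.
have E : (fun x => (m1 * \1_S1 x + m2 * \1_S2 x)%:C) =
    (fun x => \1_S1 x * m1%:C + \1_S2 x * m2%:C).
  apply/funext => x; rewrite realcD !realcM !indicE; congr (_ + _); rewrite mulrC.
    by case: (x \in S1).
  by case: (x \in S2).
have h1 := hintegrable_cst m1%:C mS1 cK S1K.
have h2 := hintegrable_cst m2%:C mS2 cK S2K.
apply: le_trans (le_cabs_haar_integral hf _ fm) _.
  by rewrite E; exact: hintegrableD.
rewrite E haar_integralD// !(haar_integral_indic _ _ cK)//.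
by rewrite -!realcM -realcD/= [m1 * _]mulrC [m2 * _]mulrC.
Qed.

Lemma cabs_haar_integral_bound f (m : R) (S K : set G) : hintegrable f ->
  measurable (S : set (borel (pointed G))) -> compact K -> S `<=` K ->
  (forall x, cabs (f x) <= m * \1_S x) ->
  cabs (I f) <= 2 * (m * fine (theta S)).
Proof.
move=> hf mS cK SK fm.
have := @cabs_haar_integral_bound2 f m 0 S S K hf mS mS cK SK SK.
rewrite mul0r addr0; apply => x; rewrite mul0r addr0; exact: fm.
Qed.

(** Invariance says that the pushforward of [theta] under the translation is [theta]; the rest is
    change of variables for the real and imaginary parts. *)
Lemma haar_integral_addl t f : hintegrable f -> I (fun x => f (t + x)) = I f.
Proof.
move=> hf; have [mR mI _ _] := hf.
pose phi : borel (pointed G) -> borel (pointed G) := fun x : G => t + x.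
have mphi : measurable_fun setT phi.
  apply: (@measurability _ _ _ _ setT phi (@open (pointed G))) => //.
  move=> _ [U oU <-]; rewrite setTI; apply: open_measurable.
  by apply: open_comp => // x _; exact: addl_continuous.
have pE (B : set (borel (pointed G))) : measurable B ->
    pushforward theta phi B = theta B.
  move=> mB; rewrite /pushforward; have [_ inv _] := haar_theta.
  rewrite -(inv (- t) B mB); congr (theta _); apply/seteqP; split.
    by move=> x /= Bx; exists (phi x) => //; rewrite /phi addKr.
  by move=> _ [x Bx <-]; rewrite /preimage /phi/= addNKr.
have aux (h : G -> R) : theta.-integrable setT (EFin \o h) ->
    theta.-integrable setT (EFin \o (h \o phi)) ->
    measurable_fun setT (h : borel (pointed G) -> R) ->
    \int[theta]_x h (phi x) = \int[theta]_x h x.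
  move=> ih ihp mh; rewrite /Rintegral.
  have := @integral_pushforward _ _ _ _ _ phi mphi theta setT (EFin \o h).
  rewrite preimage_setT => ip; congr fine.
  transitivity (\int[pushforward theta phi]_y (EFin \o h) y)%E.
    by rewrite ip//; exact/measurable_EFinP.
  by apply: eq_measure_integral => B mB _; exact: pE.
have hfp : hintegrable (fun x => f (phi x)).
  have [_ _ [m fm] [K cK fK]] := hf; split.
  - exact: (measurableT_comp mR mphi).
  - exact: (measurableT_comp mI mphi).
  - by exists m => x; exact: fm.
  - exists [set - t + x | x in K].
      by apply: compact_image => //; exact: addl_continuous.
    move=> x nK; apply: fK => Kx; apply: nK; exists (phi x) => //.
    by rewrite /phi addKr.
rewrite /haar_integral -(aux (fun x => complex.Re (f x)))//.
- rewrite -(aux (fun x => complex.Im (f x)))//; first exact: Im_integrable.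
  exact: (Im_integrable hfp).
- exact: Re_integrable.
- exact: (Re_integrable hfp).
Qed.

Lemma haar_integral_subr t f : hintegrable f -> I (fun x => f (x - t)) = I f.
Proof.
move=> hf; rewrite -(haar_integral_addl (- t) hf).
by congr haar_integral; apply/funext => x; rewrite addrC.
Qed.

Lemma haar_integral_addr t f : hintegrable f -> I (fun x => f (x + t)) = I f.
Proof.
move=> hf; rewrite -(haar_integral_addl t hf).
by congr haar_integral; apply/funext => x; rewrite addrC.
Qed.

(** If [U] were null, finitely many null translates of [U] would cover any given compact set, and
    inner regularity would give the whole group measure 0. *)
Lemma haar_open_gt0 (U : set G) : open U -> U !=set0 -> (0 < theta U)%E.
Proof.
move=> oU [u Uu]; rewrite lt0e measure_ge0 andbT; apply/negP => /eqP U0.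
have [[_ reg] inv nz] := haar_theta.
have : theta setT = 0%E; last exact/eqP.
apply/eqP; rewrite eq_le measure_ge0 andbT reg; last exact: measurableT.
apply: ge_ereal_sup => _ [K [cK _] <-].
have := cK; rewrite compact_cover => /(_ G setT (fun t => [set t + x | x in U])) [].
- by move=> t _; exact: open_translate.
- by move=> x _; exists (x - u) => //; exists u => //; rewrite subrK.
move=> D _ KD.
have := @content_sub_fsum _ _ _ theta G [set` D] K (fun t => [set t + x | x in U]).
move=> /(_ _ _ _ KD)/le_trans; apply => //.
- by move=> t _; exact: (open_measurable (open_translate _ oU)).
- exact: compact_measurable_borel.
- by apply: fsume_le0 => t _ /=; rewrite inv ?U0//; exact: open_measurable.
Qed.

End haar.

(** * Radon functionals *)

Section radon_functional.
Context {R : realType} {G : topologicalZmodType}.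
Hypothesis hausG : hausdorff_space G.
Variable mu : (G -> R[i]) -> R[i].
Hypothesis radon_mu : cradon mu.
Implicit Types (f g : G -> R[i]).

Lemma cradon0 : mu (fun=> 0) = 0.
Proof.
have [lin _] := radon_mu; have := lin 1 _ _ (Cc0 hausG) (Cc0 hausG).
under eq_fun do rewrite mulr0 addr0.
by rewrite mul1r => /eqP; rewrite -subr_eq0 opprD addrA subrr sub0r oppr_eq0 => /eqP.
Qed.

Lemma cradonZ a f : Cc f -> mu (fun x => a * f x) = a * mu f.
Proof.
move=> cf; have [lin _] := radon_mu; have := lin a _ _ cf (Cc0 hausG).
by rewrite cradon0 addr0 => <-; congr mu; apply/funext => x; rewrite addr0.
Qed.

Lemma cradonD f g : Cc f -> Cc g -> mu (fun x => f x + g x) = mu f + mu g.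
Proof.
move=> cf cg; have [lin _] := radon_mu; have := lin 1 _ _ cf cg.
by rewrite mul1r => <-; congr mu; apply/funext => x; rewrite mul1r.
Qed.

Lemma cradonN f : Cc f -> mu (fun x => - f x) = - mu f.
Proof.
move=> cf; rewrite -mulN1r -cradonZ//; congr mu.
by apply/funext => x; rewrite mulN1r.
Qed.

Lemma cradonB f g : Cc f -> Cc g -> mu (fun x => f x - g x) = mu f - mu g.
Proof. by move=> cf cg; rewrite cradonD ?cradonN//; exact: CcN. Qed.

Lemma cradon_bound (K : set G) : compact K -> exists2 C : R, 0 < C &
  forall f m, Cc f -> (forall x, ~ K x -> f x = 0) -> (forall x, cabs (f x) <= m) ->
  cabs (mu f) <= C * m.
Proof.
move=> cK; have [_ /(_ K cK)[c bnd]] := radon_mu.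
exists (`|c| + 1); first by rewrite ltr_wpDl.
move=> f m cf f0 fm; have := bnd f m cf f0 fm => /le_trans; apply.
have m0 : 0 <= m := le_trans (cabs_ge0 (f 0)) (fm 0).
by rewrite ler_wpM2r// (le_trans (ler_norm _))// lerDl.
Qed.

End radon_functional.

(** * Fubini for a Radon functional and a Haar integral *)

Section swap.
Context {R : realType} {G : topologicalZmodType}.
Hypothesis hausG : hausdorff_space G.
Hypothesis lcG : locally_compact [set: G].
Variable theta : {measure set (borel (pointed G)) -> \bar R}.
Hypothesis haar_theta : haar_measure theta.
Local Notation I := (haar_integral theta).
Local Notation hintegrable := (@hintegrable R G).
Implicit Types (a b c f g : G -> R[i]).

Lemma hintegrableMcc b f : hintegrable b -> ccont f -> hintegrable (fun x => b x * f x).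
Proof.
move=> hb cf; have [_ _ _ [K cK bK]] := hb.
have mK := compact_measurable_borel hausG cK.
have := hintegrableM hb (hintegrable_indic mK cK (fun _ h => h) cf).
congr hintegrable; apply/funext => x; rewrite indicE.
have [|] := boolP (x \in K); first by rewrite mul1r.
by rewrite notin_setE => /bK ->; rewrite !mul0r.
Qed.

Lemma ccont_subl c (x : G) : ccont c -> ccont (fun w => c (x - w)).
Proof. by move=> cc; apply: (ccont_comp (p := fun w => x - w)) => //; exact: subl_continuous. Qed.

Lemma haar_conv_ccont b c : hintegrable b -> Cc c ->
  ccont (fun x => I (fun w => b w * c (x - w))).
Proof.
move=> hb cc; have [_ _ [m bm] [K cK bK]] := hb.
have mK := compact_measurable_borel hausG cK.
have m0 : 0 <= m := le_trans (cabs_ge0 (b 0)) (bm 0).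
pose M := 2 * (m * fine (theta K)) + 1.
have M0 : 0 < M by rewrite ltr_wpDl// !mulr_ge0// fine_ge0.
apply/ccontP => x e e0; have eM : 0 < e / M by rewrite divr_gt0.
have uc := Cc_uniform_continuous hausG cc eM.
have : \forall y \near x, forall z, cabs (c (z + (y - x)) - c z) < e / M.
  by have := @subr_continuous G x x; rewrite /continuous_at subrr => /(_ _ uc).
apply: filterS => y yx.
have hx z : hintegrable (fun w => b w * c (z - w)).
  by apply: hintegrableMcc => //; apply: ccont_subl; exact: Cc_ccont.
rewrite -(haar_integralB hausG haar_theta)//.
have := @cabs_haar_integral_bound R G hausG theta haar_theta
  (fun w => b w * c (y - w) - b w * c (x - w)) (m * (e / M)) K K.
move=> /(_ (hintegrableB hausG (hx y) (hx x)) mK cK (fun _ h => h)).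
have bnd w : cabs (b w * c (y - w) - b w * c (x - w)) <= m * (e / M) * \1_K w.
  rewrite -mulrBr cabsM indicE; have [wK|] := boolP (w \in K); last first.
    by rewrite notin_setE => /bK ->; rewrite cabs0 mul0r mulr0.
  rewrite mulr1 ler_pM ?cabs_ge0// ltW//.
  by have := yx (x - w); rewrite (_ : x - w + (y - x) = y - w)// addrC addrA subrK.
move=> /(_ bnd)/le_lt_trans; apply.
have -> : 2 * (m * (e / M) * fine (theta K)) = 2 * (m * fine (theta K)) * (e / M) by ring.
by rewrite mulrCA gtr_pMr// ltr_pdivrMr// mul1r /M ltrDl.
Qed.

Section functional.
Variable mu : (G -> R[i]) -> R[i].
Hypothesis radon_mu : cradon mu.

(** The cutoff [a] confines the integration to a fixed compact set, so one constant serves all [w]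
    and [w']. This gives both the continuity of [Psi] and the local error in the proof of Fubini. *)
Lemma radon_conv_estimate a c (Ka : set G) : Cc a -> Cc c -> compact Ka ->
  (forall x, ~ Ka x -> a x = 0) ->
  exists2 C : R, 0 < C & forall (w w' : G) e,
    (forall x, cabs (c (x - w) - c (x - w')) <= e) ->
    cabs (mu (fun x => a x * c (x - w)) - mu (fun x => a x * c (x - w'))) <= C * e.
Proof.
move=> ca cc cKa aKa; have [C C0 bnd] := cradon_bound radon_mu cKa.
have [m m0 am] := Cc_bounded hausG ca.
exists (C * m); first exact: mulr_gt0.
move=> w w' e ce.
have cx w0 : Cc (fun x => a x * c (x - w0)).
  by apply: CcM => //; apply: Cc_ccont; exact: Cc_subr.
rewrite -cradonB// -mulrA; apply: bnd.
- exact: CcB.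
- by move=> x /aKa ->; rewrite !mul0r subrr.
- by move=> x; rewrite -mulrBr cabsM ler_pM ?cabs_ge0.
Qed.

Lemma radon_conv_Cc a c : Cc a -> Cc c ->
  Cc (fun w => mu (fun x => a x * c (x - w))).
Proof.
move=> ca cc; have [Ka cKa aKa] := Cc_supp hausG ca.
have [Kc cKc cKc0] := Cc_supp hausG cc.
have [C C0 est] := radon_conv_estimate ca cc cKa aKa.
apply/CcP => //; split; last first.
  exists [set x - y | x in Ka & y in Kc]; first exact: compact_dif.
  move=> w nw; rewrite -(cradon0 hausG radon_mu); congr mu; apply/funext => x.
  have [Kx|/aKa ->] := pselect (Ka x); last by rewrite mul0r.
  rewrite cKc0 ?mulr0// => Kxw; apply: nw; exists x => //; exists (x - w) => //.
  by rewrite subKr.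
apply/ccontP => w e e0; have eC : 0 < e / (C + C) by rewrite divr_gt0// addr_gt0.
have := Cc_uniform_continuous hausG cc eC => uc.
have : \forall y \near w, forall z, cabs (c (z + (w - y)) - c z) < e / (C + C).
  by have := @subl_continuous G w w; rewrite /continuous_at subrr => /(_ _ uc).
apply: filterS => y yw.
apply: (@le_lt_trans _ _ (C * (e / (C + C)))); last first.
  have -> : C * (e / (C + C)) = e / 2 by field; apply: lt0r_neq0; lra.
  by rewrite ltr_pdivrMr// ltr_pMr// ltr1n.
apply: est => x; rewrite ltW//; have := yw (x - w).
by rewrite [X in c X](_ : _ = x - y)// addrA subrK.
Qed.

(** Riemann sums replace product measures, as [mu] is only a functional. If [b] lives on a set of
    points [w] near one point [p], then [c (x - w)] may be replaced by [c (x - p)], after which both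
    sides agree. The error is proportional to the measure of that set, so it stays small when
    finitely many such pieces are added up. *)
Lemma radon_haar_swap_hintegrable a b c : Cc a -> hintegrable b -> Cc c ->
  mu (fun x => a x * I (fun w => b w * c (x - w))) =
  I (fun w => b w * mu (fun x => a x * c (x - w))).
Proof.
move=> ca hb cc.
pose Psi w := mu (fun x => a x * c (x - w)).
have [Ka cKa aKa] := Cc_supp hausG ca.
have cPsi : Cc Psi by exact: radon_conv_Cc.
have [C C0 est] := radon_conv_estimate ca cc cKa aKa.
have [C' C'0 bnd] := cradon_bound radon_mu cKa.
have [m m0 am] := Cc_bounded hausG ca.
have [_ _ [mb bm] [L cL bL]] := hb.
have mb0 : 0 <= mb := le_trans (cabs_ge0 (b 0)) (bm 0).
have mL := compact_measurable_borel hausG cL.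
pose r (B : set G) w := \1_B w * b w.
have hr (B : set G) : measurable (B : set (borel (pointed G))) -> B `<=` L ->
    hintegrable (r B).
  move=> mB BL; have := hintegrableM hb (hintegrable_cst 1 mB cL BL).
  by congr hintegrable; apply/funext => w; rewrite /r mulr1 mulrC.
have hrc b' x : hintegrable b' -> hintegrable (fun w => b' w * c (x - w)).
  by move=> hb'; apply: hintegrableMcc => //; apply: ccont_subl; exact: Cc_ccont.
have hrP b' : hintegrable b' -> hintegrable (fun w => b' w * Psi w).
  by move=> hb'; apply: hintegrableMcc => //; exact: Cc_ccont.
have Phic b' : hintegrable b' -> Cc (fun x => a x * I (fun w => b' w * c (x - w))).
  by move=> hb'; apply: CcM => //; exact: haar_conv_ccont.
(* The defect of Fubini as a function of the weight; it is additive, which allows cutting the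
   support of [b] into pieces. *)
pose D b' := mu (fun x => a x * I (fun w => b' w * c (x - w))) - I (fun w => b' w * Psi w).
have DD b1 b2 : hintegrable b1 -> hintegrable b2 ->
    D (fun w => b1 w + b2 w) = D b1 + D b2.
  move=> h1 h2; rewrite /D addrACA -opprD; congr (_ - _).
    rewrite -cradonD; [|exact: radon_mu|exact: Phic|exact: Phic].
    congr mu; apply/funext => x; rewrite -mulrDr -haar_integralD; [|by []|by []|exact: hrc|exact: hrc].
    by congr (_ * haar_integral _ _); apply/funext => w; rewrite mulrDl.
  rewrite -haar_integralD; [|by []|by []|exact: hrP|exact: hrP].
  by congr haar_integral; apply/funext => w; rewrite mulrDl.
apply/eqP; rewrite -subr_eq0 -/(D b); apply/eqP/cabs_eq0/eqP.
rewrite eq_le cabs_ge0 andbT; apply/ler_addgt0Pr => e e0; rewrite add0r.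
(* The first summand in the bracket is the cost of freezing [c (x - w)] at [p] under [mu], the
   second that of freezing [Psi w] under the Haar integral; adding 1 makes [M] positive. *)
pose M := (C' * m * 2 * mb + 2 * mb * C) * fine (theta L) + 1.
have M0 : 0 < M.
  rewrite ltr_wpDl// mulr_ge0// ?fine_ge0// addr_ge0// !mulr_ge0// ltW//.
have eM : 0 < e / M by rewrite divr_gt0.
have : nbhs (0 : G) [set u | forall x, cabs (c (x + u) - c x) < e / M].
  exact: Cc_uniform_continuous.
rewrite nbhsE => -[V [oV V0] Vc].
have step (p : G) (B : set G) : measurable (B : set (borel (pointed G))) ->
    B `<=` L -> (forall w, B w -> V (p - w)) ->
    cabs (D (r B)) <= (C' * m * 2 * mb + 2 * mb * C) * (e / M) * fine (theta B).
  move=> mB BL BV.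
  have cpw w x : B w -> cabs (c (x - w) - c (x - p)) <= e / M.
    move=> /BV /Vc /(_ (x - p)) /ltW.
    by rewrite [X in c X](_ : _ = x - w)// addrA subrK.
  pose beta := I (r B).
  (* Freezing subtracts [beta * Psi p] from both terms of [D (r B)], so the defect does not
     change. *)
  have -> : D (r B) = mu (fun x => a x * I (fun w => r B w * (c (x - w) - c (x - p)))) -
      I (fun w => r B w * (Psi w - Psi p)).
    rewrite /D.
    have E1 x : I (fun w => r B w * (c (x - w) - c (x - p))) =
        I (fun w => r B w * c (x - w)) - c (x - p) * beta.
      rewrite -(haar_integralZ hausG haar_theta); last exact: hr.
      rewrite -(haar_integralB hausG haar_theta); [|exact/hrc/hr|].
        by congr haar_integral; apply/funext => w; ring.
      by apply: hintegrableZ => //; exact: hr.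
    have E2 : I (fun w => r B w * (Psi w - Psi p)) =
        I (fun w => r B w * Psi w) - Psi p * beta.
      rewrite -(haar_integralZ hausG haar_theta); last exact: hr.
      rewrite -(haar_integralB hausG haar_theta); [|exact/hrP/hr|].
        by congr haar_integral; apply/funext => w; ring.
      by apply: hintegrableZ => //; exact: hr.
    have E3 : mu (fun x => a x * I (fun w => r B w * (c (x - w) - c (x - p)))) =
        mu (fun x => a x * I (fun w => r B w * c (x - w))) - beta * Psi p.
      have cp : Cc (fun x => a x * c (x - p)).
        by apply: CcM => //; apply: Cc_ccont; exact: Cc_subr.
      rewrite -cradonZ// -cradonB; [|by []|by []|exact: (Phic _ (hr _ mB BL))|exact: CcZ].
      by congr mu; apply/funext => x; rewrite E1; ring.
    by rewrite E3 E2; ring.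
  have -> : (C' * m * 2 * mb + 2 * mb * C) * (e / M) * fine (theta B) =
    C' * (m * (2 * (mb * (e / M) * fine (theta B)))) +
    2 * (mb * (C * (e / M)) * fine (theta B)) by ring.
  rewrite (le_trans (cabsB _ _))// lerD//.
    apply: bnd.
    - apply: CcM => //.
      have -> : (fun x => I (fun w => r B w * (c (x - w) - c (x - p)))) =
          (fun x => I (fun w => r B w * c (x - w)) - beta * c (x - p)).
        apply/funext => x; rewrite -(mulrC (c _)) -(haar_integralZ hausG haar_theta); last exact: hr.
        rewrite -(haar_integralB hausG haar_theta); [|exact/hrc/hr|].
          by congr haar_integral; apply/funext => w; ring.
        by apply: hintegrableZ => //; exact: hr.
      apply: ccontB; first by apply: haar_conv_ccont => //; exact: hr.
      by apply: Cc_ccont; apply: CcZ => //; exact: Cc_subr.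
    - by move=> x /aKa ->; rewrite mul0r.
    - move=> x; rewrite cabsM ler_pM ?cabs_ge0//.
      apply: (@cabs_haar_integral_bound R G hausG theta haar_theta _ _ B L) => //.
        apply: hintegrableMcc; first exact: hr.
        apply: ccontB; last exact: ccont_cst.
        by apply: ccont_subl; exact: Cc_ccont.
      move=> w; rewrite /r indicE [in leRHS]indicE; have [|] := boolP (w \in B); last first.
        by rewrite !mul0r cabs0 mulr0.
      by rewrite inE => Bw; rewrite mul1r mulr1 cabsM ler_pM ?cabs_ge0// cpw.
  apply: (@cabs_haar_integral_bound R G hausG theta haar_theta _ _ B L) => //.
    apply: hintegrableMcc; first exact: hr.
    by apply: ccontB; [exact: Cc_ccont|exact: ccont_cst].
  move=> w; rewrite /r indicE [in leRHS]indicE; have [|] := boolP (w \in B); last first.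
    by rewrite !mul0r cabs0 mulr0.
  rewrite inE => Bw; rewrite mul1r mulr1 cabsM ler_pM ?cabs_ge0//.
  by apply: est => x; exact: cpw.
have fin B : measurable (B : set (borel (pointed G))) -> B `<=` L ->
    theta B \is a fin_num.
  move=> mB BL; rewrite ge0_fin_numE//.
  by apply: le_lt_trans (compact_fin_haar haar_theta cL); apply: le_measure; rewrite ?inE.
(* Induction on the list of centres: the points of [B] close to the first centre are split off, and
   both [D] and [theta] are additive on the two disjoint pieces. With no centres left [B] is
   empty. *)
have ind (s : seq G) (B : set G) : measurable (B : set (borel (pointed G))) ->
    B `<=` L -> (forall w, B w -> exists2 p, p \in s & V (p - w)) ->
    cabs (D (r B)) <= (C' * m * 2 * mb + 2 * mb * C) * (e / M) * fine (theta B).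
  elim: s B => [|p s ih] B mB BL Bs.
    by apply: (step 0) => // w /Bs[].
  have oVp : open [set w | V (p - w)].
    by apply: open_comp => // w _; exact: subl_continuous.
  have mVp := open_measurable oVp.
  pose B1 := B `&` [set w | V (p - w)]; pose B2 := B `\` [set w | V (p - w)].
  have mB1 : measurable (B1 : set (borel (pointed G))) by exact: measurableI.
  have mB2 : measurable (B2 : set (borel (pointed G))) by exact: measurableD.
  have B1L : B1 `<=` L by move=> w [/BL].
  have B2L : B2 `<=` L by move=> w [/BL].
  have -> : r B = (fun w => r B1 w + r B2 w).
    apply/funext => w; rewrite /r -mulrDl; congr (_ * _).
    rewrite !indicE /B1 /B2 in_setI in_setD.
    by case: (w \in B); case: (w \in _); rewrite /= ?addr0 ?add0r.
  rewrite DD; [|exact: hr|exact: hr].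
  have -> : fine (theta B) = fine (theta B1) + fine (theta B2).
    rewrite -fineD ?fin//; congr fine; rewrite -measureU//.
      by rewrite /B1 /B2 setUIDK.
    by apply/seteqP; split => // w [[_ ?] []].
  rewrite mulrDr (le_trans (cabsD _ _))// lerD//; first by apply: (step p) => // w [].
  apply: ih => // w [Bw nV]; have [q + Vq] := Bs w Bw.
  by rewrite inE => /predU1P[qp|qs]; [rewrite qp in Vq|exists q].
have bE : b = r L.
  apply/funext => w; rewrite /r indicE; have [|] := boolP (w \in L); first by rewrite mul1r.
  by rewrite notin_setE => /bL ->; rewrite mulr0.
have [s Ls] : exists s : seq G, forall w, L w -> exists2 p, p \in s & V (p - w).
  have : @compact (pointed G) L := cL; rewrite compact_cover => /(_ G setT (fun p => [set w | V (p - w)])) [].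
  - by move=> p _; apply: open_comp => // w _; exact: subl_continuous.
  - by move=> w _; exists w => //=; rewrite subrr.
  move=> F _ LF; exists (enum_fset F) => w /LF[p Fp Vp]; exists p => //.
have := ind s L mL (fun _ h => h) Ls; rewrite -bE => /le_trans; apply.
rewrite mulrAC mulrA ler_pdivrMr// mulrC ler_pM2l// /M lerDl//.
Qed.

(** The product [a x * c (x - w)] vanishes unless [w] lies in the compact difference set of the two
    supports, so [b] may be truncated there. *)
Lemma radon_haar_swapl a b c : Cc a -> ccont b -> Cc c ->
  mu (fun x => a x * I (fun w => b w * c (x - w))) =
  I (fun w => b w * mu (fun x => a x * c (x - w))).
Proof.
move=> ca cb cc; have [Ka cKa aKa] := Cc_supp hausG ca.
have [Kc cKc cKc0] := Cc_supp hausG cc.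
pose L := [set x - y | x in Ka & y in Kc].
have cL : compact L by exact: compact_dif.
have mL := compact_measurable_borel hausG cL.
have hb : hintegrable (fun w => \1_L w * b w) by exact: (hintegrable_indic mL cL).
have acw x w : ~ L w -> a x * c (x - w) = 0.
  move=> nL; have [Kx|/aKa ->] := pselect (Ka x); last by rewrite mul0r.
  rewrite cKc0 ?mulr0// => Kxw; apply: nL; exists x => //; exists (x - w) => //.
  by rewrite subKr.
transitivity (mu (fun x => a x * I (fun w => \1_L w * b w * c (x - w)))).
  congr mu; apply/funext => x; have [->|a0] := eqVneq (a x) 0; first by rewrite !mul0r.
  congr (_ * haar_integral _ _); apply/funext => w; rewrite indicE.
  have [|] := boolP (w \in L); first by rewrite mul1r.
  rewrite notin_setE => /(acw x)/eqP; rewrite mulf_eq0 (negbTE a0)/= => /eqP ->.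
  by rewrite !mulr0.
rewrite radon_haar_swap_hintegrable//; congr haar_integral; apply/funext => w.
rewrite indicE; have [|] := boolP (w \in L); first by rewrite mul1r.
rewrite notin_setE => nL; rewrite (_ : (fun x => _) = (fun=> 0)).
  by rewrite cradon0// !mulr0.
by apply/funext => x; exact: acw.
Qed.

(** Here the supports of [b] and [c] confine [x] to a compact sum set; a cutoff equal to 1 on it can
    be inserted as the weight [a]. *)
Lemma radon_haar_swap b c : Cc b -> Cc c ->
  mu (fun x => I (fun w => b w * c (x - w))) =
  I (fun w => b w * mu (fun x => c (x - w))).
Proof.
move=> cb cc; have [Kb cKb bKb] := Cc_supp hausG cb.
have [Kc cKc cKc0] := Cc_supp hausG cc.
pose K := [set x + y | x in Kb & y in Kc].
have cK : compact K by exact: compact_sum.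
have [h [ch _ h1 _]] := Cc_urysohn (R := R) hausG lcG cK openT (fun _ _ => Logic.I).
have bcx x w : b w * c (x - w) != 0 -> h x = 1.
  move=> nz; apply: h1; have [Kw|/bKb b0] := pselect (Kb w); last first.
    by rewrite b0 mul0r eqxx in nz.
  have [Kxw|/cKc0 c0] := pselect (Kc (x - w)); last by rewrite c0 mulr0 eqxx in nz.
  by exists w => //; exists (x - w) => //; rewrite addrC subrK.
have := radon_haar_swapl ch (Cc_ccont cb) cc.
congr (_ = _).
  congr mu; apply/funext => x; have [hx|hx] := pselect (h x = 1); first by rewrite hx mul1r.
  rewrite (_ : (fun w => _) = (fun=> 0)) ?haar_integral0 ?mulr0//.
  apply/funext => w; have [//|/bcx//] := eqVneq (b w * c (x - w)) 0.
congr haar_integral; apply/funext => w; have [->|b0] := eqVneq (b w) 0; first by rewrite !mul0r.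
congr (_ * mu _); apply/funext => x; have [->|c0] := eqVneq (c (x - w)) 0; first by rewrite mulr0.
by rewrite (bcx x w) ?mul1r// mulf_neq0.
Qed.

End functional.
End swap.

(** * Normalised bumps and inversion invariance of Haar measure *)

Section haar_functional.
Context {R : realType} {G : topologicalZmodType}.
Hypothesis hausG : hausdorff_space G.
Hypothesis lcG : locally_compact [set: G].
Variable theta : {measure set (borel (pointed G)) -> \bar R}.
Hypothesis haar_theta : haar_measure theta.
Local Notation I := (haar_integral theta).
Implicit Types (f g : G -> R[i]).

(** A Urysohn function equal to 1 at 0 exceeds 1/2 on a nonempty open set, which has positive Haar
    measure; so its integral is positive and can be normalised. *)
Lemma haar_bump (U : set G) : nbhs (0 : G) U ->
  exists h : G -> R, [/\ Cc (fun x => (h x)%:C), forall x, 0 <= h x,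
    forall x, ~ U x -> h x = 0 & I (fun x => (h x)%:C) = 1].
Proof.
rewrite nbhsE => -[V [oV V0] VU].
have V0' : [set 0] `<=` V by move=> _ ->.
have [h [ch h01 h1 h0]] := Cc_urysohn (R := R) hausG lcG (@compact_set1 _ (0 : G)) oV V0'.
have hcont : continuous h.
  move=> x; have := continuous_Re (Cc_ccont ch); exact.
pose W := [set x | h x > 1 / 2].
have oW : open W.
  apply: (@open_comp _ _ h [set y | y > 1 / 2]); last exact: open_gt.
  by move=> x _; exact: hcont.
have W0 : W !=set0 by exists 0; rewrite /W/= h1// mul1r invf_lt1// ltr1n.
have [K cK hK] := Cc_supp hausG ch.
have WK : W `<=` K.
  move=> x; rewrite /W/= => Wx; apply: contrapT => /hK [hx].
  by move: Wx; rewrite hx ltNge mul1r invr_ge0 ler0n.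
have mW := open_measurable oW.
have hint := hintegrable_Cc hausG ch.
have c0 : 0 < complex.Re (I (fun x => (h x)%:C)).
  apply: (@lt_le_trans _ _ (complex.Re (I (fun x => \1_W x * (1 / 2 : R)%:C)))).
    rewrite (haar_integral_indic hausG haar_theta _ mW cK WK) -realcM/=.
    rewrite mulr_gt0 ?divr_gt0// fine_gt0// (haar_open_gt0 hausG haar_theta oW W0)/=.
    apply: le_lt_trans (compact_fin_haar haar_theta cK).
    by apply: le_measure; rewrite ?inE//; exact: compact_measurable_borel.
  apply: (le_Re_haar_integral hausG haar_theta _ hint).
    exact: (hintegrable_cst _ mW cK WK).
  move=> x; rewrite indicE; have [|] := boolP (x \in W).
    by rewrite inE => Wx; rewrite (mul1r (1 / 2)%:C); exact: (ltW (Wx : 1 / 2 < h x)).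
  by rewrite mul0r/= => _; have /andP[] := h01 x.
set c := complex.Re _ in c0.
have Ih : I (fun x => (h x)%:C) = c%:C by rewrite /c haar_integral_real.
exists (fun x => c^-1 * h x); split.
- have := CcZ hausG (c^-1)%:C ch; congr Cc.
  by apply/funext => x; rewrite realcM.
- by move=> x; apply: mulr_ge0; [rewrite invr_ge0 ltW|case/andP: (h01 x)].
- by move=> x nU; rewrite h0 ?mulr0// => /VU.
- rewrite (_ : (fun x => _) = (fun x => (c^-1)%:C * (h x)%:C)).
    by rewrite (haar_integralZ hausG haar_theta)// Ih -realcM mulVf// gt_eqF.
  by apply/funext => x; rewrite realcM.
Qed.

Lemma haar_cradon : cradon I.
Proof.
split=> [a f g cf cg|K cK].
  have hf := hintegrable_Cc hausG cf; have hg := hintegrable_Cc hausG cg.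
  rewrite (haar_integralD hausG haar_theta)//; last exact: hintegrableZ.
  by rewrite (haar_integralZ hausG haar_theta).
have mK := compact_measurable_borel hausG cK.
exists (2 * fine (theta K)) => f m cf f0 fm.
have := @cabs_haar_integral_bound R G hausG theta haar_theta f m K K
  (hintegrable_Cc hausG cf) mK cK (fun _ h => h).
rewrite -mulrA [_ * m]mulrC; apply => x; rewrite indicE.
have [|] := boolP (x \in K); first by rewrite mulr1.
by rewrite notin_setE => /f0 ->; rewrite cabs0 mulr0.
Qed.

Lemma haar_opp_cradon : cradon (fun f => I (fun x => f (- x))).
Proof.
have [lin bnd] := haar_cradon; split=> [a f g cf cg|K cK].
  by rewrite -lin//; exact: Cc_opp.
have [c cb] := bnd _ (compact_opp cK); exists c => f m cf f0 fm.
apply: cb => [||x]; [exact: Cc_opp| |exact: fm].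
by move=> x nK; apply: f0 => Kx; apply: nK; exists (- x) => //; rewrite opprK.
Qed.

(* Haar measure on an abelian group is invariant under inversion: computing
   [I' (g * f)] in two ways, where [I' f] is the integral of [f (- x)], gives
   [I g * I' f = I' f * I' g]. *)
Lemma haar_integral_opp f : Cc f -> I (fun x => f (- x)) = I f.
Proof.
move=> cf.
pose J g := I (fun x => g (- x)).
(* Taking for [k] the reflection of a normalised bump gives [J k = 1], which then cancels. *)
suff key k : Cc k -> J k * J f = I f * J k.
  have [h [ch _ _ h1]] := haar_bump (filterT : nbhs (0 : G) setT).
  have := key _ (Cc_opp hausG ch); rewrite /J.
  under eq_fun do rewrite opprK.
  by rewrite h1 mul1r mulr1.
move=> ck.
have E1 : J (fun x => I (fun w => f w * k (x - w))) = I f * J k.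
  rewrite [LHS](radon_haar_swap hausG lcG haar_theta haar_opp_cradon cf ck).
  transitivity (I (fun w => J k * f w)); last first.
    by rewrite (haar_integralZ hausG haar_theta _ (hintegrable_Cc hausG cf)); exact: mulrC.
  congr haar_integral; apply/funext => w; rewrite mulrC; congr (_ * _).
  have := haar_integral_addr hausG haar_theta w (hintegrable_Cc hausG (Cc_opp hausG ck)).
  by rewrite /J => <-; congr haar_integral; apply/funext => x; rewrite opprD.
have E2 : J (fun x => I (fun w => f w * k (x - w))) =
    I (fun x => I (fun w => k (- w) * f (- (x - w)))).
  rewrite /J; congr haar_integral; apply/funext => x.
  have hf : hintegrable (fun w => f w * k (- x - w)).
    by apply: hintegrable_Cc => //; apply: CcM => //; exact/Cc_ccont/Cc_subl.
  rewrite -(haar_integral_addl hausG haar_theta (- x) hf).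
  congr haar_integral; apply/funext => w; rewrite mulrC; congr (k _ * f _).
    by rewrite opprD opprK addrA addNr sub0r.
  by rewrite opprB addrC.
rewrite -E1 E2 (radon_haar_swap hausG lcG haar_theta haar_cradon (Cc_opp hausG ck) (Cc_opp hausG cf)).
transitivity (I (fun w => J f * k (- w))).
  rewrite (haar_integralZ hausG haar_theta _ (hintegrable_Cc hausG (Cc_opp hausG ck))).
  exact: mulrC.
congr haar_integral; apply/funext => w; rewrite mulrC; congr (_ * _).
have := haar_integral_subr hausG haar_theta w (hintegrable_Cc hausG (Cc_opp hausG cf)).
by [].
Qed.

End haar_functional.

(** * Restriction of a Radon functional to an open set *)

Lemma continuous_maxf {R : realType} {X : topologicalType} (f g : X -> R) :
  continuous f -> continuous g -> continuous (fun x => Num.max (f x) (g x)).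
Proof. by move=> cf cg x; exact: (continuous_max (cf x) (cg x)). Qed.

Lemma ccont_1B {R : realType} {X : topologicalType} (q : X -> R) :
  ccont (fun x => (q x)%:C) -> ccont (fun x => (1 - q x)%:C).
Proof.
move=> cq; rewrite (_ : (fun x => _) = (fun x => 1 - (q x)%:C)).
  exact: (ccontB (@ccont_cst R X 1) cq).
by apply/funext => x; rewrite realcB.
Qed.

Section restriction.
Context {R : realType} {G : topologicalZmodType}.
Hypothesis hausG : hausdorff_space G.
Hypothesis lcG : locally_compact [set: G].
Implicit Types (mu : (G -> R[i]) -> R[i]) (f g F : G -> R[i]) (A : set G) (h : G -> R).

Lemma complex_phase (z : R[i]) : exists2 u : R[i], cabs u = 1 & u * z = (cabs z)%:C.
Proof.
have [->|z0] := eqVneq z 0; first by exists 1; rewrite ?cabs1// cabs0 mulr0.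
have cz : cabs z != 0 by apply: contra_neq z0 => /cabs_eq0.
exists ((cabs z)^-1%:C * z^*).
  by rewrite cabsM cabs_real cabs_conj ger0_norm ?invr_ge0 ?cabs_ge0// mulVf.
by rewrite -mulrA [_^* * _]mulrC mulcJ -realcM expr2 mulrA mulVf// mul1r.
Qed.

(** A function in C_c(G) that stands in for the indicator of [A]. The last clause expresses that the
    integral of [1_A - h] against [|mu|] is at most [eps], through test functions [k] dominated by
    [1_A - h], so that the total variation need not be formed. *)
Definition fills mu A eps h :=
  [/\ Cc (fun x => (h x)%:C), forall x, 0 <= h x <= 1, forall x, ~ A x -> h x = 0
    & forall k, Cc k -> (forall x, ~ A x -> k x = 0) ->
        (forall x, cabs (k x) <= 1 - h x) -> cabs (mu k) <= eps].

(* If [g] nearly maximises [cabs (mu g)] among the functions of C_c dominated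
   by the indicator of [A], then [cabs g] fills [A]: anything that could be
   added to [g] has a small integral. *)
Lemma fills_ex mu A eps : cradon mu -> relatively_compact A ->
  0 < eps -> exists h, fills mu A eps h.
Proof.
move=> rmu cA eps0.
pose E := [set r | exists g, [/\ Cc g, forall x, ~ A x -> g x = 0,
  forall x, cabs (g x) <= 1 & r = cabs (mu g)]].
have [C C0 bnd] := cradon_bound rmu cA.
have E0 : E !=set0.
  exists (cabs (mu (fun=> 0))), (fun=> 0); split => //; first exact: Cc0.
  by move=> x; rewrite cabs0.
have Eb : has_ubound E.
  exists (C * 1) => _ [g [cg gA g1 ->]]; apply: bnd => // x nA.
  by apply: gA => Ax; apply: nA; exact: subset_closure.
have [r [g [cg gA g1 rE]] gs] := sup_adherent eps0 (conj E0 Eb).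
exists (fun x => cabs (g x)); split => //.
- exact: Cc_cabs.
- by move=> x; rewrite cabs_ge0 g1.
- by move=> x /gA ->; rewrite cabs0.
move=> k ck kA kg.
(* Phases are chosen so that [mu k] and [mu g] add up without cancellation. *)
have [u u1 uk] := complex_phase (mu k); have [v v1 vg] := complex_phase (mu g).
have : E (cabs (mu k) + cabs (mu g)).
  exists (fun x => u * k x + v * g x); split.
  - by apply: CcD => //; exact: CcZ.
  - by move=> x nA; rewrite kA// gA// !mulr0 addr0.
  - move=> x; rewrite (le_trans (cabsD _ _))// !cabsM u1 v1 !mul1r -lerBrDr.
    exact: kg.
  - rewrite cradonD//; [|exact: CcZ|exact: CcZ].
    rewrite !cradonZ// uk vg -realcD cabs_real ger0_norm//.
    by rewrite addr_ge0 ?cabs_ge0.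
move=> /(ub_le_sup Eb); rewrite -rE => h1.
by move: gs; rewrite ltrBlDr => gs; rewrite -(lerD2r r) (le_trans h1)// ltW// addrC.
Qed.

Lemma fills_Cc mu A eps h F : fills mu A eps h -> ccont F ->
  Cc (fun x => F x * (h x)%:C).
Proof. by case=> ch _ _ _ cF; exact: (CcMl hausG cF ch). Qed.

(** Split [h1 - h2] into positive and negative parts. On [A] the positive part is at most [1 - h2]
    and the negative part at most [1 - h1], so after division by [m] each product with [F] is a test
    function for the other filling. *)
Lemma fills_dif mu A e1 e2 h1 h2 F m : cradon mu -> fills mu A e1 h1 ->
  fills mu A e2 h2 -> ccont F -> 0 < m -> (forall x, A x -> cabs (F x) <= m) ->
  cabs (mu (fun x => F x * (h1 x)%:C) - mu (fun x => F x * (h2 x)%:C)) <= m * (e1 + e2).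
Proof.
move=> rmu H1 H2 cF m0 Fm.
have [c1 h101 h1A s1] := H1; have [c2 h201 h2A s2] := H2.
have ch (h h' : G -> R) : Cc (fun x => (h x)%:C) -> Cc (fun x => (h' x)%:C) ->
    Cc (fun x => (Num.max (h x - h' x) 0)%:C).
  move=> ch ch'; apply: (Cc_dominated hausG (CcD hausG (Cc_cabs hausG ch) (Cc_cabs hausG ch'))).
    apply/ccont_real/continuous_maxf => x; last exact: cvg_cst.
    apply: (@continuousB _ _ _ h h' x).
      exact: (continuous_Re (Cc_ccont ch)).
    exact: (continuous_Re (Cc_ccont ch')).
  move=> x; rewrite !cabs_real -realcD => -[hh].
  have h0 : `|h x| = 0 by apply/eqP; rewrite eq_le normr_ge0 andbT -hh lerDl.
  have h'0 : `|h' x| = 0 by apply/eqP; rewrite eq_le normr_ge0 andbT -hh lerDr.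
  by rewrite (normr0_eq0 h0) (normr0_eq0 h'0) subrr maxxx.
have key (h h' : G -> R) e : Cc (fun x => (h x)%:C) -> (forall x, 0 <= h x <= 1) ->
    (forall x, ~ A x -> h x = 0) -> (forall x, 0 <= h' x <= 1) ->
    fills mu A e h' ->
    cabs (mu (fun x => F x * (Num.max (h x - h' x) 0)%:C)) <= m * e.
  move=> c h01 hA h'01 [c' _ h'A s].
  have cm : Cc (fun x => F x * (Num.max (h x - h' x) 0)%:C).
    exact: (CcMl hausG cF (ch _ _ c c')).
  rewrite -ler_pdivrMl//.
  have -> : m^-1 * cabs (mu (fun x => F x * (Num.max (h x - h' x) 0)%:C)) =
      cabs (mu (fun x => (m^-1)%:C * (F x * (Num.max (h x - h' x) 0)%:C))).
    by rewrite cradonZ// cabsM cabs_real ger0_norm// invr_ge0 ltW.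
  apply: s.
  - exact: CcZ.
  - by move=> x nA; rewrite hA// h'A// subrr maxxx !mulr0.
  - move=> x; have m0' : 0 <= Num.max (h x - h' x) 0 by rewrite le_max lexx orbT.
    rewrite !cabsM !cabs_real (ger0_norm m0') ger0_norm ?invr_ge0 ?(ltW m0)//.
    have /andP[hx0 hx1] := h01 x; have /andP[hx0' hx1'] := h'01 x.
    have mx : Num.max (h x - h' x) 0 <= 1 - h' x by rewrite ge_max lerB// subr_ge0.
    have [Ax|nA] := pselect (A x); last first.
      by rewrite hA// h'A// subrr maxxx !mulr0 subr0.
    rewrite mulrA (le_trans _ mx)//; apply: ler_piMl => //.
    by rewrite ler_pdivrMl// mulr1 Fm.
have k1 := key h1 h2 e2 c1 h101 h1A h201 H2.
have k2 := key h2 h1 e1 c2 h201 h2A h101 H1.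
rewrite -(cradonB hausG rmu); [|exact: (fills_Cc H1)|exact: (fills_Cc H2)].
rewrite [X in mu X](_ : _ = (fun x => F x * (Num.max (h1 x - h2 x) 0)%:C -
    F x * (Num.max (h2 x - h1 x) 0)%:C)).
  rewrite (cradonB hausG rmu); [|exact: (CcMl hausG cF (ch _ _ c1 c2))|exact: (CcMl hausG cF (ch _ _ c2 c1))].
  by rewrite (le_trans (cabsB _ _))// mulrDr addrC lerD.
apply/funext => x; rewrite -!mulrBr -!realcB; congr (_ * _%:C).
have [h12|h12] := leP (h1 x) (h2 x).
  rewrite max_r ?subr_le0// max_l ?subr_ge0//; ring.
by rewrite max_l ?subr_ge0 ?ltW// max_r ?subr_le0 ?ltW// subr0.
Qed.

Lemma radon_lsc_small mu (H : G -> \bar R) e g : (radon_lsc_integral mu H < e%:E)%E ->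
  Cc g -> (forall x, ((cabs (g x))%:E <= H x)%E) -> cabs (mu g) < e.
Proof.
move=> He cg gH; rewrite -lte_fin; apply: le_lt_trans He.
by apply: ereal_sup_ubound; exists g.
Qed.

Lemma radon_upper_lsc mu (f : G -> \bar R) e : (radon_upper_integral mu f < e%:E)%E ->
  exists H : G -> \bar R, [/\ lower_semicontinuous H, forall x, (f x <= H x)%E
    & (radon_lsc_integral mu H < e%:E)%E].
Proof. by move=> /ereal_inf_lt[_ [H [lH fH] <-] He]; exists H. Qed.

(* A weak form of the subadditivity of the upper integral: [u] is split by a
   partition of unity for the two open sets where [H1], resp. [H2], dominates
   half of [cabs u] (up to [d]). *)
Lemma radon_lsc_split mu (H1 H2 : G -> \bar R) e u : cradon mu ->
  lower_semicontinuous H1 -> lower_semicontinuous H2 ->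
  (forall x, (0 <= H1 x)%E) -> (forall x, (0 <= H2 x)%E) ->
  (radon_lsc_integral mu H1 < e%:E)%E -> (radon_lsc_integral mu H2 < e%:E)%E ->
  Cc u -> (forall x, ((cabs (u x))%:E <= H1 x + H2 x)%E) ->
  cabs (mu u) <= 4 * e.
Proof.
move=> rmu l1 l2 p1 p2 He1 He2 cu uH.
have [K cK uK] := Cc_supp hausG cu.
have [C C0 bnd] := cradon_bound rmu cK.
apply/ler_addgt0Pr => e' e'0.
pose d := e' / C; have d0 : 0 < d by rewrite divr_gt0.
have dE : e' = C * d by rewrite /d mulrCA divff ?mulr1// gt_eqF.
clearbody d.
(* The product [u * s] has modulus [max (cabs u - d) 0], and the rest [u * (1 - s)] has modulus at
   most [d], which costs at most [C * d = e']. The margin [d] is what makes the sets [O H1] and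
   [O H2], given by strict inequalities, cover the support: outside both, [H1 + H2] is at most
   [cabs u - d]. *)
pose s x := 1 - d / Num.max (cabs (u x)) d.
have mx x : 0 < Num.max (cabs (u x)) d by rewrite lt_max d0 orbT.
have s01 x : 0 <= s x <= 1.
  rewrite /s subr_ge0 ler_pdivrMr// mul1r le_max lexx orbT/=.
  by rewrite gerBl divr_ge0// ltW.
have su x : cabs (u x) * s x = Num.max (cabs (u x) - d) 0.
  rewrite /s; have [ud|ud] := leP (cabs (u x)) d.
    by rewrite divff ?gt_eqF// subrr mulr0 max_r// subr_le0.
  rewrite max_l ?subr_ge0 ?ltW// mulrBr mulr1 mulrCA divff ?mulr1//.
  by rewrite gt_eqF// (lt_trans d0).
have cs : continuous s.
  move=> x; apply: cvgB; first exact: cvg_cst.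
  apply: cvgM; first exact: cvg_cst.
  apply: cvgV; first by rewrite gt_eqF.
  apply: (@continuous_maxf _ _ (fun x => cabs (u x)) (fun=> d)).
    exact: (continuous_cabs (Cc_ccont cu)).
  by move=> y; exact: cvg_cst.
pose O (H : G -> \bar R) := [set x | (((cabs (u x) - d) / 2)%:E < H x)%E].
have oO H : lower_semicontinuous H -> open (O H).
  move=> lH; rewrite openE => x; rewrite /O/= => Hx.
  have [a ha1 ha2] : exists2 a : R, (cabs (u x) - d) / 2 < a & (a%:E < H x)%E.
    move: Hx; case: (H x) => [r||//]; rewrite ?lte_fin.
      by move=> hr; exists (((cabs (u x) - d) / 2 + r) / 2); rewrite ?lte_fin midf_lt.
    by exists ((cabs (u x) - d) / 2 + 1); rewrite ?ltry// ltrDl.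
  have [V Vx VH] := lH x a ha2.
  have /cvgrPdist_lt/(_ (2 * a - (cabs (u x) - d))) := continuous_cabs (Cc_ccont cu) (x := x).
  rewrite subr_gt0 mulrC -ltr_pdivrMr// => /(_ ha1) cux.
  apply: filterS2 Vx cux => y /VH Hy uy; apply: le_lt_trans Hy.
  rewrite lee_fin ler_pdivrMr//.
  have := ler_norm (cabs (u y) - cabs (u x)); rewrite distrC; lra.
have KO : K `\` O H2 `<=` O H1.
  move=> x [_]; rewrite /O/= => /negP; rewrite -leNgt => h2.
  rewrite ltNge; apply/negP => h1.
  have := uH x; move: h1 h2 (p1 x) (p2 x).
  case: (H1 x) => [r1||]//; case: (H2 x) => [r2||]//.
  rewrite !lee_fin => h1 h2 _ _ h3.
  by have := d0; lra.
have cKO : compact (K `\` O H2).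
  apply: (subclosed_compact _ cK); last by move=> x [].
  by apply: closedI; [exact: compact_closed|apply: open_closedC; exact: oO].
have [p [cp p01 pK pO]] := Cc_urysohn (R := R) hausG lcG cKO (oO _ l1) KO.
have csC : ccont (fun x => (s x)%:C) by exact: ccont_real.
(* Half of [u * s * q] is dominated by [H], hence [2 * e] for each of the two parts and [4 * e] in
   total. *)
have small (H : G -> \bar R) (q : G -> R) : (forall x, (0 <= H x)%E) ->
    (radon_lsc_integral mu H < e%:E)%E ->
    ccont (fun x => (q x)%:C) -> (forall x, 0 <= q x <= 1) ->
    (forall x, u x != 0 -> ~ O H x -> q x = 0) ->
    cabs (mu (fun x => u x * ((s x)%:C * (q x)%:C))) <= 2 * e.
  move=> pH He cq q01 qO.
  have cc : Cc (fun x => u x * ((s x)%:C * (q x)%:C)).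
    exact: (CcM hausG cu (ccontM csC cq)).
  rewrite -ler_pdivrMl//.
  have -> : 2^-1 * cabs (mu (fun x => u x * ((s x)%:C * (q x)%:C))) =
      cabs (mu (fun x => (2^-1)%:C * (u x * ((s x)%:C * (q x)%:C)))).
    by rewrite cradonZ// cabsM cabs_real ger0_norm// invr_ge0.
  apply: ltW; apply: (radon_lsc_small He); first exact: CcZ.
  move=> x; rewrite !cabsM !cabs_real.
  have /andP[q0 q1] := q01 x; have /andP[s0 s1] := s01 x.
  rewrite (ger0_norm q0) (ger0_norm s0) ger0_norm ?invr_ge0// (mulrA (cabs (u x))) su.
  have [u0|u0] := eqVneq (u x) 0.
    rewrite u0 cabs0 sub0r max_r ?oppr_le0 ?(ltW d0)// mul0r mulr0; exact: pH.
  have [Ox|nO] := pselect (O H x); last by rewrite qO// !mulr0; exact: pH.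
  have [h|h] := leP (cabs (u x) - d) 0.
    rewrite mul0r mulr0; exact: pH.
  have Ox' : (((cabs (u x) - d) / 2)%:E < H x)%E := Ox.
  apply: le_trans (ltW Ox'); rewrite lee_fin.
  by rewrite mulrC ler_pM2r ?invr_gt0// ler_piMr// ltW.
have ps : cabs (mu (fun x => u x * ((s x)%:C * (p x)%:C))) <= 2 * e.
  by apply: (small H1 p p1 He1 (Cc_ccont cp) p01) => x _; exact: pO.
have qs : cabs (mu (fun x => u x * ((s x)%:C * (1 - p x)%:C))) <= 2 * e.
  apply: (small H2 _ p2 He2 (ccont_1B (Cc_ccont cp))).
  - by move=> x; have /andP[q0 q1] := p01 x; rewrite subr_ge0 q1 gerBl.
  - move=> x u0 nO; rewrite pK ?subrr//; split => //.
    by apply: contrapT => /uK ux; rewrite ux eqxx in u0.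
have rs : cabs (mu (fun x => u x * (1 - s x)%:C)) <= e'.
  rewrite dE; apply: bnd.
  - exact: (CcM hausG cu (ccont_1B csC)).
  - by move=> x /uK ->; rewrite mul0r.
  - move=> x; rewrite cabsM cabs_real /s opprB addrC subrK.
    rewrite ger0_norm ?divr_ge0 ?(ltW d0) ?(ltW (mx x))//.
    by rewrite mulrCA ler_piMr ?(ltW d0)// ler_pdivrMr ?mx// mul1r le_max lexx.
have cus (q : G -> R) : ccont (fun x => (q x)%:C) -> Cc (fun x => u x * ((s x)%:C * (q x)%:C)).
  by move=> cq; exact: (CcM hausG cu (ccontM csC cq)).
have -> : mu u = mu (fun x => u x * ((s x)%:C * (p x)%:C)) +
    mu (fun x => u x * ((s x)%:C * (1 - p x)%:C)) + mu (fun x => u x * (1 - s x)%:C).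
  have c1 := cus _ (Cc_ccont cp); have c2 := cus _ (ccont_1B (Cc_ccont cp)).
  rewrite -(cradonD rmu c1 c2) -(cradonD rmu (CcD hausG c1 c2) (CcM hausG cu (ccont_1B csC))).
  by congr mu; apply/funext => x; rewrite !realcB; ring.
apply: le_trans (cabsD _ _) _; apply: lerD => //.
apply: le_trans (cabsD _ _) _; have := lerD ps qs; lra.
Qed.

(** For two approximants, [cabs (g - g')] is dominated by the sum of the majorants of [cabs (F - g)]
    and [cabs (F - g')], which is where subadditivity enters. The choice [e / 6] pays for its factor
    4 and for the two approximation errors. *)
Lemma has_radon_integral_unique mu F z z' : cradon mu ->
  has_radon_integral mu F z -> has_radon_integral mu F z' -> z = z'.
Proof.
move=> rmu Fz Fz'; apply/eqP; rewrite -subr_eq0; apply/eqP/cabs_eq0/eqP.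
rewrite eq_le cabs_ge0 andbT; apply/ler_addgt0Pr => e e0; rewrite add0r.
have e60 : 0 < e / 6 by rewrite divr_gt0.
have [g [cg /radon_upper_lsc[H [lH FH He]] zg]] := Fz _ e60.
have [g' [cg' /radon_upper_lsc[H' [lH' FH' He']] zg']] := Fz' _ e60.
have p (k : G -> R[i]) (L : G -> \bar R) :
    (forall x, ((cabs (F x - k x))%:E <= L x)%E) -> forall x, (0 <= L x)%E.
  by move=> kL x; apply: le_trans (kL x); rewrite lee_fin cabs_ge0.
have := radon_lsc_split rmu lH lH' (p _ _ FH) (p _ _ FH') He He' (CcB hausG cg cg').
move=> /(_ _)/le_trans gg'.
have {}gg' : cabs (mu g - mu g') <= 4 * (e / 6).
  rewrite -cradonB//; apply: gg' => // x.
  apply: le_trans (leeD (FH x) (FH' x)); rewrite -EFinD lee_fin.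
  by rewrite (le_trans (cabs_sub_le _ _ (F x)))// lerD// cabs_distC.
have h1 := cabs_sub_le z z' (mu g); have h2 := cabs_sub_le (mu g) z' (mu g').
by rewrite cabs_distC in zg'; lra.
Qed.

(** The integral is built as the limit of [mu (F * h n)] for fillings of quality [1 / n.+1], a
    Cauchy sequence by [fills_dif]. Once this limit is known to be an integral of [1_A * F],
    uniqueness identifies it with the value picked by [xget]. *)
Lemma has_radon_integral_restrict mu A F m : cradon mu -> open A ->
  relatively_compact A -> ccont F -> 0 < m -> (forall x, A x -> cabs (F x) <= m) ->
  has_radon_integral mu (fun x => \1_A x * F x)
    (radon_restrict mu A F) /\
  forall eps h, fills mu A eps h ->
    cabs (radon_restrict mu A F - mu (fun x => F x * (h x)%:C)) <= m * eps.
Proof.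
move=> rmu oA cA cF m0 Fm.
have n0 n : 0 < (n.+1%:R)^-1 :> R by rewrite invr_gt0.
have [h hP] := choice (fun n => fills_ex rmu cA (n0 n)).
have lim0 (c e : R) : 0 < e -> \forall n \near \oo, c * (n.+1%:R)^-1 < e.
  move=> e0; have /cvgrPdist_lt/(_ e e0) : (fun n => c * (n.+1%:R)^-1 : R) @ \oo --> (0 : R).
    by rewrite -[X in _ --> X](mulr0 c); apply: cvgMr; exact: cvg_harmonic.
  by apply: filterS => n; rewrite distrC subr0; exact: le_lt_trans (ler_norm _).
have [z zlim] : exists z, clim (fun n => mu (fun x => F x * (h n x)%:C)) z.
  apply: clim_ex => e e0; near \oo => N.
  have NE : (m * 2) * (N.+1%:R)^-1 < e by near: N; exact: lim0.
  exists (mu (fun x => F x * (h N x)%:C)); near=> n.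
  apply: le_lt_trans (fills_dif rmu (hP n) (hP N) cF m0 Fm) _.
  apply: le_lt_trans NE; rewrite -mulrA ler_pM2l// mulrDl mul1r lerD2r.
  rewrite lef_pV2 ?posrE// ler_nat ltnS.
  by near: n; exact: nbhs_infty_ge.
have zest eps (g : G -> R) : fills mu A eps g ->
    cabs (z - mu (fun x => F x * (g x)%:C)) <= m * eps.
  move=> gP; apply/ler_addgt0Pr => e e0; have e20 : 0 < e / 2 by rewrite divr_gt0.
  near \oo => n.
  have h1 : cabs (mu (fun x => F x * (h n x)%:C) - z) < e / 2 by near: n; exact: zlim.
  have h2 : m * (n.+1%:R)^-1 < e / 2 by near: n; exact: lim0.
  have h3 := fills_dif rmu (hP n) gP cF m0 Fm; rewrite mulrDr in h3.
  rewrite (le_trans (cabs_sub_le _ _ (mu (fun x => F x * (h n x)%:C))))//.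
  rewrite cabs_distC in h1; apply: le_trans (lerD (ltW h1) h3) _.
  by rewrite addrA addrC lerD2l [leRHS]splitr lerD2l ltW.
have zint : has_radon_integral mu (fun x => \1_A x * F x) z.
  move=> e e0; have e40 : 0 < e / (2 * m) by rewrite divr_gt0// mulr_gt0.
  have [g gP] := fills_ex rmu cA e40.
  have me : m * (e / (2 * m)) < e.
    have -> : m * (e / (2 * m)) = e / 2 by field; rewrite gt_eqF.
    by rewrite ltr_pdivrMr// ltr_pMr// ltr1n.
  exists (fun x => F x * (g x)%:C); split.
  - exact: (fills_Cc gP).
  - have [cg g01 gA gs] := gP.
    (* A majorant of the difference of [1_A * F] and [F * g], lower semicontinuous because [A] is
       open. A test function below [H] vanishes off [A] and, divided by [m], is admissible in
       [fills]. *)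
    pose H x : \bar R := (m * (\1_A x - g x))%:E.
    have Hin x : A x -> H x = (m * (1 - g x))%:E by move=> Ax; rewrite /H indicE mem_set.
    have Hout x : ~ A x -> H x = 0%E.
      by move=> nA; rewrite /H indicE memNset// gA// subrr mulr0.
    have H0 x : (0 <= H x)%E.
      have [Ax|/Hout -> //] := pselect (A x); rewrite Hin// lee_fin.
      by rewrite mulr_ge0 ?(ltW m0)// subr_ge0; case/andP: (g01 x).
    have lH : lower_semicontinuous H.
      move=> x a; have [Ax|nA] := pselect (A x); last first.
        rewrite Hout// => a0; exists setT; first exact: filterT.
        by move=> y _; exact: lt_le_trans (H0 y).
      rewrite Hin// lte_fin => ax.
      have gc : continuous g by exact: (continuous_Re (Cc_ccont cg)).
      have /cvgrPdist_lt/(_ ((m * (1 - g x) - a) / m)) := gc x.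
      rewrite divr_gt0 ?subr_gt0// => /(_ isT) gx.
      exists (A `&` [set y | `|g x - g y| < (m * (1 - g x) - a) / m]).
        by apply: filterI => //; exact: open_nbhs_nbhs.
      move=> y [Ay /= gy]; rewrite Hin// lte_fin.
      have : g y - g x < (m * (1 - g x) - a) / m.
        by apply: le_lt_trans gy; rewrite distrC ler_norm.
      by rewrite ltr_pdivlMr//; lra.
    apply: (@le_lt_trans _ _ (radon_lsc_integral mu H)).
      apply: ereal_inf_lbound; exists H => //; split => // x.
      have [Ax|nA] := pselect (A x); last first.
        by rewrite Hout// indicE memNset// mul0r gA// mulr0 subrr cabs0.
      rewrite Hin// lee_fin indicE mem_set// mul1r.
      have -> : F x - F x * (g x)%:C = F x * (1 - g x)%:C by rewrite realcB; ring.
      have g1 : 0 <= 1 - g x by rewrite subr_ge0; case/andP: (g01 x).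
      by rewrite cabsM cabs_real ger0_norm// ler_wpM2r// Fm.
    apply: (@le_lt_trans _ _ (m * (e / (2 * m)))%:E); last by rewrite lte_fin.
    apply: ge_ereal_sup => _ [k [ck kH] <-]; rewrite lee_fin -ler_pdivrMl//.
    have -> : m^-1 * cabs (mu k) = cabs (mu (fun x => (m^-1)%:C * k x)).
      by rewrite cradonZ// cabsM cabs_real ger0_norm// invr_ge0 ltW.
    have kA x : ~ A x -> k x = 0.
      move=> nA; apply/cabs_eq0/eqP; rewrite eq_le cabs_ge0 andbT -lee_fin.
      by apply: le_trans (kH x) _; rewrite Hout.
    apply: gs; first exact: CcZ.
      by move=> x /kA ->; rewrite mulr0.
    move=> x; rewrite cabsM cabs_real ger0_norm ?invr_ge0 ?(ltW m0)//.
    have [Ax|nA] := pselect (A x); last by rewrite kA// cabs0 mulr0 gA// subr0.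
    by rewrite ler_pdivrMl// -lee_fin; apply: le_trans (kH x) _; rewrite Hin.
  - apply: le_lt_trans (zest _ _ gP) me.
have -> : radon_restrict mu A F = z.
  rewrite /radon_restrict /radon_integral; case: xgetP => [z' _ z'P|/(_ z)//].
  exact: has_radon_integral_unique z'P zint.
by split.
Unshelve. all: by end_near. Qed.

(** The interface to restrictions: from here on every fact about [radon_restrict] is derived from
    this estimate. *)
Lemma radon_restrict_fills mu A F m eps h : cradon mu -> open A ->
  relatively_compact A -> ccont F -> 0 < m -> (forall x, A x -> cabs (F x) <= m) ->
  fills mu A eps h ->
  cabs (radon_restrict mu A F - mu (fun x => F x * (h x)%:C)) <= m * eps.
Proof.
move=> rmu oA cA cF m0 Fm.
by have [_] := has_radon_integral_restrict rmu oA cA cF m0 Fm; exact.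
Qed.

Lemma fun_tildeK f : fun_tilde (fun_tilde f) = f.
Proof. by apply/funext => x; rewrite /fun_tilde opprK conjc_K. Qed.

Lemma cradon_tilde mu : cradon mu -> cradon (radon_tilde mu).
Proof.
move=> rmu; split=> [a f g cf cg|K cK].
  rewrite /radon_tilde -[a in RHS]conjc_K -conjcM -conjcD.
  rewrite -cradonZ//; last exact: Cc_tilde.
  rewrite -cradonD//; [|exact/CcZ/Cc_tilde|exact: Cc_tilde].
  congr (_ ^*); congr mu; apply/funext => x.
  by rewrite /fun_tilde conjcD conjcM.
have [C C0 bnd] := cradon_bound rmu (compact_opp cK); exists C => f m cf f0 fm.
rewrite cabs_conj; apply: bnd; first exact: Cc_tilde.
  move=> x nK; rewrite /fun_tilde f0 ?conjc_0// => Kx; apply: nK.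
  by exists (- x) => //; rewrite opprK.
by move=> x; rewrite cabs_conj.
Qed.

Lemma fills_tilde mu A eps h : fills mu A eps h ->
  fills (radon_tilde mu) [set - x | x in A] eps (fun x => h (- x)).
Proof.
move=> [ch h01 hA hs].
have opA x : ~ [set - x | x in A] x -> ~ A (- x).
  by move=> nA Ax; apply: nA; exists (- x) => //; rewrite opprK.
split.
- exact: (Cc_opp hausG ch).
- by move=> x; exact: h01.
- by move=> x /opA; exact: hA.
- move=> k ck kA kh; rewrite cabs_conj; apply: hs; first exact: Cc_tilde.
  + move=> x nA; rewrite /fun_tilde kA ?conjc_0// => -[y Ay /oppr_inj yx].
    by rewrite yx in Ay.
  + by move=> x; rewrite cabs_conj -[x in h x]opprK.
Qed.

Lemma relatively_compact_opp A : relatively_compact A ->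
  relatively_compact [set - x | x in A].
Proof.
move=> cA; apply: (subclosed_compact _ (compact_opp cA)).
  exact: closed_closure.
rewrite (closure_id [set - x | x in closure A]).1.
  by apply: closure_subset => _ [x Ax <-]; exists x => //; exact: subset_closure.
by apply: compact_closed => //; exact: compact_opp.
Qed.

(** The reflection of a filling of [A] for [mu] is a filling of [-A] for the tilde of [mu], so one
    [h] approximates both sides by the same number. *)
Lemma radon_restrict_tilde mu A F m : cradon mu -> open A ->
  relatively_compact A -> ccont F -> 0 < m -> (forall x, cabs (F x) <= m) ->
  radon_restrict (radon_tilde mu) [set - x | x in A] F =
  (radon_restrict mu A (fun_tilde F))^*.
Proof.
move=> rmu oA cA cF m0 Fm; apply/eqP; rewrite -subr_eq0; apply/eqP/cabs_eq0/eqP.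
rewrite eq_le cabs_ge0 andbT; apply/ler_addgt0Pr => e e0; rewrite add0r.
have em0 : 0 < e / (2 * m) by rewrite divr_gt0// mulr_gt0.
have [h hP] := fills_ex rmu cA em0.
have cFt : ccont (fun_tilde F).
  by apply: ccontJ; exact: (ccont_comp (@opp_continuous G) cF).
have Ftm x : A x -> cabs (fun_tilde F x) <= m by rewrite cabs_conj.
have h1 := radon_restrict_fills rmu oA cA cFt m0 Ftm hP.
have h2 := radon_restrict_fills (cradon_tilde rmu) (open_opp oA)
  (relatively_compact_opp cA) cF m0 (fun x _ => Fm x) (fills_tilde hP).
rewrite -cabs_conj conjcD conjcN in h1.
apply: le_trans (cabs_sub_le _ _ (radon_tilde mu (fun x => F x * (h (- x))%:C))) _.
have E : radon_tilde mu (fun x => F x * (h (- x))%:C) = (mu (fun x => fun_tilde F x * (h x)%:C))^*.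
  congr (_ ^*); congr mu; apply/funext => x.
  by rewrite /fun_tilde conjcM conjc_R opprK.
have -> : e = m * (e / (2 * m)) + m * (e / (2 * m)) by field; rewrite gt_eqF.
by apply: lerD => //; rewrite E cabs_distC.
Qed.

End restriction.

(** * Translation boundedness and van Hove sequences *)

Section translation_bound.
Context {R : realType} {G : topologicalZmodType}.
Hypothesis hausG : hausdorff_space G.
Hypothesis lcG : locally_compact [set: G].
Variable theta : {measure set (borel (pointed G)) -> \bar R}.
Hypothesis haar_theta : haar_measure theta.
Variable mu : (G -> R[i]) -> R[i].
Hypothesis radon_mu : cradon mu.
Hypothesis tb_mu : translation_bounded mu.
Local Notation I := (haar_integral theta).
Implicit Types (f g : G -> R[i]) (m : R).

Lemma haar_integral_subl f t : Cc f -> I (fun x => f (t - x)) = I f.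
Proof.
move=> cf; rewrite -(haar_integral_opp hausG lcG haar_theta cf).
rewrite -(haar_integral_subr hausG haar_theta t (hintegrable_Cc hausG (Cc_opp hausG cf))).
by congr haar_integral; apply/funext => x; rewrite opprB.
Qed.

(** Converts the bound on variations into one on the functional: a function supported in [t + V]
    with modulus at most 1 lies below every lower semicontinuous majorant of the indicator of
    [t + V]. Scaling gives general [m]. *)
Lemma translation_bounded_open : exists V : set G, [/\ open V, V !=set0,
  relatively_compact V & exists2 C : R, 0 < C & forall t g m, Cc g ->
    (forall x, ~ V (x - t) -> g x = 0) -> (forall x, cabs (g x) <= m) ->
    cabs (mu g) <= C * m].
Proof.
have [V [oV V0 cV]] := tb_mu; set S := ereal_sup _ => Sfin.
exists V; split => //; exists (`|fine S| + 1); first by rewrite ltr_wpDl.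
have key t g : Cc g -> (forall x, ~ V (x - t) -> g x = 0) ->
    (forall x, cabs (g x) <= 1) -> cabs (mu g) <= `|fine S| + 1.
  move=> cg gV g1.
  have : ((cabs (mu g))%:E <= S)%E.
    apply: (@le_trans _ _ (radon_variation mu [set (t + x)%R | x in V])); last first.
      by apply: ereal_sup_ubound; exists t.
    apply: le_ereal_inf_tmp => _ [H [lH VH] <-].
    apply: ereal_sup_ubound; exists g => //; split => // x.
    apply: le_trans (VH x); rewrite lee_fin indicE.
    have [Vx|nV] := pselect (V (x - t)).
      by rewrite mem_set//; exists (x - t) => //; rewrite addrC subrK.
    by rewrite gV// cabs0.
  move: Sfin; case: S => [r|//|]; last by rewrite leeNy_eq.
  by rewrite lee_fin => _ /le_trans; apply; rewrite (le_trans (ler_norm _))// lerDl.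
move=> t g m cg gV gm; have [m0|m0] := ltP 0 m; last first.
  have g0 x : g x = 0.
    by apply/cabs_eq0/eqP; rewrite eq_le cabs_ge0 andbT (le_trans (gm x)).
  have mE : m = 0 by apply/eqP; rewrite eq_le m0 (le_trans (cabs_ge0 _) (gm 0)).
  rewrite (_ : g = (fun=> 0)); first by rewrite cradon0// cabs0 mE mulr0.
  exact/funext.
rewrite mulrC -ler_pdivrMl//.
have -> : m^-1 * cabs (mu g) = cabs (mu (fun x => (m^-1)%:C * g x)).
  by rewrite cradonZ// cabsM cabs_real ger0_norm// invr_ge0 ltW.
apply: (key t); first exact: (CcZ hausG _ cg).
- by move=> x /gV ->; rewrite mulr0.
- move=> x; rewrite cabsM cabs_real ger0_norm ?invr_ge0 ?(ltW m0)//.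
  by rewrite ler_pdivrMl// mulr1.
Qed.

(* [g] is an average of its localisations [g * k(. - w)], each of which is
   controlled by translation boundedness. *)
Lemma translation_bounded_volume : exists W : set G, compact W /\
  exists2 C : R, 0 < C & forall g m (S K : set G), Cc g ->
    measurable (S : set (borel (pointed G))) -> compact K -> S `<=` K -> 0 <= m ->
    (forall x, cabs (g x) <= m) ->
    (forall w x, g x != 0 -> W (x - w) -> S w) ->
    cabs (mu g) <= C * m * fine (theta S).
Proof.
have [V [oV [v Vv] cV [C C0 bnd]]] := translation_bounded_open.
have Vv0 : nbhs (0 : G) [set x | V (v + x)].
  have := @addl_continuous G v 0; rewrite /continuous_at addr0; apply.
  exact: open_nbhs_nbhs.
have [h [ch h0 hV h1]] := haar_bump hausG lcG haar_theta Vv0.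
(* The bump is moved to [v] so that it lives in [V]. By inversion and translation invariance
   [k (x - w)] has integral 1 in [w], which is the partition of unity behind the averaging. *)
pose k x := (h (x - v))%:C.
have ck : Cc k by exact: (Cc_subr hausG v ch).
have kV x : ~ V x -> k x = 0.
  by move=> nV; rewrite /k hV//= addrC subrK.
have k1 x : I (fun w => k (x - w)) = 1.
  rewrite (haar_integral_subl x ck) -h1.
  exact: (haar_integral_subr hausG haar_theta v (hintegrable_Cc hausG ch)).
have [mk mk0 km] := Cc_bounded hausG ck.
exists (closure V); split => //; exists (2 * (C * mk)); first by rewrite !mulr_gt0.
move=> g m S K cg mS cK SK m0 gm gS.
have -> : mu g = I (fun w => 1 * mu (fun x => g x * k (x - w))).
  rewrite -(radon_haar_swapl hausG haar_theta radon_mu cg (@ccont_cst R G 1) ck).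
  congr mu; apply/funext => x; rewrite -[LHS]mulr1 -[X in _ * X = _](k1 x).
  by congr (_ * haar_integral _ _); apply/funext => w; rewrite mul1r.
have -> : 2 * (C * mk) * m * fine (theta S) = 2 * (C * (m * mk) * fine (theta S)) by ring.
apply: (cabs_haar_integral_bound hausG haar_theta _ mS cK SK).
  apply: (hintegrable_Cc hausG); have := radon_conv_Cc hausG radon_mu cg ck.
  by congr Cc; apply/funext => w; rewrite mul1r.
move=> w; rewrite mul1r indicE; have [Sw|nS] := pselect (S w).
  rewrite mem_set// mulr1; apply: (bnd w).
  - exact: (CcM hausG cg (Cc_ccont (Cc_subr hausG w ck))).
  - by move=> x /kV ->; rewrite mulr0.
  - by move=> x; rewrite cabsM ler_pM ?cabs_ge0.
rewrite memNset// mulr0 (_ : (fun x => _) = (fun=> 0)) ?cradon0 ?cabs0//.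
apply/funext => x; have [->|gx] := eqVneq (g x) 0; first by rewrite mul0r.
rewrite kV ?mulr0// => Vx; apply: nS; apply: gS gx _.
exact: subset_closure.
Qed.

(** The volume estimate with [S] the translate by [t] of the difference set of [K] and [W], whose
    measure does not depend on [t]. *)
Lemma translation_bounded_compact (K : set G) : compact K -> exists2 C : R, 0 < C &
  forall t g m, Cc g -> (forall x, ~ K (x - t) -> g x = 0) -> 0 <= m ->
    (forall x, cabs (g x) <= m) -> cabs (mu g) <= C * m.
Proof.
move=> cK; have [W [cW [C C0 bnd]]] := translation_bounded_volume.
pose L := [set x - y | x in K & y in W].
have cL : compact L by exact: compact_dif.
have mL := compact_measurable_borel hausG cL.
exists (C * fine (theta L) + 1).
  by rewrite ltr_wpDl// mulr_ge0 ?fine_ge0// ltW.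
move=> t g m cg gK m0 gm.
have cS : compact [set t + x | x in L].
  by apply: compact_image => //; exact: addl_continuous.
have := bnd g m [set t + x | x in L] _ cg (compact_measurable_borel hausG cS) cS
  (fun _ h => h) m0 gm.
have [_ inv _] := haar_theta.
rewrite inv// => /(_ _)/le_trans; apply => [w x gx Wx|]; last first.
  by rewrite mulrDl mul1r mulrAC lerDl.
have Kx : K (x - t) by apply: contrapT => /gK g0; rewrite g0 eqxx in gx.
exists (w - t); last by rewrite addrC subrK.
exists (x - t) => //; exists (x - w) => //.
by rewrite opprB addrC addrA subrK.
Qed.

Lemma radon_shift_ccont f : Cc f -> ccont (fun w => mu (fun s => f (s - w))).
Proof.
move=> cf; have [K cK fK] := Cc_supp hausG cf.
have [U U0 cU] := locally_compact_nbhs lcG 0.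
(* Translated by [w], this set contains the supports of [f (s - w)] and of [f (s - y)] for all [y]
   near [w], so one constant bounds their difference. *)
have cL : compact (K `|` [set x + y | x in K & y in U]).
  by apply: compactU => //; exact: compact_sum.
have [C C0 bnd] := translation_bounded_compact cL.
apply/ccontP => w e e0; have eC : 0 < e / (2 * C) by rewrite divr_gt0// mulr_gt0.
have uc := Cc_uniform_continuous hausG cf eC.
have sw P : nbhs (0 : G) P -> \forall y \near w, P (w - y).
  by have := @subl_continuous G w w; rewrite /continuous_at subrr; apply.
have swU : \forall y \near w, U (- (w - y)).
  apply: (sw (fun x => U (- x))); have := @opp_continuous G 0.
  by rewrite /continuous_at oppr0; apply.
apply: filterS2 (sw _ uc) swU => y /= yc yU.
have ce : C * (e / (2 * C)) = e / 2 by field; rewrite gt_eqF.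
apply: (@le_lt_trans _ _ (C * (e / (2 * C)))); last first.
  by rewrite ce ltr_pdivrMr// ltr_pMr// ltr1n.
have c1 := Cc_subr hausG y cf; have c2 := Cc_subr hausG w cf.
rewrite -(cradonB hausG radon_mu c1 c2); apply: (bnd w).
- exact: (CcB hausG c1 c2).
- move=> x /not_orP[nK nKU]; rewrite (fK (x - w))// fK ?subrr// => Kxy.
  apply: nKU; exists (x - y) => //; exists (- (w - y)) => //.
  by rewrite opprB addrA subrK.
- exact: ltW.
- move=> x; apply: ltW; have := yc (x - w).
  by rewrite (_ : x - w + (w - y) = x - y)// addrA subrK.
Qed.

(** The weight [q] lets the same bound serve [mu] itself ([q = 1]) and all measures [h mu] with [h]
    a filling. *)
Lemma radon_shift_bounded f : Cc f -> exists2 B : R, 0 < B &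
  forall w (q : G -> R[i]), ccont q -> (forall x, cabs (q x) <= 1) ->
    cabs (mu (fun s => q s * f (s - w))) <= B.
Proof.
move=> cf; have [K cK fK] := Cc_supp hausG cf.
have [C C0 bnd] := translation_bounded_compact cK.
have [m m0 fm] := Cc_bounded hausG cf.
exists (C * m) => [|w q cq q1]; first by rewrite mulr_gt0.
apply: (bnd w); [exact: (CcMl hausG cq (Cc_subr hausG w cf))| |exact: ltW|].
  by move=> x /fK ->; rewrite mulr0.
by move=> x; rewrite cabsM -[m]mul1r ler_pM ?cabs_ge0.
Qed.

End translation_bound.

(** * Van Hove boundaries and means over [A n] *)

Section van_hove.
Context {R : realType} {G : topologicalZmodType}.
Hypothesis hausG : hausdorff_space G.
Hypothesis lcG : locally_compact [set: G].
Variable theta : {measure set (borel (pointed G)) -> \bar R}.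
Hypothesis haar_theta : haar_measure theta.
Variable A : nat -> set G.
Hypothesis vhA : van_hove theta A.
Local Notation I := (haar_integral theta).
Local Notation vol := (vol theta A).

Lemma van_hove_measurable n : measurable (A n : set (borel (pointed G))).
Proof. by have [oA _ _ _] := vhA; exact: open_measurable. Qed.

Lemma van_hove_fin n : theta (A n) \is a fin_num.
Proof.
have [_ cA _ _] := vhA; rewrite ge0_fin_numE//.
apply: le_lt_trans (compact_fin_haar haar_theta (cA n)).
apply: le_measure; rewrite ?inE; [exact: van_hove_measurable| |exact: subset_closure].
exact: (compact_measurable_borel hausG (cA n)).
Qed.

Lemma vol_gt0 n : 0 < vol n.
Proof.
have [_ _ A0 _] := vhA; rewrite fine_gt0// A0/= ltey_eq.
by rewrite van_hove_fin.
Qed.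

Definition boundary_vol (K : set G) n : R := fine (theta (vh_boundary K (A n))).

Lemma vh_boundary_compact (K : set G) n : compact K -> compact (vh_boundary K (A n)).
Proof.
move=> cK; have [_ cA _ _] := vhA.
have cAK := compact_sum (cA n) cK.
apply: compactU; last first.
  by rewrite setIC; exact: (compact_closedI (cA n) (@closed_closure _ _)).
apply: (subclosed_compact _ cAK).
  by apply: closedI; exact: closed_closure.
move=> x [+ _]; rewrite (closure_id [set x + y | x in closure (A n) & y in K]).1.
  by apply: closure_subset => _ [a Aa [k Kk <-]]; exists a; [exact: subset_closure|exists k].
exact: compact_closed.
Qed.

Lemma vh_boundary_measurable (K : set G) n : compact K ->
  measurable ((vh_boundary K (A n) : set G) : set (borel (pointed G))).
Proof. by move=> cK; apply: (compact_measurable_borel hausG); exact: vh_boundary_compact. Qed.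

Lemma boundary_vol_cvg (K : set G) : compact K ->
  (fun n => boundary_vol K n / vol n) @ \oo --> (0 : R).
Proof.
move=> cK; have [_ _ _ /(_ K cK) vh] := vhA.
have E : (fun n => theta (vh_boundary K (A n)) * ((vol n)^-1)%:E)%E =
    (EFin \o (fun n => boundary_vol K n / vol n)).
  apply/funext => n /=; rewrite EFinM fineK// ge0_fin_numE//.
  by apply: (compact_fin_haar haar_theta); exact: vh_boundary_compact.
by move: vh; rewrite E => /fine_cvgP[].
Qed.

Lemma vh_boundary_outer (K : set G) n x k : A n x -> K k -> ~ A n (x + k) ->
  vh_boundary K (A n) (x + k).
Proof.
move=> Ax Kk nA; left; split; last exact: subset_closure.
by apply: subset_closure; exists x => //; exists k.
Qed.

Lemma vh_boundary_inner (K : set G) n x k : ~ A n x -> K k -> A n (x - k) ->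
  vh_boundary K (A n) (x - k).
Proof.
move=> nA Kk Ax; right; split; last exact: subset_closure.
by apply: subset_closure; exists x => //; exists k.
Qed.

Definition mean n (F : G -> R[i]) : R[i] :=
  ((vol n)^-1)%:C * I (fun x => \1_(A n) x * F x).

Lemma hintegrable_van_hove n (F : G -> R[i]) : ccont F -> hintegrable (fun x => \1_(A n) x * F x).
Proof.
move=> cF; have [_ cA _ _] := vhA.
exact: (hintegrable_indic (van_hove_measurable n) (cA n) (@subset_closure _ _) cF).
Qed.

(** The function [Phi] is a compactly supported replacement for [1_(A n) * F]: they differ by at
    most [2 * M] on the van Hove boundary, by at most [d] on the rest of [A n], and agree elsewhere.
    The outer factor 2 comes from the modulus of a complex integral. *)
Lemma mean_compare n (K : set G) (Phi F : G -> R[i]) M d : compact K ->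
  hintegrable Phi -> ccont F -> 0 <= M -> 0 <= d ->
  (forall w, A n w -> ~ vh_boundary K (A n) w -> cabs (Phi w - F w) <= d) ->
  (forall w, ~ A n w -> ~ vh_boundary K (A n) w -> Phi w = 0) ->
  (forall w, cabs (Phi w) <= M) -> (forall w, cabs (F w) <= M) ->
  cabs (((vol n)^-1)%:C * I Phi - mean n F) <=
    2 * (2 * M * (boundary_vol K n / vol n) + d).
Proof.
move=> cK hPhi cF M0 d0 Pin Pout PM FM.
have hF := hintegrable_van_hove n cF.
have [_ cA _ _] := vhA.
rewrite /mean -mulrBr -(haar_integralB hausG haar_theta hPhi hF).
have v0 := vol_gt0 n.
rewrite cabsM cabs_real ger0_norm ?invr_ge0 ?(ltW v0)// ler_pdivrMl//.
have -> : vol n * (2 * (2 * M * (boundary_vol K n / vol n) + d)) =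
    2 * ((2 * M) * boundary_vol K n + d * vol n) by field; rewrite gt_eqF.
have cL := compactU (vh_boundary_compact (n := n) cK) (cA n).
apply: (cabs_haar_integral_bound2 hausG haar_theta (hintegrableB hausG hPhi hF)
  (vh_boundary_measurable n cK) (van_hove_measurable n) cL).
- by move=> x; left.
- by move=> x Ax; right; exact: subset_closure.
move=> w; rewrite !indicE; have [Bw|nB] := pselect (vh_boundary K (A n) w).
  rewrite (mem_set Bw) mulr1.
  have h1 : cabs (Phi w - (w \in A n)%:R * F w) <= 2 * M.
    rewrite (le_trans (cabsB _ _))// mulr2n mulrDl mul1r lerD//.
    by case: (w \in A n); rewrite ?mul1r ?mul0r ?cabs0.
  by rewrite (le_trans h1)// lerDl mulr_ge0.
rewrite (memNset nB) mulr0 add0r; have [Aw|nA] := pselect (A n w).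
  by rewrite mem_set// mul1r mulr1 Pin.
by rewrite memNset// mul0r Pout// subrr cabs0 mulr0.
Qed.

End van_hove.

(** * Autocorrelation and Fourier-Bohr means as means of [mu * f] *)

Section asymptotics.
Context {R : realType} {G : topologicalZmodType}.
Hypothesis hausG : hausdorff_space G.
Hypothesis lcG : locally_compact [set: G].
Variable theta : {measure set (borel (pointed G)) -> \bar R}.
Hypothesis haar_theta : haar_measure theta.
Variable A : nat -> set G.
Hypothesis vhA : van_hove theta A.
Variable mu : (G -> R[i]) -> R[i].
Hypothesis radon_mu : cradon mu.
Hypothesis tb_mu : translation_bounded mu.
Local Notation I := (haar_integral theta).
Local Notation vol := (vol theta A).
Local Notation mean := (mean theta A).
Local Notation gamma := (autocorrelation_approx theta A mu).
Implicit Types (f g phi : G -> R[i]) (h : G -> R).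

(* [rshift f] is the convolution of [mu] with the reflection of [f]. *)
Definition rshift f : G -> R[i] := fun w => mu (fun s => f (s - w)).

(** The same convolution for [h mu], which replaces [mu] restricted to [A n] when [h] fills [A n].
    For [h] and [f] in C_c(G) it is again in C_c(G). *)
Definition rshift_local h f : G -> R[i] := fun w => mu (fun s => (h s)%:C * f (s - w)).

Lemma fills_ge0 (B : set G) eps h : fills mu B eps h -> 0 <= eps.
Proof.
case=> _ h01 _ hs; have := hs (fun=> 0) (Cc0 hausG) (fun _ _ => erefl).
rewrite cradon0// cabs0; apply => x.
by rewrite subr_ge0; case/andP: (h01 x).
Qed.

(** Used at fixed [n] to let the filling error tend to 0; [C] may depend on everything except
    [eps]. *)
Lemma ler_addMgt0 (x y C : R) : (forall eps, 0 < eps -> x <= C * eps + y) -> x <= y.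
Proof.
move=> H; apply/ler_addgt0Pr => e e0.
have e1 : 0 < e / (`|C| + 1) by rewrite divr_gt0// ltr_wpDl.
apply: le_trans (H _ e1) _; rewrite addrC lerD2l.
apply: (@le_trans _ _ (`|C| * (e / (`|C| + 1)))).
  by rewrite ler_wpM2r ?ler_norm// ltW.
by rewrite mulrCA ler_piMr ?(ltW e0)// ler_pdivrMr ?ltr_wpDl// mul1r lerDl.
Qed.

Lemma rshift_ccont f : Cc f -> ccont (rshift f).
Proof. by move=> cf; exact: (radon_shift_ccont hausG lcG haar_theta radon_mu tb_mu cf). Qed.

Lemma rshift_local_Cc h f : Cc (fun x => (h x)%:C) -> Cc f -> Cc (rshift_local h f).
Proof. by move=> ch cf; exact: (radon_conv_Cc hausG radon_mu ch cf). Qed.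

Lemma rshift_bounded f : Cc f -> exists2 B : R, 0 < B &
  (forall w, cabs (rshift f w) <= B) /\
  (forall C eps h, fills mu C eps h -> forall w, cabs (rshift_local h f w) <= B).
Proof.
move=> cf.
have [B B0 bnd] := radon_shift_bounded hausG lcG haar_theta radon_mu tb_mu cf.
exists B => //; split=> [w|C eps h [ch h01 _ _] w].
  have := bnd w (fun=> 1) (@ccont_cst R G 1).
  rewrite /rshift (_ : (fun s => 1 * f (s - w)) = (fun s => f (s - w))).
    by move=> /(_ (fun _ => ltac:(rewrite cabs1; exact: lexx))).
  by apply/funext => s; rewrite mul1r.
apply: bnd; first exact: Cc_ccont.
by move=> x; rewrite cabs_real ger0_norm; case/andP: (h01 x).
Qed.

(** Symmetry lets one [K] serve for points that leave [A n] by adding and by subtracting an element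
    of the support. *)
Lemma symmetric_support f g : Cc f -> Cc g -> exists2 K : set G, compact K &
  [/\ forall x, K x -> K (- x), forall x, ~ K x -> f x = 0
    & forall x, ~ K x -> g x = 0].
Proof.
move=> cf cg; have [K cK fK] := Cc_supp hausG cf; have [L cL gL] := Cc_supp hausG cg.
have cKL := compactU cK cL.
exists ((K `|` L) `|` [set - x | x in K `|` L]).
  exact: (compactU cKL (compact_opp cKL)).
split=> [x [KLx|[y KLy <-]]|x nK|x nK].
- by right; exists x.
- by left; rewrite opprK.
- by apply: fK => Kx; apply: nK; left; left.
- by apply: gL => Lx; apply: nK; left; right.
Qed.

(** A point [s] of [A n] with [s - w] in [K] would place the outside point [w] in the boundary. *)
Lemma rshift_local_out f (K : set G) n eps h w : (forall x, K x -> K (- x)) ->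
  (forall x, ~ K x -> f x = 0) -> fills mu (A n) eps h ->
  ~ A n w -> ~ vh_boundary K (A n) w -> rshift_local h f w = 0.
Proof.
move=> KN fK [ch h01 hA hs] nA nB; rewrite -(cradon0 hausG radon_mu); congr mu.
apply/funext => s; have [As|/hA ->] := pselect (A n s); last by rewrite mul0r.
rewrite fK ?mulr0// => Ks; apply: nB; rewrite (_ : w = s + - (s - w)).
  apply: vh_boundary_outer => //; first exact: KN.
  by rewrite opprB addrC subrK.
by rewrite opprB addrC subrK.
Qed.

(** Away from the boundary the translate of [f] to [w] is supported in [A n], so that
    [(1 - h) * f (. - w) / m] is a test function in the definition of [fills]. *)
Lemma rshift_local_in f (K : set G) n eps h w m : Cc f -> 0 < m ->
  (forall x, cabs (f x) <= m) -> (forall x, K x -> K (- x)) ->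
  (forall x, ~ K x -> f x = 0) -> fills mu (A n) eps h ->
  A n w -> ~ vh_boundary K (A n) w -> cabs (rshift_local h f w - rshift f w) <= m * eps.
Proof.
move=> cf m0 fm KN fK [ch h01 hA hs] Aw nB; rewrite cabs_distC.
have cfw := Cc_subr hausG w cf.
have chf := CcM hausG ch (Cc_ccont cfw).
rewrite /rshift_local /rshift -(cradonB hausG radon_mu cfw chf).
have cd := CcB hausG cfw chf.
rewrite mulrC -ler_pdivrMr// mulrC.
have -> : m^-1 * cabs (mu (fun x => f (x - w) - (h x)%:C * f (x - w))) =
    cabs (mu (fun x => (m^-1)%:C * (f (x - w) - (h x)%:C * f (x - w)))).
  by rewrite (cradonZ hausG radon_mu _ cd) cabsM cabs_real ger0_norm// invr_ge0 ltW.
have E x : f (x - w) - (h x)%:C * f (x - w) = (1 - h x)%:C * f (x - w).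
  by rewrite realcB; ring.
apply: hs; first exact: (CcZ hausG _ cd).
  move=> x nAx; rewrite fK ?mulr0 ?subrr ?mulr0// => Kx; apply: nB.
  rewrite (_ : w = x - (x - w)); last by rewrite opprB addrC subrK.
  apply: vh_boundary_inner => //.
  by rewrite opprB addrC subrK.
have h1 x : 0 <= 1 - h x by rewrite subr_ge0; case/andP: (h01 x).
move=> x; rewrite E !cabsM !cabs_real (ger0_norm (h1 x)) ger0_norm ?invr_ge0 ?(ltW m0)//.
by rewrite mulrCA ler_piMr// ler_pdivrMl// mulr1.
Qed.

Lemma mean_rshift_approx f g : Cc f -> Cc g -> exists K : set G, exists M : R,
  [/\ compact K, 0 <= M & forall n eps h, fills mu (A n) eps h ->
  cabs (((vol n)^-1)%:C * I (fun u => (rshift_local h g u)^* * rshift_local h f u) -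
    mean n (fun u => rshift f u * (rshift g u)^*)) <=
    2 * (2 * M * (boundary_vol theta A K n / vol n) + M * eps)].
Proof.
move=> cf cg; have [K cK [KN fK gK]] := symmetric_support cf cg.
have [m m0 fm] := Cc_bounded hausG cf; have [m' m'0 gm] := Cc_bounded hausG cg.
have [B B0 [fB hfB]] := rshift_bounded cf; have [B' B'0 [gB hgB]] := rshift_bounded cg.
(* The term [B * B'] bounds both integrands; the bracket is the coefficient of [eps] when the two
   factors are replaced one after the other. *)
pose M := B * B' + (m * B' + B * m').
have BB : 0 <= B * B' by rewrite mulr_ge0 ?ltW.
have mB : 0 <= m * B' + B * m' by rewrite addr_ge0 ?mulr_ge0 ?ltW.
have M0 : 0 <= M by rewrite addr_ge0.
exists K, M; split => // n eps h hP.
have eps0 := fills_ge0 hP; have [ch h01 hA hs] := hP.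
have cfh := rshift_local_Cc ch cf; have cgh := rshift_local_Cc ch cg.
apply: (mean_compare hausG haar_theta vhA cK _ _ M0).
- exact: (hintegrable_Cc hausG (CcM hausG (CcJ hausG cgh) (Cc_ccont cfh))).
- exact: (ccontM (rshift_ccont cf) (ccontJ (rshift_ccont cg))).
- by rewrite mulr_ge0.
- move=> w Aw nB.
  have h1 := rshift_local_in cf m0 fm KN fK hP Aw nB.
  have h2 := rshift_local_in cg m'0 gm KN gK hP Aw nB.
  set F := rshift f w in h1 *; set F' := rshift_local h f w in h1 *.
  set H := rshift g w in h2 *; set H' := rshift_local h g w in h2 *.
  have -> : H'^* * F' - F * H^* = (F' - F) * H'^* + F * (H'^* - H^*) by ring.
  apply: le_trans (cabsD _ _) _; rewrite !cabsM -conjcN -conjcD !cabs_conj.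
  apply: (@le_trans _ _ ((m * eps) * B' + B * (m' * eps))).
    apply: lerD; apply: ler_pM; rewrite ?cabs_ge0//.
    - exact: (hgB _ _ _ hP).
    - exact: fB.
  have -> : m * eps * B' + B * (m' * eps) = (m * B' + B * m') * eps by ring.
  by rewrite ler_wpM2r// /M lerDr.
- by move=> w nA nB; rewrite (rshift_local_out KN fK hP)// mulr0.
- move=> w; rewrite cabsM cabs_conj mulrC (@le_trans _ _ (B * B'))// /M ?lerDl//.
  by rewrite ler_pM ?cabs_ge0//; [exact: (hfB _ _ _ hP)|exact: (hgB _ _ _ hP)].
- move=> w; rewrite cabsM cabs_conj (@le_trans _ _ (B * B'))// /M ?lerDl//.
  by rewrite ler_pM ?cabs_ge0.
Qed.

Lemma mean_rshift_mul_approx f (q : G -> R[i]) : Cc f -> ccont q ->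
  (forall x, cabs (q x) = 1) -> exists K : set G, exists M : R,
  [/\ compact K, 0 <= M & forall n eps h, fills mu (A n) eps h ->
  cabs (((vol n)^-1)%:C * I (fun u => q u * rshift_local h f u) -
    mean n (fun u => q u * rshift f u)) <=
    2 * (2 * M * (boundary_vol theta A K n / vol n) + M * eps)].
Proof.
move=> cf cq q1; have [K cK [KN fK _]] := symmetric_support cf cf.
have [m m0 fm] := Cc_bounded hausG cf.
have [B B0 [fB hfB]] := rshift_bounded cf.
exists K, (B + m); split => //; first by rewrite addr_ge0 ?ltW.
move=> n eps h hP; have eps0 := fills_ge0 hP; have [ch h01 hA hs] := hP.
have cfh := rshift_local_Cc ch cf.
apply: (mean_compare hausG haar_theta vhA cK).
- exact: (hintegrable_Cc hausG (CcMl hausG cq cfh)).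
- exact: (ccontM cq (rshift_ccont cf)).
- by rewrite addr_ge0 ?ltW.
- by rewrite mulr_ge0// addr_ge0 ?ltW.
- move=> w Aw nB; have h1 := rshift_local_in cf m0 fm KN fK hP Aw nB.
  rewrite -mulrBr cabsM q1 mul1r (le_trans h1)//.
  by rewrite ler_wpM2r// lerDr ltW.
- by move=> w nA nB; rewrite (rshift_local_out KN fK hP)// mulr0.
- move=> w; rewrite cabsM q1 mul1r (@le_trans _ _ B)//; first exact: (hfB _ _ _ hP).
  by rewrite lerDl ltW.
- by move=> w; rewrite cabsM q1 mul1r (@le_trans _ _ B)// lerDl ltW.
Qed.

(** The convolution of [h mu] with its own tilde, evaluated at [phi]: the approximant of the
    autocorrelation, before normalisation, with the indicator replaced by [h]. *)
Definition local_corr h phi : R[i] :=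
  mu (fun s => (h s)%:C * (rshift_local h (fun_tilde phi) s)^*).

Lemma local_corr_Cc h phi : Cc (fun x => (h x)%:C) -> Cc phi ->
  Cc (fun s => (h s)%:C * (rshift_local h (fun_tilde phi) s)^*).
Proof.
move=> ch cp; have cl := rshift_local_Cc ch (Cc_tilde hausG cp).
exact: (CcM hausG ch (Cc_ccont (CcJ hausG cl))).
Qed.

(** The approximant contains two nested restrictions, which are replaced by [h] one at a time. The
    constant may depend on [n], as it is used only for [eps -> 0] at fixed [n]. *)
Lemma autocorrelation_local n phi : Cc phi -> exists C : R, forall eps h,
  0 < eps -> fills mu (A n) eps h ->
  cabs (gamma n phi - ((vol n)^-1)%:C * local_corr h phi) <= C * eps.
Proof.
move=> cp; have [oA cA _ _] := vhA; have v0 := vol_gt0 hausG haar_theta vhA n.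
have [m m0 pm] := Cc_bounded hausG cp.
have cpt := Cc_tilde hausG cp.
have [B B0 [_ hB]] := rshift_bounded cpt.
have [c c0 bnd] := cradon_bound radon_mu (cA n).
pose inner s := radon_restrict (radon_tilde mu) [set - x | x in A n] (fun t => phi (s + t)).
have innerE s eps h : fills mu (A n) eps h ->
    cabs (inner s - (rshift_local h (fun_tilde phi) s)^*) <= m * eps.
  move=> hP; have cps := Cc_addl hausG s cp.
  rewrite /inner (radon_restrict_tilde hausG lcG radon_mu (oA n) (cA n) (Cc_ccont cps) m0); last by [].
  rewrite -conjcN -conjcD cabs_conj.
  have cpst := Cc_tilde hausG cps.
  have bm x : A n x -> cabs (fun_tilde (fun t => phi (s + t)) x) <= m by rewrite cabs_conj.
  have := radon_restrict_fills hausG lcG radon_mu (oA n) (cA n) (Cc_ccont cpst) m0 bm hP.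
  congr (cabs (_ - _) <= _); congr mu; apply/funext => t.
  by rewrite mulrC /fun_tilde opprB.
have lc h : Cc (fun x => (h x)%:C) -> ccont (fun s => (rshift_local h (fun_tilde phi) s)^*).
  by move=> ch; exact: (Cc_ccont (CcJ hausG (rshift_local_Cc ch cpt))).
(* The outer restriction can be handled only on continuous functions. The inner integral is a
   uniform limit of the continuous functions [rshift_local], since the error in [innerE] does not
   depend on [s]. *)
have inner_cont : ccont inner.
  apply/ccontP => s e e0; have e3 : 0 < e / (3 * m) by rewrite divr_gt0// mulr_gt0.
  have [h hP] := fills_ex hausG radon_mu (cA n) e3.
  have [ch _ _ _] := hP; have := (ccontP _).1 (lc h ch) s (e / 3).
  rewrite divr_gt0// => /(_ isT); apply: filterS => y.
  have me : m * (e / (3 * m)) = e / 3 by field; rewrite gt_eqF.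
  have := innerE s _ _ hP; have := innerE y _ _ hP; rewrite me.
  set a := inner y; set b := inner s; set a' := (_ _ y)^*; set b' := (_ _ s)^*.
  rewrite (cabs_distC b) => h1 h2 h3.
  have := cabs_sub_le a b a'; have := cabs_sub_le a' b b'; lra.
have inner_bnd s : cabs (inner s) <= B + m.
  have [h hP] := fills_ex hausG radon_mu (cA n) (ltr01 : 0 < 1 :> R).
  have := innerE s _ _ hP; rewrite mulr1 => h1.
  rewrite -[inner s](subrK (rshift_local h (fun_tilde phi) s)^*).
  rewrite (le_trans (cabsD _ _))// addrC lerD// cabs_conj.
  exact: (hB _ _ _ hP).
have Bm0 : 0 < B + m by rewrite addr_gt0.
(* [B + m] bounds the integrand of the outer replacement; [c * m] is the inner error carried through
   [mu] on the closure of [A n]. *)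
exists ((vol n)^-1 * ((B + m) + c * m)) => eps h eps0 hP.
have [ch h01 hA hs] := hP.
rewrite /autocorrelation_approx /radon_conv -mulrBr cabsM cabs_real.
rewrite ger0_norm ?invr_ge0 ?(ltW v0)// -mulrA ler_pM2l ?invr_gt0//.
have h1 := radon_restrict_fills hausG lcG radon_mu (oA n) (cA n) inner_cont Bm0
  (fun x _ => inner_bnd x) hP.
apply: le_trans (cabs_sub_le _ _ (mu (fun x => inner x * (h x)%:C))) _.
rewrite mulrDl lerD//.
have c1 := CcMl hausG inner_cont ch.
have c2 := local_corr_Cc ch cp.
rewrite -(cradonB hausG radon_mu c1 c2) -mulrA; apply: bnd.
- exact: (CcB hausG c1 c2).
- move=> x nA; rewrite hA ?mulr0 ?mul0r ?subrr// => Ax; apply: nA.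
  exact: subset_closure.
- move=> x; have -> : inner x * (h x)%:C - (h x)%:C * (rshift_local h (fun_tilde phi) x)^* =
    (h x)%:C * (inner x - (rshift_local h (fun_tilde phi) x)^*) by ring.
  have /andP[hx0 hx1] := h01 x.
  rewrite cabsM cabs_real ger0_norm// (le_trans _ (innerE x _ _ hP))//.
  by rewrite ler_piMl// cabs_ge0.
Qed.

(** Restrictions are defined through a choice, so linearity is not formal; it is inherited from
    [local_corr] as the filling error tends to 0. *)
Lemma autocorrelation_linear n a phi psi : Cc phi -> Cc psi ->
  gamma n (fun x => a * phi x + psi x) = a * gamma n phi + gamma n psi.
Proof.
move=> cp cq; have cap := CcZ hausG a cp; have capq := CcD hausG cap cq.
have [C1 H1] := autocorrelation_local n cp; have [C2 H2] := autocorrelation_local n cq.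
have [C3 H3] := autocorrelation_local n capq.
have [_ cA _ _] := vhA.
apply/eqP; rewrite -subr_eq0; apply/eqP/cabs_eq0/eqP; rewrite eq_le cabs_ge0 andbT.
apply: (@ler_addMgt0 _ _ (C3 + (cabs a * C1 + C2))) => eps eps0; rewrite addr0.
have [h hP] := fills_ex hausG radon_mu (cA n) eps0.
have [ch h01 hA hs] := hP.
have ctp := Cc_tilde hausG cp; have ctq := Cc_tilde hausG cq.
have E : local_corr h (fun x => a * phi x + psi x) =
    a * local_corr h phi + local_corr h psi.
  rewrite /local_corr -(cradonZ hausG radon_mu a (local_corr_Cc ch cp)).
  rewrite -(cradonD radon_mu (CcZ hausG a (local_corr_Cc ch cp)) (local_corr_Cc ch cq)).
  congr mu; apply/funext => s; rewrite mulrCA -mulrDr; congr (_ * _).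
  rewrite -[a in RHS]conjc_K -conjcM -conjcD; congr (_ ^*).
  have d1 := CcM hausG ch (Cc_ccont (Cc_subr hausG s ctp)).
  have d2 := CcM hausG ch (Cc_ccont (Cc_subr hausG s ctq)).
  rewrite /rshift_local -(cradonZ hausG radon_mu _ d1).
  rewrite -(cradonD radon_mu (CcZ hausG _ d1) d2).
  congr mu; apply/funext => t; rewrite /fun_tilde conjcD conjcM; ring.
have := H3 _ _ eps0 hP; have := H1 _ _ eps0 hP; have := H2 _ _ eps0 hP.
rewrite E; set g1 := gamma n phi; set g2 := gamma n psi; set g3 := gamma n _.
set v := (_)%:C; set l1 := local_corr h phi; set l2 := local_corr h psi.
move=> h2 h1 h3.
have -> : g3 - (a * g1 + g2) = (g3 - v * (a * l1 + l2)) - (a * (g1 - v * l1) + (g2 - v * l2)) by ring.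
apply: le_trans (cabsB _ _) _; rewrite mulrDl lerD// (le_trans (cabsD _ _))//.
rewrite mulrDl lerD// cabsM -mulrA ler_wpM2l//; exact: cabs_ge0.
Qed.

(** Fubini twice, once for each copy of [mu], followed by a translation of the integration variable.
    The identity is exact because [h] already confines both copies. *)
Lemma local_corr_conv h f g : Cc (fun x => (h x)%:C) -> Cc f -> Cc g ->
  local_corr h (fun_conv theta f (fun_tilde g)) =
  I (fun u => (rshift_local h g u)^* * rshift_local h f u).
Proof.
move=> ch cf cg.
have cgh := rshift_local_Cc ch cg.
rewrite -(radon_haar_swapl hausG haar_theta radon_mu ch (Cc_ccont (CcJ hausG cgh)) cf).
congr mu; apply/funext => s; congr (_ * _).
have cfs : ccont (fun u => (f (s - u))^*) := Cc_ccont (CcJ hausG (Cc_subl hausG s cf)).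
transitivity ((I (fun u => (f (s - u))^* * rshift_local h g u))^*); last first.
  rewrite -(haar_integralJ hausG haar_theta (hintegrable_Cc hausG (CcMl hausG cfs cgh))).
  by congr haar_integral; apply/funext => u; rewrite conjcM conjc_K mulrC.
congr (_ ^*).
rewrite -(radon_haar_swapl hausG haar_theta radon_mu ch cfs cg).
congr mu; apply/funext => t; congr (_ * _).
have c1 : Cc (fun u => f (- (t - s) - u) * fun_tilde g u).
  exact: (CcM hausG (Cc_subl hausG _ cf) (Cc_ccont (Cc_tilde hausG cg))).
rewrite {1}/fun_tilde /fun_conv.
rewrite -(haar_integral_subr hausG haar_theta t (hintegrable_Cc hausG c1)).
rewrite -(haar_integralJ hausG haar_theta); last first.
  exact: (hintegrable_Cc hausG (Cc_subr hausG t c1)).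
congr haar_integral; apply/funext => u; rewrite conjcM /fun_tilde conjc_K opprB.
by congr ((f _)^* * g _); rewrite !opprB ?addrA ?subrK.
Qed.

Lemma fun_conv_Cc f g : Cc f -> Cc g -> Cc (fun_conv theta f g).
Proof.
move=> cf cg.
have := radon_conv_Cc hausG (haar_cradon hausG haar_theta) cg (Cc_opp hausG cf).
congr Cc; apply/funext => t; rewrite /fun_conv; congr haar_integral.
by apply/funext => s; rewrite opprB mulrC.
Qed.

Theorem autocorrelation_conv_mean f g : Cc f -> Cc g ->
  clim (fun n => gamma n (fun_conv theta f (fun_tilde g)) -
    mean n (fun u => rshift f u * (rshift g u)^*)) 0.
Proof.
move=> cf cg; have [K [M [cK M0 HM]]] := mean_rshift_approx cf cg.
have [_ cA _ _] := vhA.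
apply: (@clim0_squeeze _ _ (fun n => (4 * M) * (boundary_vol theta A K n / vol n))); last first.
  rewrite -[X in _ --> X](mulr0 (4 * M)); apply: cvgMr.
  exact: (boundary_vol_cvg hausG haar_theta vhA cK).
apply: nearW => n.
have [C HC] := autocorrelation_local n (fun_conv_Cc cf (Cc_tilde hausG cg)).
apply: (@ler_addMgt0 _ _ (C + 2 * M)) => eps eps0.
have [h hP] := fills_ex hausG radon_mu (cA n) eps0; have [ch _ _ _] := hP.
have h1 := HC _ _ eps0 hP; rewrite (local_corr_conv ch cf cg) in h1.
have h2 := HM _ _ _ hP.
apply: le_trans (cabs_sub_le _ _ _) (le_trans (lerD h1 h2) _).
rewrite le_eqVlt; apply/orP; left; apply/eqP; ring.
Qed.

(** Characters are eigenfunctions of convolution, with eigenvalue [fcheck theta f chi]; with [h mu]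
    in place of the restriction this is the exact identity [E], and comparing with the means costs
    the boundary term. *)
Theorem fourier_bohr_mean_rshift f (chi : dual R G) : Cc f ->
  clim (fun n => mean n (fun u => (chi u)^* * rshift f u) -
    fourier_bohr_mean theta A mu chi n * fcheck theta f chi) 0.
Proof.
move=> cf; pose q : G -> R[i] := fun u => (chi u)^*.
have cq : ccont q by apply: ccontJ; exact: dual_continuous.
have q1 x : cabs (q x) = 1 by rewrite cabs_conj dual_abs.
have [K [M [cK M0 HM]]] := mean_rshift_mul_approx cf cq q1.
have [oA cA _ _] := vhA.
apply: (@clim0_squeeze _ _ (fun n => (4 * M) * (boundary_vol theta A K n / vol n))); last first.
  rewrite -[X in _ --> X](mulr0 (4 * M)); apply: cvgMr.
  exact: (boundary_vol_cvg hausG haar_theta vhA cK).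
apply: nearW => n; have v0 := vol_gt0 hausG haar_theta vhA n.
set J := fcheck theta f chi.
apply: (@ler_addMgt0 _ _ (2 * M + (vol n)^-1 * cabs J)) => eps eps0.
have [h hP] := fills_ex hausG radon_mu (cA n) eps0; have [ch _ _ _] := hP.
have h1 := HM _ _ _ hP.
have h2 := radon_restrict_fills hausG lcG radon_mu (oA n) (cA n) cq ltr01 _ hP.
have {}h2 : cabs (radon_restrict mu (A n) q - mu (fun x => q x * (h x)%:C)) <= eps.
  by rewrite -[leRHS]mul1r; apply: h2 => x _; rewrite q1.
have cqh := CcMl hausG cq ch.
have E : mu (fun x => q x * (h x)%:C) * J = I (fun u => q u * rshift_local h f u).
  rewrite mulrC -(cradonZ hausG radon_mu J cqh).
  rewrite -(radon_haar_swapl hausG haar_theta radon_mu ch cq cf).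
  congr mu; apply/funext => s.
  have cp : Cc (fun x => q (s - x) * f x).
    exact: (CcMl hausG (ccont_subl (x := s) cq) cf).
  have -> : I (fun w => q w * f (s - w)) = q s * J.
    have := haar_integral_subl hausG lcG haar_theta s cp.
    under eq_fun do rewrite subKr.
    move=> ->; rewrite /J /fcheck.
    have ccf : Cc (fun t => chi t * f t).
      by apply: (CcMl hausG _ cf); exact: dual_continuous.
    rewrite -(haar_integralZ hausG haar_theta (q s) (hintegrable_Cc hausG ccf)).
    congr haar_integral; apply/funext => x; rewrite mulrA; congr (_ * _).
    have : chi (s - x) * chi x = chi s by rewrite -dual_add subrK.
    rewrite /q => <-; rewrite conjcM -mulrA -[LHS]mulr1.
    by congr (_ * _); rewrite mulrC mulcJ dual_abs expr1n.
  ring.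
rewrite cabs_distC /fourier_bohr_mean.
apply: le_trans (cabs_sub_le _ _ (((vol n)^-1)%:C * I (fun u => q u * rshift_local h f u))) _.
have h3 : cabs (((vol n)^-1)%:C * radon_restrict mu (A n) q * J -
    ((vol n)^-1)%:C * I (fun u => q u * rshift_local h f u)) <= (vol n)^-1 * cabs J * eps.
  rewrite -E -mulrA -mulrBr -mulrBl !cabsM cabs_real ger0_norm ?invr_ge0 ?(ltW v0)//.
  by rewrite -mulrA ler_pM2l ?invr_gt0// mulrC ler_wpM2l ?cabs_ge0.
apply: le_trans (lerD h3 h1) _.
rewrite le_eqVlt; apply/orP; left; apply/eqP; ring.
Qed.

(** Translation boundedness bounds the inner integral by a multiple of [m] and the outer one by a
    multiple of the volume of [A n] enlarged by a boundary. That enlarged volume is at most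
    [(1 + D) * vol n], so normalisation leaves a constant independent of [n]. *)
Theorem autocorrelation_bound (K : set G) : compact K -> exists2 C : R, 0 < C &
  forall n phi m, Cc phi -> (forall x, ~ K x -> phi x = 0) ->
    (forall x, cabs (phi x) <= m) -> cabs (gamma n phi) <= C * m.
Proof.
move=> cK; have [oA cA _ _] := vhA.
have [C1 C10 H1] := translation_bounded_compact hausG lcG haar_theta radon_mu tb_mu (compact_opp cK).
have [W [cW [C2 C20 H2]]] := translation_bounded_volume hausG lcG haar_theta radon_mu tb_mu.
have cNW := compact_opp cW.
have [D D0 HD] : exists2 D : R, 0 < D & forall n,
    boundary_vol theta A [set - x | x in W] n / vol n <= D.
  have cb := boundary_vol_cvg hausG haar_theta vhA cNW.
  have /cvg_seq_bounded : cvgn (fun n => boundary_vol theta A [set - x | x in W] n / vol n).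
    by apply/cvg_ex; exists 0.
  move=> [M [_ HM]]; exists (`|M| + 1); first by rewrite ltr_wpDl.
  move=> n; apply: le_trans (ler_norm _) _; apply: HM => //.
  by rewrite (le_lt_trans (ler_norm _))// ltrDl.
exists (C2 * C1 * (1 + D)); first by rewrite !mulr_gt0// addr_gt0.
move=> n phi m cp pK pm; have m0 : 0 <= m := le_trans (cabs_ge0 _) (pm 0).
have v0 := vol_gt0 hausG haar_theta vhA n.
have [C HC] := autocorrelation_local n cp.
apply: (@ler_addMgt0 _ _ C) => eps eps0.
have [h hP] := fills_ex hausG radon_mu (cA n) eps0; have [ch h01 hA hs] := hP.
have hq x : cabs (h x)%:C <= 1.
  by rewrite cabs_real ger0_norm; case/andP: (h01 x).
have ctp := Cc_tilde hausG cp.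
have inner s : cabs (rshift_local h (fun_tilde phi) s) <= C1 * m.
  apply: (H1 s) => //.
  - exact: (CcM hausG ch (Cc_ccont (Cc_subr hausG s ctp))).
  - move=> x nK; rewrite /fun_tilde pK ?conjc_0 ?mulr0// => Kx; apply: nK.
    by exists (- (x - s)) => //; rewrite opprK.
  - by move=> x; rewrite cabsM cabs_conj -[m]mul1r ler_pM ?cabs_ge0.
(* If [h x] is nonzero and [x - w] lies in [W], then [w = x - (x - w)] is in [A n] or leaves it by
   an element of [B]. *)
pose B := [set - x | x in W].
have mS : measurable ((A n `|` vh_boundary B (A n) : set G) : set (borel (pointed G))).
  apply: measurableU; first exact: (van_hove_measurable vhA).
  exact: (vh_boundary_measurable hausG vhA n cNW).
have cS := compactU (cA n) (vh_boundary_compact hausG vhA (n := n) cNW).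
have h2 : cabs (local_corr h phi) <= C2 * (C1 * m) *
    fine (theta (A n `|` vh_boundary B (A n))).
  apply: (H2 _ _ _ _ (local_corr_Cc ch cp) mS cS).
  - by move=> x [Ax|Bx]; [left; exact: subset_closure|right].
  - by rewrite mulr_ge0// ltW.
  - by move=> x; rewrite cabsM cabs_conj -[C1 * m]mul1r ler_pM ?cabs_ge0.
  - move=> w x nz Wx; have [Aw|nA] := pselect (A n w); [by left|right].
    rewrite (_ : w = x + - (x - w)); last by rewrite opprB addrC subrK.
    apply: vh_boundary_outer; [|by exists (x - w)|by rewrite opprB addrC subrK].
    by apply: contrapT => /hA hx; rewrite hx mul0r eqxx in nz.
have fB : theta (vh_boundary B (A n)) \is a fin_num.
  rewrite ge0_fin_numE//; apply: (compact_fin_haar haar_theta).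
  exact: (vh_boundary_compact hausG vhA (n := n) cNW).
have fA := van_hove_fin hausG haar_theta vhA n.
have h3 : fine (theta (A n `|` vh_boundary B (A n))) <= vol n * (1 + D).
  apply: (@le_trans _ _ (vol n + boundary_vol theta A B n)).
    have le2 : (theta (A n `|` vh_boundary B (A n)) <=
        theta (A n) + theta (vh_boundary B (A n)))%E.
      by apply: measureU2; [exact: (van_hove_measurable vhA)|exact: (vh_boundary_measurable hausG vhA n cNW)].
    rewrite /vol /boundary_vol -fineD// fine_le ?fin_numD ?fA ?fB//.
    by rewrite ge0_fin_numE// (le_lt_trans le2)// ltey_eq fin_numD fA fB.
  by rewrite mulrDr mulr1 lerD2l mulrC -ler_pdivrMr// HD.
rewrite -[gamma n phi](subrK (((vol n)^-1)%:C * local_corr h phi)).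
apply: le_trans (cabsD _ _) _; apply: lerD; first exact: HC.
rewrite cabsM cabs_real ger0_norm ?invr_ge0 ?(ltW v0)// ler_pdivrMl//.
apply: le_trans h2 _.
have -> : vol n * (C2 * C1 * (1 + D) * m) = C2 * (C1 * m) * (vol n * (1 + D)) by ring.
by rewrite ler_wpM2l// !mulr_ge0// ltW.
Qed.

End asymptotics.

(** * Parseval's identity for Besicovitch almost periodic functions *)

Section besicovitch.
Context {R : realType} {G : topologicalZmodType}.
Hypothesis hausG : hausdorff_space G.
Hypothesis lcG : locally_compact [set: G].
Variable theta : {measure set (borel (pointed G)) -> \bar R}.
Hypothesis haar_theta : haar_measure theta.
Variable A : nat -> set G.
Hypothesis vhA : van_hove theta A.
Local Notation I := (haar_integral theta).
Local Notation vol := (vol theta A).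
Local Notation mean := (mean theta A).
Implicit Types (F H P : G -> R[i]) (chi psi : dual R G) (s : seq (dual R G)).

Lemma dual_ccont chi : ccont chi.
Proof. exact: dual_continuous. Qed.

Lemma dual_ext chi psi : (forall t, chi t = psi t) -> chi = psi.
Proof.
case: chi => f fc fa f1; case: psi => g gc ga g1 /= fg.
have {fg} E : f = g by exact/funext.
rewrite E in fc fa f1 *.
by rewrite (Prop_irrelevance fc gc) (Prop_irrelevance fa ga) (Prop_irrelevance f1 g1).
Qed.

Lemma meanD n F H : ccont F -> ccont H ->
  mean n (fun x => F x + H x) = mean n F + mean n H.
Proof.
move=> cF cH; rewrite /mean -mulrDr; congr (_ * _).
rewrite -(haar_integralD hausG haar_theta); [|exact: (hintegrable_van_hove vhA)..].
by congr haar_integral; apply/funext => x; rewrite mulrDr.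
Qed.

Lemma meanZ n a F : ccont F -> mean n (fun x => a * F x) = a * mean n F.
Proof.
move=> cF; rewrite /mean mulrCA; congr (_ * _).
rewrite -(haar_integralZ hausG haar_theta a (hintegrable_van_hove vhA n cF)).
by congr haar_integral; apply/funext => x; rewrite mulrCA.
Qed.

Lemma meanJ n F : ccont F -> mean n (fun x => (F x)^*) = (mean n F)^*.
Proof.
move=> cF; rewrite /mean conjcM conjc_R; congr (_ * _).
rewrite -(haar_integralJ hausG haar_theta (hintegrable_van_hove vhA n cF)).
congr haar_integral; apply/funext => x; rewrite conjcM; congr (_ * _).
by rewrite indicE; case: (x \in A n); rewrite ?conjc_1 ?conjc_0.
Qed.

Lemma mean1 n : mean n (fun=> 1) = 1.
Proof.
have [_ cA _ _] := vhA.
rewrite /mean (haar_integral_indic hausG haar_theta _ (van_hove_measurable vhA n)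
  (cA n) (@subset_closure _ _)).
have v0 := vol_gt0 hausG haar_theta vhA n.
by rewrite mulr1 -realcM mulVf// gt_eqF.
Qed.

Definition ip n F H : R[i] := mean n (fun x => F x * (H x)^*).

Definition nsq n F : R := complex.Re (ip n F F).

Lemma nsq_ge0 n F : ccont F -> 0 <= nsq n F.
Proof.
move=> cF; have v0 := vol_gt0 hausG haar_theta vhA n.
rewrite /nsq /ip /mean cReM/= mul0r subr0 mulr_ge0// ?invr_ge0 ?(ltW v0)//.
have c0 : hintegrable (fun _ : G => 0 : R[i]) := hintegrable_Cc hausG (Cc0 hausG).
have hF := hintegrable_van_hove vhA n (ccontM cF (ccontJ cF)).
have := le_Re_haar_integral hausG haar_theta c0 hF.
rewrite haar_integral0; apply => x; rewrite mulcJ indicE.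
by case: (x \in A n); rewrite ?mul1r ?mul0r//= sqr_ge0.
Qed.

Lemma ip_nsq n F : ccont F -> ip n F F = (nsq n F)%:C.
Proof.
move=> cF; have E : (ip n F F)^* = ip n F F.
  rewrite /ip -meanJ; last exact: (ccontM cF (ccontJ cF)).
  apply: (congr1 (mean n)); apply/funext => x.
  by rewrite conjcM conjc_K mulrC.
rewrite /nsq; case: (ip n F F) E => a b /= [bb].
by congr (_ +i* _); lra.
Qed.

Lemma ipDl n F H P : ccont F -> ccont H -> ccont P ->
  ip n (fun x => F x + H x) P = ip n F P + ip n H P.
Proof.
move=> cF cH cP; rewrite /ip -(meanD n (ccontM cF (ccontJ cP)) (ccontM cH (ccontJ cP))).
by apply: (congr1 (mean n)); apply/funext => x; rewrite mulrDl.
Qed.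

Lemma ipZl n a F P : ccont F -> ccont P ->
  ip n (fun x => a * F x) P = a * ip n F P.
Proof.
move=> cF cP; rewrite /ip -(meanZ n a (ccontM cF (ccontJ cP))).
by apply: (congr1 (mean n)); apply/funext => x; rewrite mulrA.
Qed.

Lemma ipBl n F H P : ccont F -> ccont H -> ccont P ->
  ip n (fun x => F x - H x) P = ip n F P - ip n H P.
Proof.
move=> cF cH cP; have cZ : ccont (fun x => -1 * H x) := ccontM (@ccont_cst R G (-1)) cH.
rewrite -mulN1r -(ipZl n (-1) cH cP) -(ipDl n cF cZ cP).
by congr (ip n _ P); apply/funext => x; rewrite mulN1r.
Qed.

Lemma ipJ n F P : ccont F -> ccont P -> ip n P F = (ip n F P)^*.
Proof.
move=> cF cP; rewrite /ip -(meanJ n (ccontM cF (ccontJ cP))).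
by apply: (congr1 (mean n)); apply/funext => x; rewrite conjcM conjc_K mulrC.
Qed.

Lemma nsqD n F H : ccont F -> ccont H ->
  nsq n (fun x => F x + H x) = nsq n F + nsq n H + 2 * complex.Re (ip n F H).
Proof.
move=> cF cH; have cFH := ccontD cF cH.
rewrite /nsq (ipDl n cF cH cFH) (ipJ n cFH cF) (ipJ n cFH cH).
rewrite (ipDl n cF cH cF) (ipDl n cF cH cH) (ipJ n cF cH).
by rewrite !conjcD conjc_K !cReD !cRe_conj; ring.
Qed.

Lemma ip_dual_self n chi : ip n chi chi = 1.
Proof.
rewrite -(mean1 n); apply: (congr1 (mean n)); apply/funext => x.
by rewrite mulcJ dual_abs expr1n.
Qed.

Lemma nsqB_dual n F chi c : ccont F ->
  nsq n (fun x => F x - c * chi x) =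
  nsq n F - 2 * complex.Re (c^* * ip n F chi) + cabs c ^+ 2.
Proof.
move=> cF; have cchi := @dual_ccont chi.
have cZ : ccont (fun x => - c * chi x) := ccontM (@ccont_cst R G (- c)) cchi.
transitivity (nsq n (fun x => F x + - c * chi x)).
  by congr (nsq n _); apply/funext => x; rewrite mulNr.
rewrite (nsqD n cF cZ) (ipJ n cZ cF) (ipZl n _ cchi cF) (ipJ n cF cchi).
rewrite /nsq (ipZl n _ cchi cZ) (ipJ n cZ cchi) (ipZl n _ cchi cchi) ip_dual_self.
rewrite mulr1 mulcJ cabsN/= conjcM conjc_K conjcN mulNr cReN.
ring.
Qed.

Lemma ip_dual_le n F chi : ccont F -> cabs (ip n F chi) ^+ 2 <= nsq n F.
Proof.
move=> cF; have cchi := @dual_ccont chi; set c := ip n F chi.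
have : 0 <= nsq n (fun x => F x - c * chi x).
  by apply: nsq_ge0; exact: (ccontB cF (ccontM (@ccont_cst R G c) cchi)).
rewrite nsqB_dual// -/c [_^* * _]mulrC mulcJ/=; lra.
Qed.

(* The mean of a character changes by a boundary term under translation and
   is multiplied by [q t]; hence it vanishes in the limit unless [q = 1]. *)
Lemma mean_multiplicative (q : G -> R[i]) t : ccont q -> (forall x, cabs (q x) = 1) ->
  (forall x, q (t + x) = q t * q x) -> q t != 1 -> clim (fun n => mean n q) 0.
Proof.
move=> cq q1 qM qt.
(* The indicator of [A n] and its translate by [t] differ only on the boundary for this [K]; the two
   elements account for leaving and for entering [A n]. *)
pose K : set G := [set t] `|` [set - t].
have cK : compact K by apply: compactU; exact: compact_set1.
pose bd n := boundary_vol theta A K n.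
have qt0 : q t - 1 != 0 by rewrite subr_eq0.
suff key : clim (fun n => (q t - 1) * mean n q) 0.
  have := climZ (q t - 1)^-1 key; rewrite mulr0; congr clim.
  by apply/funext => n; rewrite mulrA mulVf// mul1r.
apply: (@clim0_squeeze _ _ (fun n => 2 * (bd n / vol n))); last first.
  rewrite -[X in _ --> X](mulr0 2); apply: cvgMr.
  exact: (boundary_vol_cvg hausG haar_theta vhA cK).
apply: nearW => n; have v0 := vol_gt0 hausG haar_theta vhA n.
have hq := hintegrable_van_hove vhA n cq.
have cqt : ccont (fun x => q (t + x)) := ccont_comp (@addl_continuous G t) cq.
have hqt := hintegrable_van_hove vhA n cqt.
have [_ cA _ _] := vhA.
have ht : hintegrable (fun x => \1_(A n) (t + x) * q (t + x)).
  pose B := [set - t + x | x in A n].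
  have oB : open B by apply: open_translate; have [] := vhA.
  have cB : compact [set - t + x | x in closure (A n)].
    by apply: compact_image; [exact: addl_continuous|exact: cA].
  have BS : B `<=` [set - t + x | x in closure (A n)].
    by move=> _ [x Ax <-]; exists x => //; exact: subset_closure.
  have := hintegrable_indic (open_measurable oB) cB BS cqt.
  congr hintegrable; apply/funext => x; rewrite !indicE; congr (_%:R * _); congr nat_of_bool.
  apply/idP/idP; rewrite !inE.
    by move=> [y Ay <-]; rewrite addNKr.
  by move=> Atx; exists (t + x) => //; rewrite addKr.
have -> : (q t - 1) * mean n q = ((vol n)^-1)%:C *
    I (fun x => \1_(A n) x * q (t + x) - \1_(A n) (t + x) * q (t + x)).
  rewrite (haar_integralB hausG haar_theta hqt ht).
  rewrite (haar_integral_addl hausG haar_theta t hq).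
  rewrite mulrBr mulrBl mul1r; congr (_ - _).
  rewrite -(meanZ n (q t) cq); congr (_ * _); congr haar_integral.
  by apply/funext => x; rewrite qM.
rewrite cabsM cabs_real ger0_norm ?invr_ge0 ?(ltW v0)// ler_pdivrMl//.
have -> : vol n * (2 * (bd n / vol n)) = 2 * (1 * bd n) by field; rewrite gt_eqF.
apply: (cabs_haar_integral_bound hausG haar_theta (hintegrableB hausG hqt ht)
  (vh_boundary_measurable hausG vhA n cK) (vh_boundary_compact hausG vhA (n := n) cK)) => //.
move=> x; rewrite mul1r -mulrBl cabsM q1 mulr1 !indicE.
have [Ax|nA] := pselect (A n x); have [Atx|nAt] := pselect (A n (t + x)).
- by rewrite (mem_set Ax) (mem_set Atx) subrr cabs0.
- have Bx : vh_boundary K (A n) x.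
    rewrite (_ : x = t + x - t); last by rewrite addrAC subrr add0r.
    apply: vh_boundary_inner => //; first by left.
    by rewrite addrAC subrr add0r.
  by rewrite (mem_set Ax) (mem_set Bx) (memNset nAt) subr0 cabs1.
- have Bx : vh_boundary K (A n) x.
    rewrite (_ : x = t + x + - t); last by rewrite addrAC subrr add0r.
    apply: vh_boundary_outer => //; first by right.
    by rewrite addrAC subrr add0r.
  by rewrite (memNset nA) (mem_set Bx) (mem_set Atx) sub0r cabsN cabs1.
- by rewrite (memNset nA) (memNset nAt) subrr cabs0.
Qed.

Lemma dual_orthonormal chi psi : clim (fun n => ip n chi psi) (chi == psi)%:R.
Proof.
have [<-|ne] := eqVneq chi psi.
  rewrite (_ : (fun n => _) = (fun=> 1)); first exact: clim_cst.
  by apply/funext => n; exact: ip_dual_self.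
have [t tne] : exists t, chi t != psi t.
  apply: contrapT => /forallNP H; move/negP: ne; apply; apply/eqP/dual_ext => t.
  by apply/eqP/negPn/negP; exact: H.
apply: (@mean_multiplicative _ t).
- exact: (ccontM (@dual_ccont chi) (ccontJ (@dual_ccont psi))).
- by move=> x; rewrite cabsM cabs_conj !dual_abs mulr1.
- by move=> x; rewrite !dual_add conjcM; ring.
- apply: contra_neq tne => E.
  transitivity (chi t * (psi t)^* * psi t); last by rewrite E mul1r.
  by rewrite -mulrA (mulrC _^*) mulcJ dual_abs expr1n mulr1.
Qed.

Definition tpoly s (c : dual R G -> R[i]) : G -> R[i] :=
  fun x => \sum_(chi <- s) c chi * chi x.

Lemma tpoly_ccont s c : ccont (tpoly s c).
Proof.
elim: s => [|chi s ih]; rewrite /tpoly.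
  rewrite (_ : (fun _ => _) = (fun=> 0)); first exact: ccont_cst.
  by apply/funext => x; rewrite big_nil.
rewrite (_ : (fun _ => _) = (fun x => c chi * chi x + tpoly s c x)).
  exact: (ccontD (ccontM (@ccont_cst R G (c chi)) (@dual_ccont chi)) ih).
by apply/funext => x; rewrite big_cons.
Qed.

Lemma tpoly_trig s c : trig_poly (tpoly s c).
Proof.
exists (size s), (fun i => c (tnth (in_tuple s) i)), (fun i => tnth (in_tuple s) i) => t.
by rewrite /tpoly (big_tnth _ _ s).
Qed.

(** Completing the square, one character at a time: after subtracting [c chi * chi] the coefficients
    at the remaining characters are unchanged in the limit. The difference with [nsq n F] is used
    because [nsq n F] is not yet known to converge. *)
Lemma nsqB_tpoly F a c s : ccont F -> uniq s ->
  (forall chi, chi \in s -> clim (fun n => ip n F chi) (a chi)) ->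
  (fun n => nsq n (fun x => F x - tpoly s c x) - nsq n F) @ \oo -->
  \sum_(chi <- s) (cabs (c chi - a chi) ^+ 2 - cabs (a chi) ^+ 2).
Proof.
elim: s F a => [|chi s ih] F a cF; first move=> _ _.
  rewrite big_nil (_ : (fun n => _) = (fun=> 0)); first exact: cvg_cst.
  apply/funext => n; apply/eqP; rewrite subr_eq0; apply/eqP; congr (nsq n _).
  by apply/funext => x; rewrite /tpoly big_nil subr0.
rewrite cons_uniq => /andP[nchi us] lim.
have cchi := @dual_ccont chi.
have cZ : ccont (fun x => c chi * chi x) := ccontM (@ccont_cst R G (c chi)) cchi.
pose F' x := F x - c chi * chi x.
have cF' : ccont F' := ccontB cF cZ.
have lim' psi : psi \in s -> clim (fun n => ip n F' psi) (a psi).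
  move=> ps; have chipsi : chi == psi = false.
    by apply/negbTE; apply: contraNneq nchi => ->.
  have h1 := lim psi; rewrite inE ps orbT in h1.
  have h2 := climZ (c chi) (dual_orthonormal chi psi); rewrite chipsi mulr0 in h2.
  have := climB (h1 isT) h2; rewrite subr0; congr clim; apply/funext => n.
  rewrite /F' -(ipZl n _ cchi (@dual_ccont psi)).
  by rewrite -(ipBl n cF cZ (@dual_ccont psi)).
have h := ih F' a cF' us lim'.
rewrite big_cons addrC.
rewrite (_ : (fun n => _) = (fun n => (nsq n (fun x => F' x - tpoly s c x) - nsq n F') +
    (- (2 * complex.Re ((c chi)^* * ip n F chi)) + cabs (c chi) ^+ 2))); last first.
  apply/funext => n; rewrite /F' (nsqB_dual n _ _ cF).
  have -> : nsq n (fun x => F x - tpoly (chi :: s) c x) =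
      nsq n (fun x => F x - c chi * chi x - tpoly s c x).
    by congr (nsq n _); apply/funext => x; rewrite /tpoly big_cons opprD addrA.
  ring.
apply: cvgD; first exact: h.
have lchi : clim (fun n => ip n F chi) (a chi) by apply: lim; rewrite mem_head.
have l2 := clim_Re (climZ (c chi)^* lchi).
have -> : cabs (c chi - a chi) ^+ 2 - cabs (a chi) ^+ 2 =
    - (2 * complex.Re ((c chi)^* * a chi)) + cabs (c chi) ^+ 2.
  rewrite !sqr_cabs cReD cImD cReN cImN cReM cRe_conj cIm_conj; ring.
by apply: cvgD; [apply: cvgN; apply: cvgMr; exact: l2|exact: cvg_cst].
Qed.

(** Combinations in which a character may be repeated, as [trig_poly] allows; [tpoly] has one
    coefficient per character and, on a duplicate-free list, fits the orthogonality relations. *)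
Definition lpoly (l : seq (R[i] * dual R G)) : G -> R[i] :=
  fun x => \sum_(p <- l) p.1 * p.2 x.

Lemma lpoly_ccont l : ccont (lpoly l).
Proof.
elim: l => [|p l ih]; rewrite /lpoly.
  rewrite (_ : (fun _ => _) = (fun=> 0)); first exact: ccont_cst.
  by apply/funext => x; rewrite big_nil.
rewrite (_ : (fun _ => _) = (fun x => p.1 * p.2 x + lpoly l x)).
  exact: (ccontD (ccontM (@ccont_cst R G p.1) (@dual_ccont p.2)) ih).
by apply/funext => x; rewrite big_cons.
Qed.

Lemma trig_poly_lpoly P : trig_poly P -> exists l, P = lpoly l.
Proof.
move=> [n [c [chi Pe]]]; exists [seq (c i, chi i) | i <- index_enum 'I_n].
by apply/funext => t; rewrite Pe /lpoly big_map.
Qed.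

Lemma tpoly_lpoly s c : tpoly s c = lpoly [seq (c chi, chi) | chi <- s].
Proof. by apply/funext => t; rewrite /lpoly big_map. Qed.

Lemma lpoly_ip F (l : seq (R[i] * dual R G)) (b : dual R G -> R[i]) : ccont F ->
  (forall p, p \in l -> clim (fun n => ip n F p.2) (b p.2)) ->
  clim (fun n => ip n F (lpoly l)) (\sum_(p <- l) p.1^* * b p.2).
Proof.
move=> cF; elim: l => [|p l ih] lim.
  rewrite big_nil (_ : (fun n => _) = (fun=> 0)); first exact: clim_cst.
  apply/funext => n; rewrite (ipJ n (@lpoly_ccont [::]) cF).
  have -> : lpoly [::] = (fun x => 0 * F x).
    by apply/funext => x; rewrite /lpoly big_nil mul0r.
  by rewrite (ipZl n 0 cF cF) mul0r conjc_0.
have cp := @dual_ccont p.2.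
have cZ : ccont (fun x => p.1 * p.2 x) := ccontM (@ccont_cst R G p.1) cp.
have h1 := climZ p.1^* (lim p (mem_head _ _)).
have h2 : clim (fun n => ip n F (lpoly l)) (\sum_(q <- l) q.1^* * b q.2).
  by apply: ih => q ql; apply: lim; rewrite inE ql orbT.
rewrite big_cons; have := climD h1 h2; congr clim; apply/funext => n.
have cl := @lpoly_ccont l.
rewrite (ipJ n cp cF) -conjcM -(ipZl n _ cp cF) (ipJ n cl cF) -conjcD.
rewrite -(ipDl n cZ cl cF) -(ipJ n (ccontD cZ cl) cF).
by congr (ip n F _); apply/funext => x; rewrite /lpoly big_cons.
Qed.

Lemma tpoly_ip_dual s c chi : uniq s -> chi \in s ->
  clim (fun n => ip n (tpoly s c) chi) (c chi).
Proof.
move=> us chis; have ct := @tpoly_ccont s c; have cchi := @dual_ccont chi.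
have := @lpoly_ip chi [seq (c psi, psi) | psi <- s] (fun psi => (chi == psi)%:R) cchi
  (fun p _ => @dual_orthonormal chi p.2).
rewrite big_map (bigD1_seq chi)//= eqxx mulr1 big1_seq ?addr0; last first.
  by move=> psi /andP[+ _]; rewrite eq_sym => /negbTE ->; rewrite mulr0.
move=> /climJ; rewrite conjc_K; congr clim; apply/funext => n.
by rewrite -tpoly_lpoly -(ipJ n cchi ct).
Qed.

Lemma nsq_lim_tpoly F a s : ccont F -> uniq s ->
  (forall chi, clim (fun n => ip n F chi) (a chi)) ->
  (fun n => nsq n (fun x => F x - tpoly s a x) - nsq n F) @ \oo -->
  - \sum_(chi <- s) cabs (a chi) ^+ 2.
Proof.
move=> cF us lim; rewrite (_ : - _ = \sum_(chi <- s) (cabs (a chi - a chi) ^+ 2 -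
    cabs (a chi) ^+ 2)); first by apply: nsqB_tpoly.
by rewrite -sumrN; apply: eq_bigr => chi _; rewrite subrr cabs0 expr0n/= sub0r.
Qed.

Lemma nsqB_tpoly_lim F a s r : ccont F -> uniq s ->
  (forall chi, clim (fun n => ip n F chi) (a chi)) -> nsq n F @[n --> \oo] --> r ->
  (fun n => nsq n (fun x => F x - tpoly s a x)) @ \oo -->
  r - \sum_(chi <- s) cabs (a chi) ^+ 2.
Proof.
move=> cF us lim rlim.
rewrite (_ : (fun n => _) = (fun n => nsq n F +
    (nsq n (fun x => F x - tpoly s a x) - nsq n F))).
  exact: (cvgD rlim (@nsq_lim_tpoly F a s cF us lim)).
by apply/funext => n; rewrite addrC subrK.
Qed.

Theorem besicovitch_parseval F : ccont F ->
  (forall e, 0 < e -> exists l, \forall n \near \oo, nsq n (fun x => F x - lpoly l x) < e) ->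
  exists (a : dual R G -> R[i]) (r : R),
  [/\ forall chi, clim (fun n => ip n F chi) (a chi), nsq n F @[n --> \oo] --> r,
    forall s, uniq s -> \sum_(chi <- s) cabs (a chi) ^+ 2 <= r
  & forall e, 0 < e -> exists2 s, uniq s & r <= \sum_(chi <- s) cabs (a chi) ^+ 2 + e].
Proof.
move=> cF bF.
(* By the Cauchy-Schwarz inequality, coefficients of [F] are uniformly close in [n] to those of an
   approximating polynomial, and these converge by orthonormality. *)
have /choice[a aP] : forall chi, exists z, clim (fun n => ip n F chi) z.
  move=> chi; apply: clim_ex => e e0; have e20 : 0 < e / 2 by rewrite divr_gt0.
  have [l Pl] := bF ((e / 2) ^+ 2) (exprn_gt0 _ e20).
  have cl := @lpoly_ccont l; have cchi := @dual_ccont chi.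
  have := climJ (@lpoly_ip chi l (fun psi => (chi == psi)%:R) cchi
    (fun p _ => @dual_orthonormal chi p.2)).
  set z := (_^*) => zlim; exists z; near=> n.
  rewrite [e]splitr; apply: le_lt_trans (cabs_sub_le _ _ (ip n (lpoly l) chi)) _.
  apply: ltrD; last first.
    by rewrite (ipJ n cchi cl); near: n; exact: zlim.
  rewrite -(ipBl n cF cl cchi) -(ltr_pXn2r (ltn0Sn 1)) ?nnegrE ?cabs_ge0 ?(ltW e20)//.
  apply: le_lt_trans (ip_dual_le n chi (ccontB cF cl)) _.
  by near: n.
(* This gives both the Cauchy property of [nsq n F] and the approximation of its limit by partial
   sums. *)
have approx e : 0 < e -> exists2 s, uniq s & \forall n \near \oo,
    `|nsq n F - \sum_(chi <- s) cabs (a chi) ^+ 2| < e.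
  move=> e0; have e30 : 0 < e / 3 by rewrite divr_gt0.
  have [l Pl] := bF _ e30; pose s := undup [seq p.2 | p <- l].
  have us : uniq s := undup_uniq _; exists s => //.
  (* The asymptotic orthogonal projection of [F] onto the characters of the approximating
     polynomial. Since [F - Q] is asymptotically orthogonal to [Q - lpoly l], replacing [lpoly l] by
     [Q] does not worsen the approximation in the limit. *)
  pose Q := tpoly s a; have cQ : ccont Q := @tpoly_ccont s a.
  have cl := @lpoly_ccont l; have cH : ccont (fun x => F x - Q x) := ccontB cF cQ.
  have cQl : ccont (fun x => Q x - lpoly l x) := ccontB cQ cl.
  have Hlim chi : chi \in s -> clim (fun n => ip n (fun x => F x - Q x) chi) 0.
    move=> chis; have := climB (aP chi) (tpoly_ip_dual a us chis).
    rewrite subrr; congr clim; apply/funext => n.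
    by rewrite (ipBl n cF cQ (@dual_ccont chi)).
  have HP : clim (fun n => ip n (fun x => F x - Q x) (lpoly l)) 0.
    have := @lpoly_ip _ l (fun=> 0) cH; rewrite big1 ?mulr0//; last by move=> p _; rewrite mulr0.
    by apply => p pl; apply: Hlim; rewrite mem_undup; apply: map_f.
  have HQ : clim (fun n => ip n (fun x => F x - Q x) Q) 0.
    have := @lpoly_ip _ [seq (a chi, chi) | chi <- s] (fun=> 0) cH.
    rewrite -tpoly_lpoly big1; last by move=> p _; rewrite mulr0.
    by apply => p /mapP[chi chis ->]; exact: Hlim.
  (* The cross term is doubled in the expansion [h4], so [e / 6] leaves a third of [e] for it. *)
  have e60 : 0 < e / 6 by rewrite divr_gt0.
  have HD := climB HQ HP; rewrite subrr in HD.
  have /cvgrPdist_lt/(_ _ e30) L := @nsq_lim_tpoly F a s cF us aP.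
  near=> n.
  have h1 : `|- \sum_(chi <- s) cabs (a chi) ^+ 2 -
    (nsq n (fun x => F x - Q x) - nsq n F)| < e / 3 by near: n.
  have h2 : nsq n (fun x => F x - lpoly l x) < e / 3 by near: n.
  have h3 : cabs (ip n (fun x => F x - Q x) Q -
    ip n (fun x => F x - Q x) (lpoly l) - 0) < e / 6 by near: n; exact: HD.
  have h4 : nsq n (fun x => F x - lpoly l x) = nsq n (fun x => F x - Q x) +
    nsq n (fun x => Q x - lpoly l x) +
    2 * complex.Re (ip n (fun x => F x - Q x) Q - ip n (fun x => F x - Q x) (lpoly l)).
    rewrite (ipJ n cQ cH) (ipJ n cl cH) -conjcN -conjcD -(ipBl n cQ cl cH).
    rewrite -(ipJ n cQl cH) -(nsqD n cH cQl).
    by congr (nsq n _); apply/funext => x; rewrite addrA subrK.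
  have h5 := nsq_ge0 n cQl; have h6 := nsq_ge0 n cH.
  rewrite subr0 in h3; have h7 := le_lt_trans (Re_le_cabs _) h3.
  move: h7 h1; rewrite !ltr_norml => /andP[h7 h7'] /andP[h1 h1'].
  clear -h1 h1' h2 h4 h5 h6 h7 h7'.
  move: h1 h1' h4 h7 h7'; set S := \sum_(chi <- s) _; set x := nsq n F.
  set y := nsq n (fun x => F x - Q x) in h6 *; set b := nsq n _ in h5 *.
  set c := complex.Re _; move: h2; set d := nsq n _.
  clearbody S x y b c d => *; by apply/andP; split; lra.
have [z zlim] : exists z, clim (fun n => (nsq n F)%:C) z.
  apply: clim_ex => e /approx[s _ sP].
  exists (\sum_(chi <- s) cabs (a chi) ^+ 2)%:C; apply: filterS sP => n.
  by rewrite -realcB cabs_real.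
have rlim : nsq n F @[n --> \oo] --> complex.Re z := clim_Re zlim.
exists a, (complex.Re z); split => //.
  move=> s us; rewrite -subr_ge0.
  apply: (cvgr_to_ge (nsqB_tpoly_lim cF us aP rlim)); apply: nearW => n.
  by apply: nsq_ge0; exact: (ccontB cF (@tpoly_ccont s a)).
move=> e /approx[s us sP]; exists s => //.
apply: (cvgr_to_le rlim); apply: filterS sP => n; rewrite ltr_norml => /andP[_ h].
by lra.
Unshelve. all: by end_near. Qed.

Theorem parseval_besicovitch F (a : dual R G -> R[i]) (r : R) : ccont F ->
  (forall chi, clim (fun n => ip n F chi) (a chi)) -> nsq n F @[n --> \oo] --> r ->
  (forall e, 0 < e -> exists2 s, uniq s & r <= \sum_(chi <- s) cabs (a chi) ^+ 2 + e) ->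
  forall e, 0 < e -> exists s, \forall n \near \oo,
    nsq n (fun x => F x - tpoly s a x) < e.
Proof.
move=> cF aP rlim sup e e0; have e20 : 0 < e / 2 by rewrite divr_gt0.
have [s us rs] := sup _ e20; exists s.
have h : r - \sum_(chi <- s) cabs (a chi) ^+ 2 < e by lra.
by have /cvgr_lt/(_ e h) := nsqB_tpoly_lim cF us aP rlim.
Qed.

End besicovitch.

(** * The Besicovitch seminorm in terms of means *)

Section besicovitch_norm_limit.
Context {R : realType} {G : topologicalZmodType}.
Hypothesis hausG : hausdorff_space G.
Variable theta : {measure set (borel (pointed G)) -> \bar R}.
Hypothesis haar_theta : haar_measure theta.
Variable A : nat -> set G.
Hypothesis vhA : van_hove theta A.
Local Notation I := (haar_integral theta).
Local Notation vol := (vol theta A).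
Local Notation nsq := (nsq theta A).
Implicit Types (F : G -> R[i]).

Lemma integral_cabs2 F (B K : set G) : ccont F ->
  measurable (B : set (borel (pointed G))) -> compact K -> B `<=` K ->
  (\int[theta]_(t in B) ((cabs (F t)) ^+ 2)%:E)%E =
  (complex.Re (I (fun x => \1_B x * (F x * (F x)^*))))%:E.
Proof.
move=> cF mB cK BK; have hF := hintegrable_indic mB cK BK (ccontM cF (ccontJ cF)).
have iF := Re_integrable hausG haar_theta hF.
rewrite /haar_integral/= /Rintegral fineK; last exact: integrable_fin_num.
rewrite [LHS]integral_mkcond; apply: eq_integral => x _.
rewrite patchE indicE mulcJ; case: (x \in B).
  by rewrite mul1r.
by rewrite mul0r.
Qed.

Lemma L2loc_ccont F : ccont F -> L2loc theta F.
Proof.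
move=> cF; split.
- exact: (continuous_borel_measurable (continuous_Re cF)).
- exact: (continuous_borel_measurable (continuous_Im cF)).
- move=> K cK; rewrite (integral_cabs2 cF (compact_measurable_borel hausG cK) cK (fun _ h => h)).
  exact: ltry.
Qed.

Lemma besicovitch_term n F : ccont F ->
  (((vol n)^-1)%:E * \int[theta]_(t in A n) ((cabs (F t)) ^+ 2)%:E)%E = (nsq n F)%:E.
Proof.
move=> cF; have [_ cA _ _] := vhA.
rewrite (integral_cabs2 cF (van_hove_measurable vhA n) (cA n) (@subset_closure _ _)).
by rewrite /nsq /ip /mean cReM/= mul0r subr0 -EFinM.
Qed.

Lemma besicovitch_norm_lt F e : ccont F ->
  (besicovitch_norm theta A F < e%:E)%E -> \forall n \near \oo, nsq n F < e ^+ 2.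
Proof.
move=> cF /ereal_inf_lt[_ [V Voo <-] supV].
apply: filterS Voo => n Vn.
have : ((nsq n F)%:E `^ 2^-1 < e%:E)%E.
  by apply: le_lt_trans supV; apply: ereal_sup_ubound; exists n => //; rewrite besicovitch_term.
have n0 := nsq_ge0 hausG haar_theta vhA n cF.
rewrite poweR_EFin lte_fin powR12_sqrt// => h.
rewrite -[ltLHS]sqr_sqrtr// ltr_pXn2r// nnegrE ?sqrtr_ge0//.
exact: le_trans (sqrtr_ge0 _) (ltW h).
Qed.

(** An eventual bound passes to the upper limit only as a weak inequality; [e / 2] restores
    strictness. *)
Lemma lt_besicovitch_norm F e : ccont F -> 0 < e ->
  (\forall n \near \oo, nsq n F < (e / 2) ^+ 2) -> (besicovitch_norm theta A F < e%:E)%E.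
Proof.
move=> cF e0 near; apply: (@le_lt_trans _ _ (e / 2)%:E); last first.
  by rewrite lte_fin ltr_pdivrMr// ltr_pMr// ltr1n.
apply: (@le_trans _ _ (ereal_sup ((fun n => (((vol n)^-1)%:E *
    \int[theta]_(t in A n) ((cabs (F t)) ^+ 2)%:E) `^ 2^-1)%E @`
    [set n | nsq n F < (e / 2) ^+ 2]))).
  by apply: ereal_inf_lbound; exists [set n | nsq n F < (e / 2) ^+ 2].
apply: ge_ereal_sup => _ [n /= h <-]; rewrite besicovitch_term// poweR_EFin lee_fin.
have n0 := nsq_ge0 hausG haar_theta vhA n cF.
rewrite powR12_sqrt// -(ler_pXn2r (ltn0Sn 1)) ?nnegrE ?sqrtr_ge0 ?divr_ge0 ?(ltW e0)//.
by rewrite sqr_sqrtr// ltW.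
Qed.

End besicovitch_norm_limit.

(** * Existence of the limit of the autocorrelation approximants *)

Section autocorrelation_limit.
Context {R : realType} {G : topologicalZmodType}.
Hypothesis hausG : hausdorff_space G.
Hypothesis lcG : locally_compact [set: G].
Variable theta : {measure set (borel (pointed G)) -> \bar R}.
Hypothesis haar_theta : haar_measure theta.
Local Notation I := (haar_integral theta).

(** The compact set is chosen before [e], so that the bound on the approximants, uniform in [n] for
    functions supported in [K], has one constant for all errors. *)
Lemma approximate_identity (phi : G -> R[i]) : Cc phi -> exists2 K : set G, compact K &
  forall e, 0 < e -> exists g : G -> R[i], [/\ Cc g,
    forall x, ~ K x -> phi x - fun_conv theta phi g x = 0
  & forall x, cabs (phi x - fun_conv theta phi g x) <= e].
Proof.
move=> cp; have [K cK pK] := Cc_supp hausG cp.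
have [C C0 cC] := locally_compact_nbhs lcG 0.
exists (K `|` [set x + y | x in K & y in C]).
  by apply: compactU => //; exact: compact_sum.
move=> e e0; have e20 : 0 < e / 2 by rewrite divr_gt0.
pose U := [set u | forall x, cabs (phi (x - u) - phi x) < e / 2].
have U0 : nbhs (0 : G) U.
  have := Cc_uniform_continuous hausG cp e20 => uc.
  by have := @opp_continuous G 0; rewrite /continuous_at oppr0 => /(_ _ uc).
have [h [ch h0 hU h1]] := haar_bump hausG lcG haar_theta (filterI C0 U0).
pose g x := (h x)%:C; exists g.
have hC x : h x != 0 -> C x /\ U x.
  by move=> hx; apply: contrapT => nCU; rewrite hU ?eqxx in hx.
have cx x : Cc (fun s => phi (x - s) * g s).
  exact: (CcM hausG (Cc_subl hausG x cp) (Cc_ccont ch)).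
have E x : phi x - fun_conv theta phi g x = I (fun s => phi x * g s - phi (x - s) * g s).
  rewrite (haar_integralB hausG haar_theta (hintegrable_Cc hausG (CcZ hausG (phi x) ch))
    (hintegrable_Cc hausG (cx x))).
  by rewrite (haar_integralZ hausG haar_theta _ (hintegrable_Cc hausG ch)) h1 mulr1.
split=> [//|x nK|x].
  rewrite E (_ : (fun s => _) = (fun=> 0)) ?haar_integral0//.
  have px : phi x = 0 by apply: pK => Kx; apply: nK; left.
  apply/funext => s; rewrite px mul0r sub0r; have [hs|/hC[Cs _]] := eqVneq (h s) 0.
    by rewrite /g hs mulr0 oppr0.
  rewrite pK ?mul0r ?oppr0// => Kxs; apply: nK; right.
  by exists (x - s) => //; exists s => //; rewrite subrK.
rewrite E.
have hd : hintegrable (fun s => phi x * g s - phi (x - s) * g s).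
  exact: (hintegrable_Cc hausG (CcB hausG (CcZ hausG (phi x) ch) (cx x))).
have hg : hintegrable (fun s => (e / 2 * h s)%:C).
  have := hintegrable_Cc hausG (CcZ hausG (e / 2)%:C ch); congr hintegrable.
  by apply/funext => s; rewrite -realcM.
apply: le_trans (le_cabs_haar_integral hausG haar_theta hd hg _) _.
  move=> s; rewrite -mulrBl cabsM /g cabs_real ger0_norm//.
  have [->|/hC[_ Us]] := eqVneq (h s) 0; first by rewrite !mulr0.
  by rewrite ler_wpM2r// cabs_distC; apply: ltW; exact: Us.
have -> : (fun s => (e / 2 * h s)%:C) = (fun s => (e / 2)%:C * (h s)%:C).
  by apply/funext => s; rewrite -realcM.
rewrite (haar_integralZ hausG haar_theta _ (hintegrable_Cc hausG ch)) h1 mulr1/=.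
by rewrite mulrC divfK.
Qed.

Variable A : nat -> set G.
Hypothesis vhA : van_hove theta A.
Variable mu : (G -> R[i]) -> R[i].
Hypothesis radon_mu : cradon mu.
Hypothesis tb_mu : translation_bounded mu.
Local Notation gamma := (autocorrelation_approx theta A mu).
Local Notation nsq := (nsq theta A).
Local Notation ip := (ip theta A).
Local Notation rshift := (rshift mu).

Lemma rshiftD (c : R[i]) (f g : G -> R[i]) : Cc f -> Cc g ->
  rshift (fun x => f x + c * g x) = (fun w => rshift f w + c * rshift g w).
Proof.
move=> cf cg; apply/funext => w; rewrite /rshift.
have c1 := Cc_subr hausG w cf; have c2 := Cc_subr hausG w cg.
rewrite -(cradonZ hausG radon_mu c c2) -(cradonD radon_mu c1 (CcZ hausG c c2)).
by [].
Qed.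

Lemma ip_rshift_clim (f g : G -> R[i]) :
  (forall k : G -> R[i], Cc k -> exists r : R, nsq n (rshift k) @[n --> \oo] --> r) ->
  Cc f -> Cc g -> exists z, clim (fun n => ip n (rshift f) (rshift g)) z.
Proof.
move=> H cf cg.
have cF := rshift_ccont hausG lcG haar_theta radon_mu tb_mu cf.
have cG := rshift_ccont hausG lcG haar_theta radon_mu tb_mu cg.
have key (c : R[i]) : exists r : R, (fun n => complex.Re (c^* * ip n (rshift f) (rshift g)))
    @ \oo --> r.
  have [r1 l1] := H _ cf; have [r2 l2] := H _ (CcZ hausG c cg).
  have [r3 l3] := H _ (CcD hausG cf (CcZ hausG c cg)).
  exists ((r3 - r1 - r2) / 2).
  rewrite (_ : (fun n => _) = (fun n => (nsq n (rshift (fun x => f x + c * g x)) -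
      nsq n (rshift f) - nsq n (rshift (fun x => c * g x))) / 2)).
    by apply: cvgMl; apply: cvgB => //; exact: cvgB.
  apply/funext => n; rewrite (rshiftD c cf cg).
  have cZ : ccont (fun w => c * rshift g w) := ccontM (@ccont_cst R G c) cG.
  rewrite (nsqD hausG haar_theta vhA n cF cZ).
  have -> : rshift (fun x => c * g x) = (fun w => c * rshift g w).
    apply/funext => w; rewrite /rshift.
    by rewrite -(cradonZ hausG radon_mu c (Cc_subr hausG w cg)).
  rewrite (ipJ hausG haar_theta vhA n cZ cF) (ipZl hausG haar_theta vhA n c cG cF).
  rewrite (ipJ hausG haar_theta vhA n cF cG) conjcM conjc_K.
  by field.
(* Polarisation with [c = 1] gives the real part of the inner product, with [c = 'i] its imaginary
   part. *)
have [a la] := key 1; have [b lb] := key 'i.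
exists (a +i* b); apply: clim_ReIm.
  move: la; rewrite (_ : (fun n => _) = (fun n => complex.Re (ip n (rshift f) (rshift g))))//.
  by apply/funext => n; rewrite conjc_1 mul1r.
move: lb; rewrite (_ : (fun n => _) = (fun n => complex.Im (ip n (rshift f) (rshift g))))//.
by apply/funext => n; rewrite cReM cRe_conj cIm_conj/= mul0r sub0r mulN1r opprK.
Qed.

Lemma autocorrelation_clim phi :
  (forall k : G -> R[i], Cc k -> exists r : R, nsq n (rshift k) @[n --> \oo] --> r) ->
  Cc phi -> exists z, clim (fun n => gamma n phi) z.
Proof.
move=> H cp; have [K cK app] := approximate_identity cp.
have [C C0 bnd] := autocorrelation_bound hausG lcG haar_theta vhA radon_mu tb_mu cK.
apply: clim_ex => e e0; have eC : 0 < e / (4 * C) by rewrite divr_gt0// mulr_gt0.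
have [g [cg gK ge]] := app _ eC.
pose psi := fun_tilde g; have cpsi : Cc psi := Cc_tilde hausG cg.
have gE : g = fun_tilde psi by rewrite fun_tildeK.
have [z zlim] := ip_rshift_clim H cp cpsi.
have zlim' : clim (fun n => gamma n (fun_conv theta phi g)) z.
  apply: clim_dist0 zlim; rewrite gE.
  exact: (autocorrelation_conv_mean hausG lcG haar_theta vhA radon_mu tb_mu cp cpsi).
exists z; near=> n.
have cc := fun_conv_Cc hausG haar_theta cp cg.
have h1 : cabs (gamma n (fun_conv theta phi g) - z) < e / 2.
  by near: n; apply: zlim'; rewrite divr_gt0.
have cd := CcB hausG cp cc.
have h2 := bnd n _ _ cd gK ge.
have E : gamma n phi = gamma n (fun x => phi x - fun_conv theta phi g x) +
    gamma n (fun_conv theta phi g).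
  rewrite -[X in X + _]mul1r.
  rewrite -(autocorrelation_linear hausG lcG haar_theta vhA radon_mu tb_mu n 1 cd cc).
  by congr autocorrelation_approx; apply/funext => x; rewrite mul1r subrK.
rewrite E -addrA; apply: le_lt_trans (cabsD _ _) _.
have h3 : C * (e / (4 * C)) < e / 2.
  have -> : C * (e / (4 * C)) = e / 2 / 2 by field; rewrite gt_eqF.
  by rewrite ltr_pdivrMr// ltr_pMr ?divr_gt0// ltr1n.
by rewrite [e]splitr ltrD// (le_lt_trans h2).
Unshelve. all: by end_near. Qed.

End autocorrelation_limit.

(** * Pure point measures on the dual group *)

Section atomic_measure.
Context {R : realType} {X : ptopologicalType}.
Variable w : X -> R.
Hypothesis w0 : forall x, 0 <= w x.

(* The proof [w0] is recorded so that the measure instance below can be inferred. *)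
Definition atomic (B : set (borel X)) : \bar R :=
  let _ := w0 in \esum_(x in B) (w x)%:E.

Let atomic0 : atomic set0 = 0%E.
Proof. exact: esum_set0. Qed.

Let atomic_ge0 B : (0 <= atomic B)%E.
Proof. by apply: esum_ge0 => x _; rewrite lee_fin. Qed.

Let atomic_sigma_additive : semi_sigma_additive atomic.
Proof.
move=> F mF tF mUF.
have -> : atomic (\bigcup_n F n) = (\sum_(n <oo) atomic (F n))%E.
  by rewrite /atomic esum_bigcupT// nneseries_esumT// => n; exact: atomic_ge0.
by apply: is_cvg_nneseries => n _ _; exact: atomic_ge0.
Qed.

HB.instance Definition _ := isMeasure.Build _ _ _ atomic
  atomic0 atomic_ge0 atomic_sigma_additive.

Lemma atomic_set1 x : atomic [set x] = (w x)%:E.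
Proof. by rewrite /atomic esum_set1// lee_fin. Qed.

Lemma atomic_pure_point : pure_point atomic.
Proof. by move=> B _; apply: eq_esum => x _; rewrite atomic_set1. Qed.

(** The sum is a supremum over finite subsets, and finite sets are compact. *)
Lemma atomic_inner_regular (B : set (borel X)) :
  atomic B = ereal_sup [set atomic K | K in [set K : set X | compact K /\ K `<=` B]].
Proof.
apply/eqP; rewrite eq_le; apply/andP; split; last first.
  apply: ge_ereal_sup => _ [K [_ KB] <-].
  apply: ge_ereal_sup => _ [F [finF FK] <-].
  by apply: ereal_sup_ubound; exists F => //; split => // x /FK /KB.
apply: ge_ereal_sup => _ [F [finF FB] <-].
apply: ereal_sup_ubound; exists F; first by split => //; exact: finite_compact.
by rewrite /atomic esum_fset// => x _; rewrite lee_fin.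
Qed.

End atomic_measure.

Section pure_point_integral.
Import HBNNSimple.
Context {R : realType} {X : ptopologicalType}.
Hypothesis set1_measurable : forall x : X, measurable ([set x] : set (borel X)).
Variable nu : {measure set (borel X) -> \bar R}.
Hypothesis pp : pure_point nu.

(** As [f] is merely nonnegative, the integral is handled as a supremum over simple functions below
    [f]. Level sets of such functions give one inequality, finite sums of weighted indicators of
    points the other. *)
Lemma pure_point_integral (f v : X -> R) : (forall x, 0 <= f x) -> (forall x, 0 <= v x) ->
  (forall x, nu [set x] = (v x)%:E) ->
  (\int[nu]_x (f x)%:E)%E = \esum_(x in [set: X]) (f x * v x)%:E.
Proof.
move=> f0 v0 nuv.
pose g x := f x * v x; have g0 x : 0 <= g x by rewrite mulr_ge0.
rewrite ge0_integralTE; last by move=> x; rewrite lee_fin.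
apply/eqP; rewrite eq_le; apply/andP; split.
  apply: ge_ereal_sup => _ [h hf <-].
  rewrite sintegralE.
  have mh (y : R) : measurable ((fun x : borel X => h x) @^-1` [set y]).
    exact: measurable_funPTI.
  (* On the level set of [y] the constant [y] is at most [f], so its contribution is at most the
     mass of that set for the weight [f * v]. The level sets are disjoint, so these masses add up to
     at most the total sum. *)
  apply: (@le_trans _ _ (\sum_(y \in range h) atomic g0 (h @^-1` [set y]))%E).
    apply: lee_fsum; first exact: fimfunP.
    move=> y [x _ <-]; set S := _ @^-1` _.
    have hx0 : 0 <= h x by exact: fun_ge0.
    have [->|hx] := eqVneq (h x) 0.
      by rewrite mul0e; apply: esum_ge0 => z _; rewrite lee_fin.
    have hxp : 0 < h x by rewrite lt_def hx.
    rewrite muleC -lee_pdivlMr// pp; last exact: mh.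
    apply: ge_ereal_sup => _ [F [finF FS] <-].
    rewrite lee_pdivlMr//.
    apply: (@le_trans _ _ (\sum_(z \in F) (g z)%:E)%E); last first.
      by apply: ereal_sup_ubound; exists F.
    rewrite muleC ge0_mule_fsumr; last by move=> z; exact: measure_ge0.
    apply: lee_fsum => // z /FS Sz; rewrite nuv -EFinM lee_fin.
    by rewrite /g ler_wpM2r// -(Sz : h z = h x) -lee_fin hf.
  have tr : trivIset (range h) (fun y => h @^-1` [set y]) by move=> i j _ _ [z [/= <- <-]].
  have E := measure_fsbig (atomic g0 : {measure set (borel X) -> \bar R})
    (fimfunP h) (fun y _ => mh y) tr.
  rewrite -E.
  apply: ge_ereal_sup => _ [F [finF FS] <-].
  by apply: ereal_sup_ubound; exists F.
apply: ge_ereal_sup => _ [F [finF _] <-].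
pose s := fset_set F : seq X.
have us : uniq s by exact: fset_uniq.
pose phi (y : borel X) : \bar R := (\sum_(x <- s) (f x * \1_[set x] y)%:E)%E.
have phi_le y : (phi y <= (f y)%:E)%E.
  have off x : x != y -> (f x * \1_[set x] y)%:E = 0%E.
    by move=> xy; rewrite indicE memNset ?mulr0// => yx; rewrite yx eqxx in xy.
  have [ys|nys] := boolP (y \in s).
    rewrite /phi (bigD1_seq y)//= big1 ?adde0; last by move=> x; exact: off.
    by rewrite lee_fin indicE mem_set// mulr1.
  rewrite /phi big1_seq ?lee_fin// => x /andP[_ xs]; apply: off.
  by apply: contraNneq nys => <-.
have mi (x : X) : measurable_fun [set: borel X] (\1_[set x] : borel X -> R).
  by apply: measurable_indic; exact: set1_measurable.
have phi_int : (\int[nu]_y phi y = \sum_(x <- s) (g x)%:E)%E.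
  rewrite /phi ge0_integral_sum//.
  - apply: eq_bigr => x _; under eq_integral do rewrite EFinM.
    rewrite ge0_integralZl_EFin//; last first.
      exact/measurable_EFinP.
    by rewrite integral_indic// setIT nuv -EFinM.
  - move=> x; apply/measurable_EFinP; exact: measurable_funM.
  - by move=> x y _; rewrite lee_fin mulr_ge0.
rewrite fsbig_finite//= -/s -phi_int ge0_integralTE; last first.
  by move=> y; rewrite /phi sume_ge0// => x _; rewrite lee_fin mulr_ge0.
apply: ge_ereal_sup => _ [h hphi <-]; apply: ereal_sup_ubound; exists h => // x.
exact: le_trans (hphi x) (phi_le x).
Qed.

End pure_point_integral.

(** * Topology of the dual group *)

Section dual_topology.
Context {R : realType} {G : topologicalZmodType}.

Lemma dual_compact_open (K : set G) (O : set R[i]^o) : compact K -> open O ->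
  open [set chi : dual R G | forall t, K t -> O (chi t)].
Proof.
move=> cK oO.
exists [set g : {compact-open, G -> R[i]^o} | g @` K `<=` O].
  exact: compact_open_open.
apply/seteqP; split=> [chi H t Kt|chi H _ [t Kt <-]]; last exact: H.
by apply: H; exists t.
Qed.

Lemma dual_hausdorff : hausdorff_space (dual R G).
Proof.
rewrite open_hausdorff => chi psi ne.
have [t tne] : exists t, chi t != psi t.
  apply: contrapT => /forallNP H; move/negP: ne; apply; apply/eqP/dual_ext => t.
  by apply/eqP/negPn/negP; exact: H.
have hC : hausdorff_space R[i]^o by exact: norm_hausdorff.
move: hC; rewrite open_hausdorff => /(_ (chi t) (psi t) tne).
move=> [[V1 V2] [V1c V2p] [oV1 oV2 V12]].
exists ([set x : dual R G | forall s, [set t] s -> V1 (x s)],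
  [set x : dual R G | forall s, [set t] s -> V2 (x s)]) => /=.
  by split; rewrite inE => _ ->; [rewrite inE in V1c|rewrite inE in V2p].
split; [exact: (dual_compact_open (@compact_set1 _ t) oV1)
  |exact: (dual_compact_open (@compact_set1 _ t) oV2)|].
apply/eqP/seteqP; split => // x [/= x1 x2].
by move/eqP/seteqP: V12 => [+ _] => /(_ (x t)); apply; split; [exact: x1|exact: x2].
Qed.

Lemma dual_set1_measurable (chi : dual R G) : measurable ([set chi] : set (borel (dual R G))).
Proof.
rewrite -[X in measurable X]setCK; apply: measurableC; apply: sub_sigma_algebra.
by rewrite /= openC; apply: accessible_closed_set1; exact/hausdorff_accessible/dual_hausdorff.
Qed.

End dual_topology.

(** * The measure of squared coefficients is a Radon measure *)

Section atomic_radon.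
Context {R : realType} {G : topologicalZmodType}.
Hypothesis hausG : hausdorff_space G.
Hypothesis lcG : locally_compact [set: G].
Variable theta : {measure set (borel (pointed G)) -> \bar R}.
Hypothesis haar_theta : haar_measure theta.
Variable w : dual R G -> R.
Hypothesis w0 : forall chi, 0 <= w chi.
Hypothesis w_fin : forall f : G -> R[i], Cc f ->
  (\esum_(chi in [set: dual R G]) ((cabs (fcheck theta f chi)) ^+ 2 * w chi)%:E < +oo)%E.

(* Near [chi0] the transform of a bump concentrated where [chi0] is close to [1]
   is bounded away from zero. *)
Lemma atomic_locally_finite (chi0 : dual R G) :
  exists W : set (dual R G), [/\ open W, W chi0 & (atomic w0 W < +oo)%E].
Proof.
have [C C0 cC] := locally_compact_nbhs lcG 0.
pose g t := cabs (chi0 t - 1).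
have cg : continuous g.
  exact: (continuous_cabs (ccontB (@dual_ccont _ _ chi0) (@ccont_cst R G 1))).
have g0 : g 0 = 0.
  rewrite /g; have := dual_add chi0 0 0; rewrite addr0 => E.
  have /mulfI : chi0 0 != 0.
    by apply/eqP => z; have := dual_abs chi0 0; rewrite z cabs0 => /eqP; rewrite eq_sym oner_eq0.
  by move/(_ (chi0 0) 1); rewrite mulr1 => /(_ (esym E)) ->; rewrite subrr cabs0.
(* The weak inequality keeps [D] compact, and [8^-1 < 4^-1] puts [chi0] inside the open set of
   characters within [4^-1] of 1 on [D]. For such characters the transform of the bump is within
   [2 * 4^-1] of 1. *)
pose D := C `&` [set t | g t <= 8^-1].
have D0 : nbhs 0 D.
  apply: filterI => //; have /cvgr_lt/(_ 8^-1) := cg 0.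
  rewrite g0 invr_gt0 ltr0n => /(_ isT); apply: filterS => t /ltW; exact.
have cD : compact D.
  apply: compact_closedI => //; apply: (@closed_comp _ _ g [set x | x <= 8^-1]).
    by move=> x _; exact: cg.
  exact: closed_le.
have [h [ch h0 hD hI]] := haar_bump hausG lcG haar_theta D0.
pose O : set R[i]^o := [set z | cabs (z - 1) < 4^-1].
have oO : open O.
  apply: (@open_comp _ _ (fun z : R[i]^o => cabs (z - 1)) [set x | x < 4^-1]).
    move=> z _; apply: (@continuous_cabs _ (R[i]^o) (fun z => z - 1)).
    by apply: ccontB; [move=> x; exact: cvg_id|exact: ccont_cst].
  exact: open_lt.
exists [set chi : dual R G | forall t, D t -> O (chi t)]; split.
- exact: dual_compact_open.
- move=> t [_ gt]; apply: le_lt_trans gt _.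
  by rewrite ltf_pV2 ?posrE// ltr_nat.
(* The transform of the bump has modulus at least 1/2 on the neighbourhood, so doubling makes that
   of [k] at least 1 and the summable weights dominate [w] there. *)
pose k t : R[i] := 2%:C * (h t)%:C.
have ck : Cc k := CcZ hausG 2%:C ch.
apply: le_lt_trans (w_fin ck).
apply: ge_ereal_sup => _ [F [finF FW] <-].
apply: (@le_trans _ _ (\sum_(chi \in F) ((cabs (fcheck theta k chi)) ^+ 2 * w chi)%:E)%E); last first.
  by apply: ereal_sup_ubound; exists F => //; split.
apply: lee_fsum => // chi /FW Wchi; rewrite lee_fin.
rewrite -[leLHS]mul1r ler_wpM2r// -(expr1n _ 2) ler_pXn2r ?nnegrE ?cabs_ge0//.
have cchi := @dual_ccont _ _ chi.
have -> : fcheck theta k chi = 2%:C * haar_integral theta (fun t => chi t * (h t)%:C).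
  have := haar_integralZ hausG haar_theta 2%:C (hintegrable_Cc hausG (CcMl hausG cchi ch)).
  by move=> <-; congr haar_integral; apply/funext => t; rewrite /k mulrCA.
rewrite cabsM cabs_real ger0_norm//.
set J := haar_integral _ _.
have : cabs (J - 1) <= 2^-1.
  rewrite -hI -(haar_integralB hausG haar_theta (hintegrable_Cc hausG (CcMl hausG cchi ch))
    (hintegrable_Cc hausG ch)).
  have hc4 := hintegrable_Cc hausG (CcZ hausG (4^-1)%:C ch).
  have E : (fun t => (4^-1)%:C * (h t)%:C) = (fun t => (4^-1 * h t)%:C :> R[i]).
    by apply/funext => t; rewrite -realcM.
  have H := @le_cabs_haar_integral _ _ hausG _ haar_theta (fun t => chi t * (h t)%:C - (h t)%:C)
    (fun t => 4^-1 * h t) (hintegrableB hausG (hintegrable_Cc hausG (CcMl hausG cchi ch))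
      (hintegrable_Cc hausG ch)).
  rewrite E in hc4; apply: (le_trans (H hc4 _)); last first.
    rewrite -E (haar_integralZ hausG haar_theta (4^-1)%:C (hintegrable_Cc hausG ch)) hI mulr1/=.
    lra.
  move=> t; rewrite -[X in _ - X]mul1r -mulrBl cabsM cabs_real ger0_norm//.
  have [Dt|nDt] := pselect (D t); last by rewrite hD// !mulr0.
  by rewrite ler_wpM2r// ltW//; exact: Wchi.
have := cabs_sub_le 1 0 J; rewrite !subr0 cabs1.
by rewrite cabs_distC; lra.
Qed.

Lemma atomic_radon : radon_measure (atomic w0).
Proof.
split; last by move=> B _; exact: atomic_inner_regular.
move=> K cK.
pose W chi := sval (cid (atomic_locally_finite chi)).
have WP chi : [/\ open (W chi), W chi chi & (atomic w0 (W chi) < +oo)%E].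
  exact: svalP (cid (atomic_locally_finite chi)).
have : compact K := cK; rewrite compact_cover => /(_ (dual R G) setT W).
case=> [chi _|chi _|F _ KF]; first by have [] := WP chi.
  by exists chi => //; have [] := WP chi.
have mW chi : measurable (W chi : set (borel (dual R G))).
  by apply: sub_sigma_algebra; have [] := WP chi.
have mK : measurable (K : set (borel (dual R G))).
  rewrite -[X in measurable X]setCK; apply: measurableC; apply: sub_sigma_algebra.
  by rewrite /= openC; exact: compact_closed (@dual_hausdorff _ _) cK.
have := content_sub_fsum (atomic w0) (finite_fset F) (fun chi _ => mW chi) mK KF.
move=> /le_lt_trans; apply.
rewrite fsbig_finite; last exact: finite_fset.
apply: (big_ind (fun x : \bar R => (x < +oo)%E)) => //= [x y|chi _].
  exact: lte_add_pinfty.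
by have [] := WP chi.
Qed.

End atomic_radon.

(** * The characterisation *)

Section esum_real.
Context {R : realType} {T : choiceType}.
Variables (c : T -> R) (r : R).
Hypothesis c0 : forall x, 0 <= c x.

Lemma esum_approx : \esum_(x in [set: T]) (c x)%:E = r%:E ->
  forall e, 0 < e -> exists2 s : seq T, uniq s & r <= \sum_(x <- s) c x + e.
Proof.
move=> E e e0.
have : (r%:E - e%:E < \esum_(x in [set: T]) (c x)%:E)%E.
  by rewrite E -EFinB lte_fin ltrBlDr ltrDl.
move=> /ereal_sup_gt[_ [F [finF _] <-]].
rewrite fsbig_finite//= sumEFin -EFinB lte_fin ltrBlDr => /ltW re.
by exists (fset_set F); [exact: fset_uniq|exact: re].
Qed.

Lemma esum_lub : (forall s : seq T, uniq s -> \sum_(x <- s) c x <= r) ->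
  (forall e, 0 < e -> exists2 s : seq T, uniq s & r <= \sum_(x <- s) c x + e) ->
  \esum_(x in [set: T]) (c x)%:E = r%:E.
Proof.
move=> ub app; apply/eqP; rewrite eq_le; apply/andP; split.
  apply: ge_ereal_sup => _ [F [finF _] <-].
  by rewrite fsbig_finite//= sumEFin lee_fin; apply: ub; exact: fset_uniq.
apply/lee_addgt0Pr => e e0; have [s us re] := app e e0.
apply: (@le_trans _ _ (\sum_(x <- s) c x + e)%:E); first by rewrite lee_fin.
rewrite EFinD leeD2r//; apply: ereal_sup_ubound.
exists [set` s]; first by split => //; exact: finite_seq.
by rewrite -fsbig_seq// sumEFin.
Qed.

End esum_real.

Section besicovitch_measure.
Context {R : realType} {G : topologicalZmodType}.
Hypothesis hausG : hausdorff_space G.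
Hypothesis lcG : locally_compact [set: G].
Variable theta : {measure set (borel (pointed G)) -> \bar R}.
Hypothesis haar_theta : haar_measure theta.
Variable A : nat -> set G.
Hypothesis vhA : van_hove theta A.
Variable mu : (G -> R[i]) -> R[i].
Hypothesis radon_mu : cradon mu.
Hypothesis tb_mu : translation_bounded mu.
Local Notation gamma_ := (autocorrelation_approx theta A mu).
Local Notation nsq := (nsq theta A).
Local Notation ip := (ip theta A).
Local Notation rshift := (rshift mu).
Local Notation fbm := (fourier_bohr_mean theta A mu).
Implicit Types (chi : dual R G) (f : G -> R[i]) (b : R[i]) (r : R).

Lemma radon_fun_conv_rshift phi : radon_fun_conv mu phi = rshift (fun x => phi (- x)).
Proof.
by apply/funext => t; congr mu; apply/funext => s; rewrite opprB.
Qed.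

Lemma fourier_bohr_clim chi : fourier_bohr_exists theta A mu chi ->
  clim (fbm chi) (fourier_bohr theta A mu chi).
Proof. by move=> H; apply/climP. Qed.

Lemma clim_fourier_bohr chi b : clim (fbm chi) b ->
  fourier_bohr_exists theta A mu chi /\ fourier_bohr theta A mu chi = b.
Proof.
move=> /climP H; split; first by apply/cvg_ex; exists b.
have hC : hausdorff_space R[i]^o by exact: norm_hausdorff.
exact: (cvg_lim hC H).
Qed.

Lemma clim_ip_rshift chi f b : Cc f -> clim (fbm chi) b ->
  clim (fun n => ip n (rshift f) chi) (b * fcheck theta f chi).
Proof.
move=> cf fb.
have H := fourier_bohr_mean_rshift hausG lcG haar_theta vhA radon_mu tb_mu chi cf.
have -> : (fun n => ip n (rshift f) chi) =
    (fun n => mean theta A n (fun u => (chi u)^* * rshift f u)).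
  apply/funext => n; rewrite /ip; apply: (congr1 (mean theta A n)).
  by apply/funext => x; rewrite mulrC.
apply: (clim_dist0 H); rewrite mulrC.
have -> : (fun n => fbm chi n * fcheck theta f chi) =
    (fun n => fcheck theta f chi * fbm chi n) by apply/funext => n; rewrite mulrC.
exact: climZ.
Qed.

(** For a normalised bump multiplied by the conjugate of [chi], the transform at [chi] is 1, so the
    coefficient of the convolution is that of [mu] itself. *)
Lemma fourier_bohr_mean_clim chi :
  (forall f, Cc f -> exists z, clim (fun n => ip n (rshift f) chi) z) ->
  exists b, clim (fbm chi) b.
Proof.
move=> H; have [h [ch _ _ hI]] := haar_bump hausG lcG haar_theta (@filterT _ (nbhs (0 : G)) _).
have cchi := @dual_ccont _ _ chi.
pose k t := (chi t)^* * (h t)%:C; have ck : Cc k := CcMl hausG (ccontJ cchi) ch.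
have fk : fcheck theta k chi = 1.
  rewrite -hI /fcheck; congr haar_integral; apply/funext => t.
  by rewrite /k mulrA mulcJ dual_abs expr1n mul1r.
have [z zlim] := H k ck; exists z.
have := fourier_bohr_mean_rshift hausG lcG haar_theta vhA radon_mu tb_mu chi ck.
rewrite fk => /climN; rewrite oppr0 => L.
apply: (@clim_dist0 _ _ (fun n => ip n (rshift k) chi)) zlim.
move: L; congr clim; apply/funext => n; rewrite opprB mulr1; congr (_ - _).
rewrite /ip; apply: (congr1 (mean theta A n)).
by apply/funext => x; rewrite mulrC.
Qed.

Lemma autocorrelation_conv_nsq f r : Cc f -> nsq n (rshift f) @[n --> \oo] --> r ->
  clim (fun n => gamma_ n (fun_conv theta f (fun_tilde f))) r%:C.
Proof.
move=> cf /clim_real L.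
have H := autocorrelation_conv_mean hausG lcG haar_theta vhA radon_mu tb_mu cf cf.
apply: (clim_dist0 H); move: L; congr clim; apply/funext => n.
rewrite -(ip_nsq hausG haar_theta vhA) //.
exact: (rshift_ccont hausG lcG haar_theta radon_mu tb_mu cf).
Qed.

Lemma autocorrelation_nsq f r : Cc f ->
  clim (fun n => gamma_ n (fun_conv theta f (fun_tilde f))) r%:C ->
  nsq n (rshift f) @[n --> \oo] --> r.
Proof.
move=> cf L.
have H := autocorrelation_conv_mean hausG lcG haar_theta vhA radon_mu tb_mu cf cf.
have {}H : clim (fun n => ip n (rshift f) (rshift f)) r%:C.
  apply: clim_dist0 L; move: (climN H); rewrite oppr0; congr clim.
  by apply/funext => n; rewrite opprB.
exact: (clim_Re H).
Qed.

Lemma autocorrelation_is_limit (gamma : (G -> R[i]) -> R[i]) :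
  (forall phi, Cc phi -> clim (fun n => gamma_ n phi) (gamma phi)) ->
  is_autocorrelation theta A mu gamma.
Proof.
move=> H; split; last by move=> phi /H/climP.
split=> [a f g cf cg|K cK].
  have cafg : Cc (fun x => a * f x + g x) := CcD hausG (CcZ hausG a cf) cg.
  apply: (clim_unique (H _ cafg)).
  have := climD (climZ a (H _ cf)) (H _ cg); congr clim; apply/funext => n.
  by rewrite (autocorrelation_linear hausG lcG haar_theta vhA radon_mu tb_mu n a cf cg).
have [C C0 bnd] := autocorrelation_bound hausG lcG haar_theta vhA radon_mu tb_mu cK.
exists C => f m cf fK fm; apply: (clim_cabs_le (H _ cf)).
by apply: nearW => n; exact: bnd.
Qed.

Lemma besicovitch_ap_parseval f : besicovitch_ap_measure theta A mu -> Cc f ->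
  exists (a : dual R G -> R[i]) (r : R),
  [/\ forall chi, clim (fun n => ip n (rshift f) chi) (a chi),
      nsq n (rshift f) @[n --> \oo] --> r
    & \esum_(chi in [set: dual R G]) ((cabs (a chi)) ^+ 2)%:E = r%:E].
Proof.
move=> ap cf.
have cF := rshift_ccont hausG lcG haar_theta radon_mu tb_mu cf.
have [_] := ap _ (Cc_opp hausG cf).
have -> : radon_fun_conv mu (fun x => f (- x)) = rshift f.
  rewrite radon_fun_conv_rshift; apply: (congr1 rshift).
  by apply/funext => x; rewrite opprK.
move=> app; have [e e0|a [r [La Lr ub lub]]] := besicovitch_parseval hausG haar_theta vhA cF.
  (* The seminorm is a square root of means, whereas [nsq] is their unrooted value. *)
  have se0 : 0 < Num.sqrt e by rewrite sqrtr_gt0.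
  have [P tP PF] := app _ se0; have [l Pl] := trig_poly_lpoly tP.
  exists l; have := besicovitch_norm_lt hausG haar_theta vhA _ PF.
  rewrite Pl sqr_sqrtr ?ltW//; apply.
  exact: (ccontB cF (@lpoly_ccont _ _ l)).
by exists a, r; split => //; apply: esum_lub => // chi.
Qed.

Lemma besicovitch_ap_measure_autocorrelation : besicovitch_ap_measure theta A mu ->
  exists (gamma : (G -> R[i]) -> R[i])
         (gammahat : {measure set (borel (dual R G)) -> \bar R}),
    [/\ [/\ is_autocorrelation theta A mu gamma,
            is_fourier_transform theta gamma gammahat
          & pure_point gammahat],
        forall chi : dual R G, fourier_bohr_exists theta A mu chi
      & forall chi : dual R G,
          gammahat [set chi] = ((cabs (fourier_bohr theta A mu chi)) ^+ 2)%:E].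
Proof.
move=> ap; have P f cf := @besicovitch_ap_parseval f ap cf.
have fbe chi : fourier_bohr_exists theta A mu chi.
  have [|b /clim_fourier_bohr[]//] := @fourier_bohr_mean_clim chi.
  by move=> f /P[a [r [La _ _]]]; exists (a chi).
pose w chi := (cabs (fourier_bohr theta A mu chi)) ^+ 2.
have w0 chi : 0 <= w chi by exact: sqr_ge0.
have W f : Cc f -> exists2 r : R, nsq n (rshift f) @[n --> \oo] --> r &
    \esum_(chi in [set: dual R G]) ((cabs (fcheck theta f chi)) ^+ 2 * w chi)%:E = r%:E.
  move=> cf; have [a [r [La Lr Er]]] := P f cf; exists r => //.
  rewrite -Er; apply: eq_esum => chi _; congr EFin.
  (* The coefficients supplied by Parseval's identity depend on [f]; uniqueness of limits factors
     each as a Fourier-Bohr coefficient of [mu] times the transform of [f]. *)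
  have /(clim_unique (La chi)) -> := clim_ip_rshift cf (fourier_bohr_clim (fbe chi)).
  by rewrite cabsM exprMn mulrC.
(* Outside C_c(G) the value of [gamma] is irrelevant, and 0 is taken. *)
have /choice[gamma gammaP] : forall phi, exists z, Cc phi -> clim (fun n => gamma_ n phi) z.
  move=> phi; have [cp|ncp] := pselect (Cc phi); last by exists 0.
  have [|z] := @autocorrelation_clim _ _ hausG lcG _ haar_theta _ vhA _ radon_mu tb_mu phi _ cp.
    by move=> k /W[r]; exists r.
  by exists z.
exists gamma, (atomic w0); split=> //; last by move=> chi; exact: atomic_set1.
split; [exact: autocorrelation_is_limit|split|exact: atomic_pure_point].
  by apply: (atomic_radon hausG lcG haar_theta) => f /W[r _ ->]; exact: ltry.
move=> phi cp; have [r Lr Er] := W phi cp; exists r.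
  apply: clim_unique (autocorrelation_conv_nsq cp Lr); apply: gammaP.
  exact: (fun_conv_Cc hausG haar_theta cp (Cc_tilde hausG cp)).
rewrite -Er; apply: (pure_point_integral (@dual_set1_measurable R G) (atomic_pure_point w0)) => // chi.
  exact: sqr_ge0.
exact: atomic_set1.
Qed.

Lemma autocorrelation_besicovitch_ap_measure (gamma : (G -> R[i]) -> R[i])
    (gammahat : {measure set (borel (dual R G)) -> \bar R}) :
  is_autocorrelation theta A mu gamma -> is_fourier_transform theta gamma gammahat ->
  pure_point gammahat -> (forall chi, fourier_bohr_exists theta A mu chi) ->
  (forall chi, gammahat [set chi] = ((cabs (fourier_bohr theta A mu chi)) ^+ 2)%:E) ->
  besicovitch_ap_measure theta A mu.
Proof.
move=> [_ gammaP] [_ gammahatP] pp fbe cpp phi cphi.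
pose f x := phi (- x); have cf : Cc f := Cc_opp hausG cphi.
have cF := rshift_ccont hausG lcG haar_theta radon_mu tb_mu cf.
rewrite radon_fun_conv_rshift -/f; split; first exact: L2loc_ccont.
have [r gr intr] := gammahatP f cf.
pose a chi := fourier_bohr theta A mu chi * fcheck theta f chi.
have La chi : clim (fun n => ip n (rshift f) chi) (a chi).
  exact: clim_ip_rshift cf (fourier_bohr_clim (fbe chi)).
have Lr : nsq n (rshift f) @[n --> \oo] --> r.
  (* The existing autocorrelation, tested on [f] convolved with its tilde, supplies the limit of the
     means of the squared modulus. *)
  apply: autocorrelation_nsq => //; rewrite -gr; apply/climP/gammaP.
  exact: (fun_conv_Cc hausG haar_theta cf (Cc_tilde hausG cf)).
have Ea : \esum_(chi in [set: dual R G]) ((cabs (a chi)) ^+ 2)%:E = r%:E.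
  rewrite -intr (pure_point_integral (@dual_set1_measurable R G) pp
    (fun chi => sqr_ge0 _) (fun chi => sqr_ge0 _) cpp).
  by apply: eq_esum => chi _; rewrite cabsM exprMn mulrC.
move=> e e0; have e2 : 0 < (e / 2) ^+ 2 by rewrite exprn_gt0// divr_gt0.
have [s sF] := parseval_besicovitch hausG haar_theta vhA cF La Lr
  (esum_approx Ea) e2.
exists (tpoly s a); first exact: tpoly_trig.
exact: (lt_besicovitch_norm hausG haar_theta vhA (ccontB cF (@tpoly_ccont _ _ s a)) e0 sF).
Qed.

End besicovitch_measure.

Theorem theorem4p39 (R : realType) (G : topologicalZmodType)
  (hausG : hausdorff_space G) (lcG : locally_compact [set: G])
  (scG : sigma_compact G)
  (theta : {measure set (borel (pointed G)) -> \bar R}) (haar_theta : haar_measure theta)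
  (A : nat -> set G) (vhA : van_hove theta A)
  (mu : (G -> R[i]) -> R[i]) (radon_mu : cradon mu)
  (tb_mu : translation_bounded mu) :
  besicovitch_ap_measure theta A mu <->
  exists (gamma : (G -> R[i]) -> R[i])
         (gammahat : {measure set (borel (dual R G)) -> \bar R}),
    [/\ [/\ is_autocorrelation theta A mu gamma,
            is_fourier_transform theta gamma gammahat
          & pure_point gammahat],
        forall chi : dual R G, fourier_bohr_exists theta A mu chi
      & forall chi : dual R G,
          gammahat [set chi] = ((cabs (fourier_bohr theta A mu chi)) ^+ 2)%:E].
Proof.
split; first exact: (besicovitch_ap_measure_autocorrelation hausG lcG haar_theta vhA).
move=> [gamma [gammahat [[ac ft pp] fb cp]]].
exact: (autocorrelation_besicovitch_ap_measure hausG lcG haar_theta vhA radon_mu tb_mu ac ft).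
Qed.
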